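(* Let $\varphi:(G,P)\to(\mathcal G,\mathcal P)$ be a controlled map between quasi-lattice ordered groups and let $X$ be a closed invariant subset of the Nica spectrum $\Omega$ of $(G,P)$. If $\mathcal G$ is an amenable group, then the conditional expectation $\Phi:C(X)\rtimes G\to C(X)$ is faithful on positive elements, and so the canonical partial action of $G$ restricted to $C(X)$ is amenable.
   Context: Groups are countable. A quasi-lattice ordered group $(G,P)$ is a group $G$ with a submonoid $P$ with $P\cap P^{-1}=\{e\}$ such that, for the left-invariant partial order $x\le y\iff x^{-1}y\in P$, every two elements of $G$ having a common upper bound have a least upper bound $x\vee y$; write $x\vee y=\infty$ if there is no common upper bound. Controlled map: an order-preserving homomorphism $\varphi:(G,P)\to(\mathcal G,\mathcal P)$ of quasi-lattice ordered groups such that (C1) the restriction $\varphi_P:P\to\mathcal P$ is finite-to-one, and (C2) for all $x,y\in P$ with $x\vee y\neq\infty$ one has $\varphi(x)\vee\varphi(y)=\varphi(x\vee y)$. Nica spectrum: $\Omega$ is the set of $\omega\subset G$ with $e\in\omega$ that are hereditary ($\omega P^{-1}\subset\omega$) and directed ($x\vee y\ne\infty$ and $x\vee y\in\omega$ for $x,y\in\omega$), with the (compact Hausdorff) topology from $\{0,1\}^G$. $G$ acts partially on $\Omega$ by $\theta_t:U_{t^{-1}}\to U_t$, $\omega\mapsto t\omega$, where $U_t=\{\omega:t\in\omega\}$. $X\subset\Omega$ is invariant if $\theta_t(X\cap U_{t^{-1}})\subset X$ for all $t$. Crossed products: for closed invariant $X$ let $D_t=C_0(U_t\cap X)$ and $\alpha_t:D_{t^{-1}}\to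 D_t$, $f\mapsto f\circ\theta_{t^{-1}}$. $C(X)\rtimes G$ is the full partial crossed product: the universal C*-completion of the $*$-algebra of finite sums $\sum f_t\delta_t$, $f_t\in D_t$, with $(f\delta_s)(g\delta_t)=\alpha_s(\alpha_{s^{-1}}(f)g)\delta_{st}$ and $(f\delta_t)^*=\alpha_{t^{-1}}(\bar f)\delta_{t^{-1}}$. $\Phi$ is the conditional expectation with $\Phi(f\delta_g)=f$ if $g=e$ and $0$ otherwise. The partial action on $X$ is amenable if the canonical map from the full to the reduced crossed product is an isomorphism; equivalently, $\Phi$ is faithful on positive elements. *)

(* Defs.v *)
From HB Require Import structures.
From mathcomp Require Import all_boot all_order all_algebra.
From mathcomp Require Import finmap complex.
From mathcomp Require Import all_classical all_reals all_analysis.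

Set Implicit Arguments.
Unset Strict Implicit.
Unset Printing Implicit Defensive.
Import Order.TTheory GRing.Theory Num.Theory numFieldNormedType.Exports.

Local Open Scope classical_set_scope.
Local Open Scope ring_scope.
Local Open Scope complex_scope.

(* The usual topology and norm of the complex numbers [R[i]]; the library has
   them on the alias [R[i]^o] only. *)
HB.instance Definition _ (R : realType) := NormedModule.copy R[i] (R[i])^o.

Section QuasiLattice.
Context (G : groupType) (P : set G).

Definition ql_le (x y : G) : Prop := P (x^-1 * y)%g.

Definition ql_ub (x y z : G) : Prop := ql_le x z /\ ql_le y z.

(* [ql_join x y z] means that x \/ y exists and equals z; x \/ y <> oo is
   [exists z, ql_join x y z]. *)
Definition ql_join (x y z : G) : Prop :=
  ql_ub x y z /\ forall w, ql_ub x y w -> ql_le z w.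

Definition quasi_lattice_ordered : Prop :=
  [/\ P 1%g,
      forall x y, P x -> P y -> P (x * y)%g,
      forall x, P x -> P (x^-1)%g -> x = 1%g
    & forall x y, (exists z, ql_ub x y z) -> exists z, ql_join x y z].

(* Subsets of G are elements of {0,1}^G, with its product topology. *)
Definition hereditary (w : {ptws G -> bool}) : Prop :=
  forall x p, w x -> P p -> w (x * p^-1)%g.

Definition directed (w : {ptws G -> bool}) : Prop :=
  forall x y, w x -> w y -> exists2 z, ql_join x y z & w z.

Definition nica_spectrum : set {ptws G -> bool} :=
  [set w : {ptws G -> bool} | [/\ w 1%g, hereditary w & directed w]].

End QuasiLattice.

Definition controlled_map (G H : groupType) (P : set G) (Q : set H)
    (phi : G -> H) : Prop :=
  [/\ {morph phi : x y / (x * y)%g},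
      forall x y, ql_le P x y -> ql_le Q (phi x) (phi y),
      forall q, Q q -> finite_set [set p | P p /\ phi p = q]
    & forall x y z, P x -> P y -> ql_join P x y z ->
        ql_join Q (phi x) (phi y) (phi z)].

(* Amenability of the discrete group G: a left invariant mean on the bounded
   real functions; values of m outside the bounded functions are irrelevant. *)
Definition amenable_group (R : realType) (G : groupType) : Prop :=
  let bounded (f : G -> R) := exists M, forall g, `|f g| <= M in
  exists m : (G -> R) -> R,
    [/\ forall (c : R) f g, bounded f -> bounded g ->
          m (fun x => c * f x + g x) = c * m f + m g,
        forall f, bounded f -> (forall x, 0 <= f x) -> 0 <= m f,
        m (fun=> 1) = 1
      & forall f t, bounded f -> m (fun x => f (t^-1 * x)%g) = m f].

Reserved Notation "x ** y" (at level 40, left associativity).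

(* Complex *-algebras, not necessarily unital. The product is not the one of a
   [pzRingType], since the library has no join of [pzRingType] and [lmodType];
   its algebras are required to be nonzero, which fails for X empty. *)
HB.mixin Record isStarAlgebra (R : realType) A of GRing.Lmodule R[i] A := {
  smul : A -> A -> A;
  star : A -> A;
  smulA : associative smul;
  smulDl : left_distributive smul +%R;
  smulDr : right_distributive smul +%R;
  smulZl : forall (k : R[i]) (x y : A), smul (k *: x) y = k *: smul x y;
  smulZr : forall (k : R[i]) (x y : A), smul x (k *: y) = k *: smul x y;
  starK : involutive star;
  starD : {morph star : x y / x + y};
  starZ : forall (k : R[i]) (x : A), star (k *: x) = k^*%C *: star x;
  starM : forall x y : A, star (smul x y) = smul (star y) (star x)
}.

#[short(type="starAlgType")]
HB.structure Definition StarAlgebra (R : realType) :=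
  {A of GRing.Lmodule R[i] A & isStarAlgebra R A}.

Notation "x ** y" := (smul x y) : ring_scope.

HB.mixin Record isCstarAlgebra (R : realType) A
    of StarAlgebra R A & CompleteNormedModule R[i] A := {
  cstar_normM : forall x y : A, `|x ** y| <= `|x| * `|y|;
  cstar_norm : forall x : A, `|star x ** x| = `|x| ^+ 2
}.

#[short(type="cstarAlgType")]
HB.structure Definition CstarAlgebra (R : realType) :=
  {A of StarAlgebra R A & CompleteNormedModule R[i] A & isCstarAlgebra R A}.

Section StarAlgebraTheory.
Context (R : realType).

Definition star_hom (A B : starAlgType R) (f : A -> B) : Prop :=
  [/\ linear f, {morph f : x y / x ** y} & {morph f : x / star x}].

Definition cstar_seminorm (A : starAlgType R) (p : A -> R) : Prop :=
  [/\ forall x y, p (x + y) <= p x + p y,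
      forall (k : R[i]) x, (p (k *: x))%:C = `|k| * (p x)%:C,
      forall x y, p (x ** y) <= p x * p y
    & forall x, p (star x ** x) = p x ^+ 2].

Definition max_cstar_norm (A : starAlgType R) (a : A) : \bar R :=
  ereal_sup [set (p a)%:E | p in @cstar_seminorm A].

(* (B, i) is the C*-algebra obtained from A by completing it in the
   (semi)norm N. The norm of a normedModType over R[i] takes its values
   in R[i]. *)
Definition cstar_completion (A : starAlgType R) (N : A -> \bar R)
    (B : cstarAlgType R) (i : A -> B) : Prop :=
  [/\ star_hom i, dense (range i) & forall a, (complex.Re `|i a|)%:E = N a].

Definition cstar_positive (B : cstarAlgType R) (b : B) : Prop :=
  exists c, b = star c ** c.

End StarAlgebraTheory.

(* The left translate t w. *)
Definition translate (G : groupType) (t : G) (w : {ptws G -> bool}) :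
  {ptws G -> bool} := fun g => w (t^-1 * g)%g.

(* The closed invariant subsets of the Nica spectrum. The latter is closed in
   {0,1}^G (see [closed_nica_spectrum]), so it does not matter in which of the
   two X is closed. *)
Record invariant_space (G : groupType) (P : set G) := InvariantSpace {
  inv_set :> set {ptws G -> bool};
  inv_set_sub : inv_set `<=` nica_spectrum P;
  inv_set_closed : closed inv_set;
  inv_set_invariant : forall t w, inv_set w -> w (t^-1)%g ->
    inv_set (translate t w)
}.

Lemma translate_continuous (G : groupType) (t : G) :
  continuous (@translate G t).
Proof.
move=> w; apply/cvg_sup => g; apply/cvg_image.
  by rewrite eqEsubset; split=> v // _; exists (fun=> v).
move=> W /=; rewrite nbhs_simpl => Ww.
exists ((fun v : {ptws G -> bool} => v g) @^-1` W).
  exact: (@proj_continuous G (fun=> bool) (t^-1 * g)%g w W).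
by rewrite eqEsubset; split => [j [? + <-//]|j Wj]; exists (fun=> j).
Qed.

Lemma ptws_near (G : groupType) (w : {ptws G -> bool}) (g : G) :
  \forall v \near w, v g = w g.
Proof.
have := @proj_continuous G (fun=> bool) g w.
by move=> /(_ [set w g]); apply; exact: discrete_set1.
Qed.

Lemma ql_join_unique (G : groupType) (P : set G) (x y z z' : G) :
  quasi_lattice_ordered P -> ql_join P x y z -> ql_join P x y z' -> z = z'.
Proof.
move=> [_ _ Panti _] [zub zlub] [z'ub z'lub].
have := zlub _ z'ub; have := z'lub _ zub; rewrite /ql_le => h1 h2.
apply/esym/(mulgI z^-1%g); rewrite mulVg.
by apply: Panti => //; rewrite invgM invgK.
Qed.

Lemma closed_nica_spectrum (G : groupType) (P : set G) :
  quasi_lattice_ordered P -> closed (nica_spectrum P).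
Proof.
move=> qlo w clw.
have E (s : seq G) : exists2 v, nica_spectrum P v & {in s, v =1 w}.
  have : \forall v \near w, {in s, (v : G -> bool) =1 w}.
    elim: s => [|g s IH]; first by near=> v.
    have gw := ptws_near w g; near=> v => h; rewrite inE => /orP[/eqP->|hs].
      by near: v; exact: gw.
    by move: h hs; near: v.
  by move=> /clw[v [? ?]]; exists v.
split.
- by have [v [v1 _ _] /(_ 1%g) <-] := E [:: 1%g]; rewrite ?inE.
- move=> x p wx Pp; have [v [_ vh _] vE] := E [:: x; (x * p^-1)%g].
  by rewrite -vE ?inE ?eqxx ?orbT//; apply: vh => //; rewrite vE ?inE ?eqxx.
- move=> x y wx wy; have [v [_ _ vd] vE] := E [:: x; y].
  have [||z zj _] := vd x y; rewrite ?vE ?inE ?eqxx ?orbT//.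
  have [v' [_ _ vd'] vE'] := E [:: x; y; z]; exists z => //.
  have [||z' zj' vz'] := vd' x y; rewrite ?vE' ?inE ?eqxx ?orbT//.
  by rewrite -vE' ?inE ?eqxx ?orbT// (ql_join_unique qlo zj zj').
Unshelve. all: by end_near. Qed.

Lemma near_eq_cvg_to (T U : topologicalType) (x : T) (f g : T -> U) (l : U) :
  (\forall y \near x, f y = g y) -> f @ x --> l -> g @ x --> l.
Proof. by move=> fg; apply: cvg_trans; exact: near_eq_cvg. Qed.

Lemma isometry_continuous (K : numFieldType) (f : K -> K) :
  (forall x y, `|f x - f y| = `|x - y|) -> continuous f.
Proof.
move=> fE x A /nbhs_ballP[e e0 eA]; rewrite /= nbhs_simpl; apply/nbhs_ballP.
exists e => // y; rewrite -ball_normE /= => xy.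
by apply: eA; rewrite -ball_normE /= fE.
Qed.

Lemma conjc_continuous (R : realType) :
  continuous (fun z : R[i] => z^*%C).
Proof. by apply: isometry_continuous => x y; rewrite -rmorphB normcJ. Qed.

Section PartialAction.
Context (R : realType) (G : groupType) (P : set G) (X : invariant_space P).
Implicit Types (x : X) (s t : G) (f g : X -> R[i]).

(* The partial action of G on X. It is only meaningful on U_{t^-1}; outside of
   it [insubd] may return the junk value x. *)
Definition theta t x : X := insubd x (translate t (val x)).

(* f o theta_{t^-1} on U_t, extended by zero. *)
Definition alpha t f : X -> R[i] :=
  fun x => if val x t then f (theta t^-1%g x) else 0.

Lemma val_theta t x : val x t^-1%g -> val (theta t x) = translate t (val x).
Proof.
move=> xt; rewrite /theta val_insubd ifT//.
by apply/mem_set/inv_set_invariant => //; exact/set_mem/(valP x).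
Qed.

Lemma val_id x : val x 1%g.
Proof. by have [] := inv_set_sub (set_mem (valP x)). Qed.

Lemma thetaM s t x : val x t^-1%g -> val x (s * t)^-1%g ->
  theta s (theta t x) = theta (s * t)%g x.
Proof.
move=> xt xst; apply/val_inj; rewrite !val_theta//.
  by rewrite /translate; apply/funext => g; rewrite invgM mulgA.
by rewrite /translate -invgM.
Qed.

Lemma theta1 x : theta 1%g x = x.
Proof.
apply/val_inj; rewrite val_theta ?invg1 ?val_id//.
by rewrite /translate; apply/funext => g; rewrite invg1 mul1g.
Qed.

Lemma thetaK t x : val x t^-1%g -> theta t^-1%g (theta t x) = x.
Proof. by move=> xt; rewrite thetaM ?mulVg ?theta1// invg1 val_id. Qed.

(* C_0(U_t \cap X), as the ideal of C(X) of the functions that vanish off the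
   clopen set U_t. *)
Definition C0U t : set (X -> R[i]) :=
  [set f | continuous f /\ forall x, ~~ val x t -> f x = 0].

Lemma C0UP t f :
  continuous f -> (forall x, ~~ val x t -> f x = 0) -> C0U t f.
Proof. by []. Qed.

Lemma C0U0 t : C0U t 0.
Proof. by split=> // x; apply: cst_continuous. Qed.

Lemma C0UD t f g : C0U t f -> C0U t g -> C0U t (f + g).
Proof.
move=> [cf f0] [cg g0]; split=> [x|x xt]; first exact: cvgD (cf x) (cg x).
by rewrite -[LHS]/(f x + g x) f0// g0// addr0.
Qed.

Lemma C0UZ t (k : R[i]) f : C0U t f -> C0U t (k *: f).
Proof.
move=> [cf f0]; split=> [x|x xt]; first exact: cvgZr (cf x).
by rewrite -[LHS]/(k *: f x) f0// scaler0.
Qed.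

Lemma C0U_sum t (I : Type) (r : seq I) (F : I -> X -> R[i]) :
  (forall i, C0U t (F i)) -> C0U t (\sum_(i <- r) F i).
Proof.
move=> FP; elim/big_ind: _ => // [|f g]; [exact: C0U0|exact: C0UD].
Qed.

Lemma val_near x t : \forall y \near x, val y t = val x t.
Proof.
have : val @ x --> val x by exact: initial_continuous.
by move=> /(_ _ (ptws_near (val x) t)).
Qed.

Lemma theta_cvg t x : val x t^-1%g -> theta t @ x --> theta t x.
Proof.
move=> xt U [V [[W oW WV] Vx VU]].
have {}Vx : W (translate t (val x)).
  by rewrite -val_theta//; move: Vx; rewrite -WV.
have oxW : nbhs (translate t (val x)) W by exact: open_nbhs_nbhs.
have := @translate_continuous G t (val x) _ oxW.
have : val @ x --> val x by exact: initial_continuous.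
move=> /[apply] H; rewrite /= nbhs_simpl.
have xt' := val_near x t^-1%g.
rewrite /fmap/=; near=> y.
apply: VU; rewrite -WV -[_ _]/(W (val (theta t y))).
have yt : val y t^-1%g by rewrite (near xt' y).
by rewrite (val_theta yt); near: y; exact: H.
Unshelve. all: by end_near. Qed.

Lemma alpha_in t f x : val x t -> alpha t f x = f (theta t^-1%g x).
Proof. by rewrite /alpha => ->. Qed.

Lemma alpha_out t f x : ~~ val x t -> alpha t f x = 0.
Proof. by rewrite /alpha => /negbTE ->. Qed.

Lemma alpha_continuous t f : continuous f -> continuous (alpha t f).
Proof.
move=> cf x; have xt' := val_near x t; rewrite /continuous_at.
have [xt|xt] := boolP (val x t).
  rewrite alpha_in//.
  apply: (@near_eq_cvg_to _ _ _ (f \o theta t^-1%g)).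
    by apply: filterS xt' => y yt; rewrite alpha_in//= yt.
  have xt1 : val x (t^-1)^-1%g by rewrite invgK.
  by have h := theta_cvg xt1; exact: (cvg_comp _ _ h (cf _)).
rewrite alpha_out//.
apply: (@near_eq_cvg_to _ _ _ (fun=> 0 : R[i])); last exact: cst_continuous.
by apply: filterS xt' => y yt; rewrite alpha_out//= yt.
Qed.

(* The coefficient families of the finite sums  \sum_t f_t delta_t. *)
Definition finite_sums : {pred (G -> X -> R[i])} :=
  mem [set a | (forall t, C0U t (a t)) /\ finite_set [set t | a t <> 0]].

Lemma finite_sums_submod : submod_closed finite_sums.
Proof.
split=> [|k a b /set_mem[aD aF] /set_mem[bD bF]]; apply/mem_set; split=> [t|].
- exact: C0U0.
- by rewrite (_ : [set _ | _] = set0)// -subset0 => t; apply.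
- exact: C0UD (C0UZ _ (aD t)) (bD t).
- have : finite_set ([set t | a t <> 0] `|` [set t | b t <> 0]).
    by rewrite finite_setU.
  apply: sub_finite_set => t /= abt0; apply: contrapT => /not_orP[].
  move=> /contrapT at0 /contrapT bt0; apply: abt0.
  by rewrite -[LHS]/(k *: a t + b t) at0 bt0 scaler0 addr0.
Qed.

HB.instance Definition _ :=
  GRing.isSubmodClosed.Build R[i] (G -> X -> R[i]) finite_sums
    finite_sums_submod.

(* The *-algebra of finite sums; [coef a t] is the coefficient a_t in D_t. *)
Record cp_alg := CPAlg { coef :> G -> X -> R[i]; _ : coef \in finite_sums }.

HB.instance Definition _ := [isSub for coef].
HB.instance Definition _ := [Choice of cp_alg by <:].
HB.instance Definition _ := [SubChoice_isSubLmodule of cp_alg by <:].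

Implicit Types a b c : cp_alg.

Lemma coefP a : (forall t, C0U t (a t)) /\ finite_set [set t | a t <> 0].
Proof. exact/set_mem/(valP a). Qed.

Lemma coef_C0U a t : C0U t (a t). Proof. exact: (coefP a).1. Qed.

Lemma coef_out a t x : ~~ val x t -> a t x = 0.
Proof. exact: (coef_C0U a t).2. Qed.

Lemma coef_inj a b : (forall t x, a t x = b t x) -> a = b.
Proof. by move=> ab; apply/val_inj/funext => t; apply/funext => x. Qed.

(* (f delta_s)(g delta_r) = alpha_s(alpha_{s^-1}(f) g) delta_{sr}, and sr = t. *)
Definition cp_mul_fun (a b : G -> X -> R[i]) : G -> X -> R[i] := fun t =>
  \sum_(s \in [set: G]) alpha s (alpha s^-1%g (a s) \* b (s^-1 * t)%g).

(* (f delta_s)^* = alpha_{s^-1}(conj f) delta_{s^-1}, and s^-1 = t. *)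
Definition cp_star_fun (a : G -> X -> R[i]) : G -> X -> R[i] := fun t =>
  alpha t (fun x => (a t^-1%g x)^*%C).

Lemma cp_termE a (g : X -> R[i]) s x :
  alpha s (alpha s^-1%g (a s) \* g) x = a s x * g (theta s^-1%g x).
Proof.
have [xs|xs] := boolP (val x s); last by rewrite alpha_out// coef_out// mul0r.
have xs' : val x (s^-1)^-1%g by rewrite invgK.
rewrite alpha_in//= alpha_in; last first.
  by rewrite val_theta// /translate invgK mulgV val_id.
by rewrite thetaK.
Qed.

Lemma cp_term0 a (g : X -> R[i]) s : a s = 0 ->
  alpha s (alpha s^-1%g (a s) \* g) = 0.
Proof. by move=> as0; apply/funext => x; rewrite cp_termE as0 mul0r. Qed.

Definition supp a : {fset G} := fset_set [set t | a t <> 0].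

Lemma notin_supp a t : t \notin supp a -> a t = 0.
Proof.
rewrite in_fset_set; last exact: (coefP a).2.
by move=> /negP h; apply: contrapT => ?; apply: h; exact/mem_set.
Qed.

Lemma cp_mul_funE a b t x :
  cp_mul_fun a b t x = \sum_(s <- supp a) a s x * b (s^-1 * t)%g (theta s^-1%g x).
Proof.
rewrite /cp_mul_fun (fsbigTE (supp a)) => [|s /notin_supp]; last exact: cp_term0.
by rewrite fct_sumE; apply: eq_bigr => s _; rewrite cp_termE.
Qed.

Lemma cp_mul_fun_in a b : cp_mul_fun a b \in finite_sums.
Proof.
apply/mem_set; split=> [t|].
  rewrite /cp_mul_fun (fsbigTE (supp a)) => [|s /notin_supp]; last exact: cp_term0.
  apply: C0U_sum => s.
  have ca : continuous (alpha s^-1%g (a s)).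
    exact: alpha_continuous (coef_C0U a s).1.
  have cab : continuous (alpha s^-1%g (a s) \* b (s^-1 * t)%g).
    by move=> x; exact: cvgM (ca x) ((coef_C0U b _).1 x).
  apply: (C0UP (alpha_continuous cab)) => x xt; rewrite cp_termE.
  have [xs|xs] := boolP (val x s); last by rewrite coef_out// mul0r.
  rewrite (@coef_out b) ?mulr0// val_theta ?invgK// /translate invgK.
  by rewrite mulgA mulgV mul1g.
have fab : finite_set [set (s * r)%g | s in [set s | a s <> 0]
    & r in [set r | b r <> 0]].
  by apply: finite_image2; exact: (coefP _).2.
apply: sub_finite_set fab => t /= abt0; apply: contrapT => tab; apply: abt0.
apply/funext => x; rewrite cp_mul_funE big1// => s _.
have [->|as0] := pselect (a s = 0); first by rewrite mul0r.
have [->|bs0] := pselect (b (s^-1 * t)%g = 0); first by rewrite mulr0.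
by exfalso; apply: tab; exists s => //; exists (s^-1 * t)%g; rewrite // mulgA mulgV mul1g.
Qed.

Lemma cp_star_fun_in a : cp_star_fun a \in finite_sums.
Proof.
apply/mem_set; split=> [t|].
  split=> [|x xt]; last by rewrite /cp_star_fun alpha_out.
  apply: alpha_continuous => x.
  exact: (cvg_comp _ _ ((coef_C0U a _).1 x) (@conjc_continuous R _)).
have fa : finite_set [set (s^-1)%g | s in [set s | a s <> 0]].
  by apply: finite_image; exact: (coefP _).2.
apply: sub_finite_set fa => t /= at0; exists t^-1%g; rewrite ?invgK// => a0.
by apply: at0; apply/funext => x; rewrite /cp_star_fun a0 /alpha conjc0 if_same.
Qed.

Definition cp_mul a b : cp_alg := CPAlg (cp_mul_fun_in a b).
Definition cp_star a : cp_alg := CPAlg (cp_star_fun_in a).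

End PartialAction.

Section CrossedProduct.
Context (R : realType) (G : groupType) (P : set G) (X : invariant_space P).
Implicit Types (x : X) (s t : G) (a b c : cp_alg R X).

Lemma cp_mulE a b t x (S : {fset G}) : (forall s, s \notin S -> a s = 0) ->
  cp_mul a b t x = \sum_(s <- S) a s x * b (s^-1 * t)%g (theta s^-1%g x).
Proof.
move=> aS; rewrite -[LHS]/(cp_mul_fun a b t x) /cp_mul_fun (fsbigTE S) => [|s /aS]; last exact: cp_term0.
by rewrite fct_sumE; apply: eq_bigr => s _; rewrite cp_termE.
Qed.

Lemma cp_mulET a b t x : cp_mul a b t x =
  \sum_(s \in [set: G]) a s x * b (s^-1 * t)%g (theta s^-1%g x).
Proof.
rewrite (cp_mulE _ _ _ (@notin_supp _ _ _ _ a)) (fsbigTE (supp a))//.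
by move=> s /notin_supp ->; rewrite mul0r.
Qed.

Lemma cp_starE a t x : val x t ->
  cp_star a t x = (a t^-1%g (theta t^-1%g x))^*%C.
Proof. by move=> xt; exact: alpha_in. Qed.

Lemma coefD a b t x : (a + b : cp_alg R X) t x = a t x + b t x.
Proof. by []. Qed.

Lemma coefZ (k : R[i]) a t x : (k *: a : cp_alg R X) t x = k * a t x.
Proof. by []. Qed.

Lemma cp_mulA : associative (@cp_mul R G P X).
Proof.
move=> a b c; apply: coef_inj => t x; apply/esym.
pose S := [fset (s * r)%g | s in supp a, r in supp b]%fset.
have SP s r : s \in supp a -> r \in supp b -> (s * r)%g \in S.
  by move=> sa rb; apply/imfset2P; exists s => //; exists r.
have abS r : r \notin S -> cp_mul a b r = 0.
  move=> rS; apply/funext => y; rewrite (cp_mulE _ _ _ (@notin_supp _ _ _ _ a)).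
  rewrite big_seq big1// => s sa.
  rewrite (@notin_supp _ _ _ _ b) ?mulr0//; apply: contra rS => /(SP _ _ sa).
  by rewrite mulgA mulgV mul1g.
rewrite (cp_mulE _ _ _ abS) (cp_mulE _ _ _ (@notin_supp _ _ _ _ a)).
under eq_bigr => r _ do
  rewrite (cp_mulE _ _ _ (@notin_supp _ _ _ _ a)) mulr_suml.
rewrite exchange_big big_seq [RHS]big_seq; apply: eq_bigr => s sa.
have [xs|xs] := boolP (val x s); last first.
  by rewrite coef_out// mul0r big1// => r _; rewrite !mul0r.
under eq_bigr => r _ do rewrite -mulrA.
rewrite -mulr_sumr; congr (_ * _).
rewrite (cp_mulE _ _ _ (@notin_supp _ _ _ _ b)).
pose F r := b (s^-1 * r)%g (theta s^-1%g x) * c (r^-1 * t)%g (theta r^-1%g x).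
rewrite -[LHS](@fsbigTE _ _ _ _ S F); last first.
  move=> r rS; rewrite /F (@notin_supp _ _ _ _ b) ?mul0r//.
  by apply: contra rS => /(SP _ _ sa); rewrite mulgA mulgV mul1g.
rewrite (@reindex_fsbigT _ _ _ _ _ (fun u => s * u)%g); last first.
  by exists (fun u => s^-1 * u)%g => u; rewrite mulgA ?mulVg ?mulgV mul1g.
rewrite (fsbigTE (supp b)); last first.
  by move=> u /notin_supp bu; rewrite /F mulgA mulVg mul1g bu mul0r.
apply: eq_bigr => u _; rewrite /F mulgA mulVg mul1g invgM -mulgA.
have vth : val (theta s^-1%g x) u = val x (s * u)%g.
  by rewrite val_theta ?invgK// /translate invgK.
have [xsu|xsu] := boolP (val x (s * u)%g); last first.
  by rewrite coef_out ?mul0r// vth.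
by rewrite thetaM// ?invgK// invgM !invgK.
Qed.

Lemma cp_mulDl : left_distributive (@cp_mul R G P X) +%R.
Proof.
move=> a b c; apply: coef_inj => t x; rewrite coefD.
pose S := (supp a `|` supp b)%fset.
have aS s : s \notin S -> a s = 0.
  by rewrite inE negb_or => /andP[/notin_supp].
have bS s : s \notin S -> b s = 0.
  by rewrite inE negb_or => /andP[_ /notin_supp].
rewrite !(@cp_mulE _ _ _ _ S)//; last first.
  move=> s sS; apply/funext => y.
  by rewrite -[LHS]/(a s y + b s y) aS// bS// addr0.
by rewrite -big_split; apply: eq_bigr => s _; rewrite coefD mulrDl.
Qed.

Lemma cp_mulDr : right_distributive (@cp_mul R G P X) +%R.
Proof.
move=> a b c; apply: coef_inj => t x; rewrite coefD.
rewrite !(cp_mulE _ _ _ (@notin_supp _ _ _ _ a)) -big_split.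
by apply: eq_bigr => s _; rewrite coefD mulrDr.
Qed.

Lemma cp_mulZl (k : R[i]) a b : cp_mul (k *: a) b = k *: cp_mul a b.
Proof.
apply: coef_inj => t x; rewrite coefZ !(@cp_mulE _ _ _ _ (supp a)).
- by rewrite mulr_sumr; apply: eq_bigr => s _; rewrite coefZ mulrA.
- exact: notin_supp.
- move=> s /notin_supp as0; apply/funext => y.
  by rewrite -[LHS]/(k * a s y) as0 mulr0.
Qed.

Lemma cp_mulZr (k : R[i]) a b : cp_mul a (k *: b) = k *: cp_mul a b.
Proof.
apply: coef_inj => t x; rewrite coefZ.
rewrite !(cp_mulE _ _ _ (@notin_supp _ _ _ _ a)) mulr_sumr.
by apply: eq_bigr => s _; rewrite coefZ mulrCA.
Qed.

Lemma cp_starK : involutive (@cp_star R G P X).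
Proof.
move=> a; apply: coef_inj => t x.
have [xt|xt] := boolP (val x t); last by rewrite !coef_out.
have xt' : val x (t^-1)^-1%g by rewrite invgK.
have tK : theta t (theta t^-1%g x) = x by rewrite -{1}(invgK t) thetaK.
rewrite cp_starE// cp_starE; first by rewrite conjcK invgK tK.
by rewrite val_theta// /translate invgK mulgV val_id.
Qed.

Lemma cp_starD : {morph @cp_star R G P X : a b / a + b}.
Proof.
move=> a b; apply: coef_inj => t x; rewrite coefD.
have [xt|xt] := boolP (val x t); last by rewrite !coef_out// addr0.
by rewrite !cp_starE// coefD rmorphD.
Qed.

Lemma cp_starZ (k : R[i]) a : cp_star (k *: a) = k^*%C *: cp_star a.
Proof.
apply: coef_inj => t x; rewrite coefZ.
have [xt|xt] := boolP (val x t); last by rewrite !coef_out// mulr0.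
by rewrite !cp_starE// coefZ rmorphM.
Qed.

Lemma cp_starM a b : cp_star (cp_mul a b) = cp_mul (cp_star b) (cp_star a).
Proof.
apply: coef_inj => t x; rewrite [RHS]cp_mulET.
rewrite (@reindex_fsbigT _ _ _ _ _ (fun u => t * u)%g); last first.
  by exists (fun u => t^-1 * u)%g => u; rewrite mulgA ?mulVg ?mulgV mul1g.
have E s : ((t * s)^-1 * t = s^-1)%g by rewrite invgM -mulgA mulVg mulg1.
rewrite (fsbigTE (supp a)); last first.
  move=> s /notin_supp as0; rewrite E.
  rewrite [X in _ * X](_ : _ = 0) ?mulr0//.
  by rewrite -[LHS]/(cp_star_fun a _ _) /cp_star_fun /alpha invgK as0 conjc0 if_same.
have [xt|xt] := boolP (val x t); last first.
  rewrite coef_out// big1// => s _; rewrite E.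
  have [xts|xts] := boolP (val x (t * s)%g); last by rewrite coef_out// mul0r.
  rewrite [X in _ * X]coef_out ?mulr0// val_theta ?invgK// /translate invgK.
  by rewrite -mulgA mulgV mulg1.
rewrite cp_starE// (cp_mulE _ _ _ (@notin_supp _ _ _ _ a)) rmorph_sum.
apply: eq_bigr => s _; rewrite E rmorphM mulrC.
have xt' : val x (t^-1)^-1%g by rewrite invgK.
have vth : val (theta t^-1%g x) s = val x (t * s)%g.
  by rewrite val_theta// /translate invgK.
have [xts|xts] := boolP (val x (t * s)%g); last first.
  by rewrite (coef_out a) ?vth// rmorph0 mulr0 (coef_out (cp_star b))// mul0r.
have xts' : val x ((t * s)^-1)^-1%g by rewrite invgK.
rewrite !cp_starE//; last first.
  by rewrite val_theta// /translate invgK -mulgA mulgV mulg1.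
rewrite invgK !invgM !thetaM//.
- by rewrite mulgA mulgV mul1g.
- by rewrite -invgM.
- by rewrite mulgA mulgV mul1g.
- by rewrite -invgM.
Qed.

HB.instance Definition _ := isStarAlgebra.Build R (cp_alg R X)
  cp_mulA cp_mulDl cp_mulDr cp_mulZl cp_mulZr cp_starK cp_starD cp_starZ
  cp_starM.

(* The universal C*-completion is the one for the largest C*-seminorm. *)
Definition full_crossed_product (B : cstarAlgType R) (iota : cp_alg R X -> B) :
  Prop := cstar_completion (@max_cstar_norm R (cp_alg R X)) iota.

(* The norm of C(X), for f continuous; it is 0 if X is empty. *)
Definition sup_norm (f : X -> R[i]) : R :=
  sup (range (fun x => complex.Re `|f x|)).

(* The C(X)-valued inner product of the regular representation: the coefficient
   of delta_e in xi^* eta, that is, the sum over t of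
   alpha_{t^-1}(conj xi_t * eta_t). *)
Definition cp_inner (xi eta : cp_alg R X) : X -> R[i] :=
  (star xi ** eta : cp_alg R X) 1%g.

(* The norm of the regular representation, which is by left multiplication on
   the Hilbert C(X)-module obtained by completing the finite sums for
   [cp_inner]. The norm of an operator is computed on the dense submodule of
   finite sums. *)
Definition reduced_norm a : \bar R :=
  ereal_sup [set (Num.sqrt (sup_norm (cp_inner (a ** xi) (a ** xi))))%:E
            | xi in [set xi : cp_alg R X | sup_norm (cp_inner xi xi) <= 1]].

Definition reduced_crossed_product (B : cstarAlgType R)
  (iota : cp_alg R X -> B) : Prop := cstar_completion reduced_norm iota.

(* Convergence in {uniform X -> R[i]} is convergence in the norm of C(X). On
   the finite sums the formula says that f delta_g goes to f if g = e and to 0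
   otherwise. *)
Definition conditional_expectation (B : cstarAlgType R)
    (iota : cp_alg R X -> B) (Phi : B -> X -> R[i]) : Prop :=
  [/\ linear Phi,
      continuous (Phi : B -> {uniform X -> R[i]}),
      forall b : B, continuous (Phi b)
    & forall a, Phi (iota a) = a 1%g].

End CrossedProduct.

Definition faithful_on_positive (R : realType) (T : Type) (B : cstarAlgType R)
    (Phi : B -> T -> R[i]) : Prop :=
  forall b : B, cstar_positive b -> Phi b = 0 -> b = 0.

(* A *-homomorphism of C*-algebras is continuous, so Lambda is determined by its
   values on the finite sums: it is the canonical map. *)
Definition amenable_partial_action (R : realType) (G : groupType) (P : set G)
    (X : invariant_space P) : Prop :=
  forall (B Br : cstarAlgType R)
    (iota : cp_alg R X -> B) (lambda : cp_alg R X -> Br),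
  full_crossed_product iota -> reduced_crossed_product lambda ->
  exists Lambda : B -> Br,
    [/\ star_hom Lambda,
        forall a, Lambda (iota a) = lambda a
      & bijective Lambda].

(* Main.v *)
Require Import Defs.
From HB Require Import structures.
From mathcomp Require Import all_boot all_order all_algebra.
From mathcomp Require Import finmap complex ring lra.
From mathcomp Require Import all_classical all_reals all_analysis.

Set Implicit Arguments.
Unset Strict Implicit.
Unset Printing Implicit Defensive.
Import Order.TTheory GRing.Theory Num.Theory numFieldNormedType.Exports.

Local Open Scope classical_set_scope.
Local Open Scope ring_scope.
Local Open Scope complex_scope.

(* Write [A] for the *-algebra of finite sums. Given finitely many [t] in [G] and
   a finitely supported unit vector [xi] of l^2(H), almost invariant under the
   [phi(t)] (it comes from the invariant mean, by Hahn-Banach), choose a finite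
   subset [F] of [H] closed under joins and let [s_h(x)] be the largest [p] in
   [x], [p] in [P], with [phi(p)] in [hF]: (C1) and (C2) make it exist. If [F] is
   large, [s_{phi(t)^-1 h}(t^-1 x) = t^-1 s_h(x)]. Hence the functions
   [eta_{h,s}(x) = xi(h) [s = s_h(x)]] on the G-set [H * G] have coefficients
   [m_t(x) = sum_i eta_i(x) eta_{t^-1 i}(t^-1 x)] which are finitely supported in
   [t] and almost 1 at the given [t].

   Multiplication of the coefficients by [m] is a map [Psi] on [A] which sends
   [a^* a] to a sum of elements [z^* z]. It is therefore contractive on
   self-adjoint elements from any C*-norm for which the coefficient at 1 is
   bounded to the norm of the full crossed product. As [Psi] tends to the
   identity, the full norm is at most the reduced one; and if [Phi (c^* c) = 0],
   then [Psi (c^* c)] vanishes, because the coefficients of [a^* a] are bounded by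
   the one at 1, so that [c^* c = 0]. *)

(** * Positive elements of C*-algebras *)

(** A priori [Psi] is only bounded, with a constant that grows with the number of coefficients it
    keeps; positivity brings this constant down to 1, but on self-adjoint elements only. That is
    enough, since the C*-identity passes from [star a ** a] to [a]. In the proof of faithfulness the
    crude constant comes back: it depends on [Psi], hence on a first approximation of [c], and is
    beaten by a second, finer approximation chosen after it. The index set is [H * G] and not [H]
    because its second coordinate makes the action of [G] free; this alone makes [m_t] vanish for
    all but finitely many [t]. The vector [xi] supplies the values, and [s_h] carries them to [G].
    The covariance of [s_h] needs the join of 1 and [t] to be a candidate at level [h], which
    decides what [F] has to contain. Positivity in a C*-algebra is expressed by [|t - h| <= t], and
    everything about it is drawn from one iteration for square roots. No spectral theory enters,
    even in the proof that [star b ** b] is positive. *)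

Section StarAlgebraLemmas.
Context (R : realType) (A : starAlgType R).
Implicit Types x y z : A.

Lemma smul0l x : 0 ** x = 0 :> A.
Proof. by apply: (addIr (0 ** x)); rewrite -smulDl !add0r. Qed.

Lemma smul0r x : x ** 0 = 0 :> A.
Proof. by apply: (addIr (x ** 0)); rewrite -smulDr !add0r. Qed.

Lemma smulNl x y : (- x) ** y = - (x ** y).
Proof. by apply/eqP; rewrite -addr_eq0 -smulDl addNr smul0l. Qed.

Lemma smulNr x y : x ** (- y) = - (x ** y).
Proof. by apply/eqP; rewrite -addr_eq0 -smulDr addNr smul0r. Qed.

Lemma smulBl x y z : (x - y) ** z = x ** z - y ** z.
Proof. by rewrite smulDl smulNl. Qed.

Lemma smulBr x y z : z ** (x - y) = z ** x - z ** y.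
Proof. by rewrite smulDr smulNr. Qed.

Lemma star0 : star (0 : A) = 0.
Proof. by apply: (addIr (star (0 : A))); rewrite -starD !add0r. Qed.

Lemma starN x : star (- x) = - star x.
Proof. by apply/eqP; rewrite -addr_eq0 -starD addNr star0. Qed.

Lemma starB x y : star (x - y) = star x - star y.
Proof. by rewrite starD starN. Qed.

Lemma starZR (s : R) x : star (s%:C *: x) = s%:C *: star x.
Proof. by rewrite starZ /= oppr0. Qed.

End StarAlgebraLemmas.

Section CstarNorm.
Context (R : realType).

Definition cnorm (B : cstarAlgType R) (b : B) : R := complex.Re `|b|.

Context (B : cstarAlgType R).
Implicit Types (b h k x y z : B) (s t d : R).

Lemma cnormE b : `|b| = (cnorm b)%:C.
Proof.
have := normr_ge0 b; rewrite lecE /= /cnorm => /andP[/eqP i0 _].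
by case: `|b| i0 => ? ? /= ->.
Qed.

Lemma cnorm_ge0 b : 0 <= cnorm b.
Proof. by rewrite -lecR -cnormE normr_ge0. Qed.

Lemma cnorm0 : cnorm (0 : B) = 0.
Proof. by rewrite /cnorm normr0. Qed.

Lemma cnorm0_eq0 b : cnorm b = 0 -> b = 0.
Proof. by move=> b0; apply/eqP; rewrite -normr_eq0 cnormE b0. Qed.

Lemma cnormD x y : cnorm (x + y) <= cnorm x + cnorm y.
Proof. by rewrite -lecR rmorphD /= -!cnormE ler_normD. Qed.

Lemma cnormN x : cnorm (- x) = cnorm x.
Proof. by rewrite /cnorm normrN. Qed.

Lemma cnormB x y : cnorm (x - y) <= cnorm x + cnorm y.
Proof. by rewrite -(cnormN y) cnormD. Qed.

Lemma cnorm_distC x y : cnorm (x - y) = cnorm (y - x).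
Proof. by rewrite /cnorm distrC. Qed.

Lemma cnormM x y : cnorm (x ** y) <= cnorm x * cnorm y.
Proof. by rewrite -lecR rmorphM /= -!cnormE cstar_normM. Qed.

Lemma normcRe (k : R[i]) : `|k| = (complex.Re `|k|)%:C.
Proof.
have := normr_ge0 k; rewrite lecE => /andP[/eqP i0 _].
by rewrite [LHS]complexE i0 /= mulr0 addr0.
Qed.

Lemma cnormZ (k : R[i]) x : cnorm (k *: x) = complex.Re `|k| * cnorm x.
Proof. by apply/complexI; rewrite rmorphM /= -!cnormE normrZ -normcRe. Qed.

Lemma cnormZR s x : cnorm (s%:C *: x) = `|s| * cnorm x.
Proof. by rewrite cnormZ normc_def /= expr0n addr0 sqrtr_sqr. Qed.

Lemma cnorm_star_mul x : cnorm (star x ** x) = cnorm x ^+ 2.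
Proof.
by apply/complexI; rewrite rmorphXn /= -!cnormE cstar_norm.
Qed.

Lemma cnorm_star x : cnorm (star x) = cnorm x.
Proof.
have H y : cnorm y <= cnorm (star y).
  have := cnormM (star y) y; rewrite cnorm_star_mul expr2.
  have := cnorm_ge0 y; rewrite le_eqVlt => /predU1P[<- _|y0].
    exact: cnorm_ge0.
  by rewrite ler_pM2r.
by apply/eqP; rewrite eq_le H andbT -{2}(starK x) H.
Qed.

Lemma cnorm_mul_star x : cnorm (x ** star x) = cnorm x ^+ 2.
Proof. by rewrite -{1}(starK x) cnorm_star_mul cnorm_star. Qed.

Lemma cnorm_sqr h : star h = h -> cnorm (h ** h) = cnorm h ^+ 2.
Proof. by move=> sh; rewrite -{1}sh cnorm_star_mul. Qed.

Lemma cauchy_cnorm (u : nat -> B) :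
  (forall e : R, 0 < e ->
    exists N, forall m n, (N <= m)%N -> (N <= n)%N -> cnorm (u m - u n) < e) ->
  exists l, forall e : R, 0 < e ->
    exists N, forall n, (N <= n)%N -> cnorm (u n - l) < e.
Proof.
move=> cu; have : cvg (u @ \oo).
  apply/cauchy_cvgP/cauchy_ballP => e e0.
  have /andP[/eqP ie re] : (complex.Im e == 0) && (0 < complex.Re e).
    by move: e0; rewrite ltcE.
  have eE : e = (complex.Re e)%:C by case: (e) ie => ? ? /= ->.
  have [N uN] := cu _ re.
  exists ([set u n | n in [set n | (N <= n)%N]],
          [set u n | n in [set n | (N <= n)%N]]) => /=.
    by split; exists N => // n /= Nn; exists n.
  move=> [x y] /= [[m Nm <-] [n Nn <-]].
  by rewrite -ball_normE /= cnormE eE ltcR uN.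
move=> /cvgrPdist_lt uc; exists (lim (u @ \oo)) => e e0.
have [|N _ uN] := uc e%:C; first by rewrite ltcR.
by exists N => n Nn; rewrite cnorm_distC -ltcR -cnormE; exact: uN.
Qed.

End CstarNorm.

Lemma expr_small (R : realType) (a d : R) : 0 <= a < 1 -> 0 < d ->
  exists N : nat, a ^+ N < d.
Proof.
move=> /andP[a0 a1] d0.
have /cvgrPdist_lt/(_ d d0) [N _ /(_ N (leqnn _))] : geometric 1 a @ \oo --> (0 : R).
  by apply: cvg_geometric; rewrite ger0_norm.
rewrite /= sub0r normrN mul1r ger0_norm ?exprn_ge0// => aN.
by exists N.
Qed.

(** * Square roots and order in a unital C*-algebra *)

Section UnitalCstar.
Context (R : realType) (B : cstarAlgType R) (e : B).
Hypotheses (smul1x : forall x : B, e ** x = x) (smulx1 : forall x : B, x ** e = x).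
Implicit Types (b c g h k x y z : B) (s t d : R).

Lemma star_unit : star e = e.
Proof. by rewrite -[RHS]starK -[in RHS](smulx1 (star e)) starM starK smulx1. Qed.

(** An inequality, because the algebra may be zero, as it is when [X] is empty. *)
Lemma cnorm_unit : cnorm e <= 1.
Proof.
have := cnorm_star_mul e; rewrite star_unit smul1x expr2 => E.
have := cnorm_ge0 e; rewrite le_eqVlt => /predU1P[<-//|e0].
by rewrite -(ler_pM2r e0) -E mul1r.
Qed.

Definition scal s : B := s%:C *: e.

Lemma smul_scal s x : scal s ** x = s%:C *: x.
Proof. by rewrite /scal smulZl smul1x. Qed.

Lemma smulx_scal s x : x ** scal s = s%:C *: x.
Proof. by rewrite /scal smulZr smulx1. Qed.

Lemma star_scal s : star (scal s) = scal s.
Proof. by rewrite /scal starZR star_unit. Qed.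

Lemma scalD s t : scal (s + t) = scal s + scal t.
Proof. by rewrite /scal rmorphD scalerDl. Qed.

Lemma cnorm_scal s : cnorm (scal s) <= `|s|.
Proof. by rewrite cnormZR ler_piMr// cnorm_unit. Qed.

Lemma cnorm_eq0P x (C : R) : (forall d, 0 < d -> cnorm x <= C * d) -> x = 0.
Proof.
move=> xC; apply: cnorm0_eq0; apply/eqP; rewrite eq_le cnorm_ge0 andbT.
apply/ler_addgt0Pr => d d0; rewrite add0r.
have C1 : 0 < `|C| + 1 by rewrite ltr_wpDl.
apply: (le_trans (xC (d / (`|C| + 1)) _)); first by rewrite divr_gt0.
rewrite mulrA ler_pdivrMr// mulrC ler_pM2l//.
by rewrite (le_trans (ler_norm C))// lerDl.
Qed.

Lemma geometric_cauchy (u : nat -> B) (a C : R) : 0 <= a < 1 ->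
  (forall n, cnorm (u n.+1 - u n) <= C * a ^+ n) ->
  exists l, forall d, 0 < d ->
    exists N, forall n, (N <= n)%N -> cnorm (u n - l) < d.
Proof.
move=> /andP[a0 a1] uC; have a1' : 0 < 1 - a by rewrite subr_gt0.
have C0 : 0 <= C by have := uC 0; rewrite mulr1; apply: le_trans; exact: cnorm_ge0.
have ub (m p : nat) : cnorm (u (m + p)%N - u m) <= C * a ^+ m * (1 - a ^+ p) / (1 - a).
  elim: p => [|p IH]; first by rewrite addn0 !subrr cnorm0 mulr0 mul0r.
  rewrite -(subrKA (u (m + p)%N)) addnS; apply: (le_trans (cnormD _ _)).
  apply: (le_trans (lerD (uC _) IH)); rewrite exprD exprS.
  rewrite le_eqVlt; apply/orP; left; apply/eqP.
  by field; rewrite gt_eqF.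
have C1 : 0 < C + 1 by rewrite ltr_wpDl.
apply: cauchy_cnorm => d d0.
have [||N aN] := @expr_small R a (d * (1 - a) / (2 * (C + 1))).
- by rewrite a0.
- by rewrite divr_gt0 ?mulr_gt0.
exists N => m n Nm Nn; rewrite -(subrKA (u N)); apply: (le_lt_trans (cnormD _ _)).
rewrite (cnorm_distC (u N)).
have H p : (N <= p)%N -> cnorm (u p - u N) < d / 2.
  move=> Np; rewrite -(subnKC Np); apply: (le_lt_trans (ub _ _)).
  rewrite ltr_pdivrMr//.
  have : C * a ^+ N * (1 - a ^+ (p - N)) <= (C + 1) * a ^+ N.
    rewrite -[leRHS]mulr1; apply: ler_pM.
    - by rewrite mulr_ge0// exprn_ge0.
    - by rewrite subr_ge0 exprn_ile1// ltW.
    - by rewrite ler_wpM2r ?exprn_ge0// lerDl.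
    - by rewrite gerBl exprn_ge0.
  move=> /le_lt_trans; apply; rewrite mulrC -ltr_pdivlMr//.
  apply: (lt_le_trans aN); rewrite le_eqVlt; apply/orP; left; apply/eqP.
  by field; rewrite gt_eqF.
by rewrite [ltRHS]splitr ltrD// H.
Qed.

(** The root is [e - y] with [2 y = h + y^2], and [y] is the limit of the iterates of [f] from 0.
    They stay in the ball of radius [a = |h|], where [f] contracts by the factor [a < 1]; being
    polynomials in [h], they are self-adjoint and commute with whatever commutes with [h]. *)
Lemma sqrt_one_sub h : star h = h -> cnorm h < 1 ->
  exists k, [/\ star k = k, k ** k = e - h
    & forall z, z ** h = h ** z -> z ** k = k ** z].
Proof.
move=> sh h1; set a := cnorm h; have a0 : 0 <= a by exact: cnorm_ge0.
pose f y := (2^-1)%:C *: (h + y ** y); pose u n := iter n f 0.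
have uS n : u n.+1 = (2^-1)%:C *: (h + u n ** u n) by [].
have half0 : 0 <= 2^-1 :> R by rewrite invr_ge0.
have un n : cnorm (u n) <= a.
  elim: n => [|n IH]; first by rewrite cnorm0.
  rewrite /= cnormZR ger0_norm// mulrC ler_pdivrMr//.
  apply: (le_trans (cnormD _ _)); rewrite mulrDr mulr1 lerD//.
  apply: (le_trans (cnormM _ _)); rewrite -[leRHS]mulr1 ler_pM ?cnorm_ge0//.
  by rewrite (le_trans IH)// ltW.
have su n : star (u n) = u n.
  by elim: n => [|n IH] /=; rewrite ?star0// starZR starD starM sh IH.
have cu z : z ** h = h ** z -> forall n, z ** u n = u n ** z.
  move=> zh; elim=> [|n IH]; first by rewrite smul0l smul0r.
  by rewrite /= smulZr smulZl smulDr smulDl zh smulA IH -smulA IH smulA.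
have sq x y : x ** x - y ** y = x ** (x - y) + (x - y) ** y.
  by rewrite smulBr smulBl addrA subrK.
have du n : cnorm (u n.+1 - u n) <= 1 * a ^+ n.
  rewrite mul1r; elim: n => [|n IH].
    rewrite subr0 expr0 -[u 1%N]/(f 0) /f smul0l addr0 cnormZR ger0_norm//.
    by rewrite mulrC ler_pdivrMr// mul1r (le_trans (ltW h1))// ler1n.
  rewrite (uS n.+1) [X in _ - X](uS n) -scalerBr opprD addrACA subrr add0r.
  rewrite sq cnormZR ger0_norm// mulrC ler_pdivrMr//.
  apply: (le_trans (cnormD _ _)); apply: (le_trans (lerD (cnormM _ _) (cnormM _ _))).
  rewrite [_ * cnorm (u n)]mulrC -mulrDl exprS.
  rewrite [leRHS]mulrAC ler_pM ?addr_ge0 ?cnorm_ge0//.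
  by rewrite mulrDr mulr1 lerD.
have [|y uy] := geometric_cauchy _ du; first by rewrite a0 h1.
(* Two consecutive iterates [v], [w], both within [d] of [y]: each property of [y] is checked on
   them up to a multiple of [d]. *)
have approx d : 0 < d -> exists2 v, (exists n, v = u n) &
    (exists2 w, w = (2^-1)%:C *: (h + v ** v) & cnorm (v - y) < d /\ cnorm (w - y) < d).
  move=> /uy[N uN]; exists (u N); first by exists N.
  by exists (u N.+1) => //; split; apply: uN.
have sy : star y = y.
  apply/eqP; rewrite -subr_eq0; apply/eqP; apply: (@cnorm_eq0P _ 2) => d d0.
  have [_ [n ->] [_ _ [/ltW uyd _]]] := approx d d0.
  rewrite -(subrKA (u n)) -{1}(su n) -starB; apply: (le_trans (cnormD _ _)).
  by rewrite cnorm_star cnorm_distC mulr2n mulrDl mul1r lerD.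
have cy z : z ** h = h ** z -> z ** y = y ** z.
  move=> zh.
  apply/eqP; rewrite -subr_eq0; apply/eqP.
  apply: (@cnorm_eq0P _ (2 * cnorm z)) => d d0.
  have [_ [n ->] [_ _ [/ltW uyd _]]] := approx d d0.
  rewrite -(subrKA (z ** u n)) -smulBr (cu _ zh) -smulBl.
  apply: (le_trans (cnormD _ _)); apply: (le_trans (lerD (cnormM _ _) (cnormM _ _))).
  rewrite cnorm_distC [_ * cnorm z]mulrC -mulrDr -mulr2n -[_ *+ 2]mulr_natl mulrCA mulrA.
  by rewrite ler_wpM2l// mulr_ge0// cnorm_ge0.
have ey : y + y = h + y ** y.
  apply/eqP; rewrite -subr_eq0; apply/eqP.
  apply: (@cnorm_eq0P _ (2 + a + cnorm y)) => d d0.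
  have [_ [n ->] [w wE [/ltW uyd /ltW wyd]]] := approx d d0.
  have w2 : w + w = h + u n ** u n.
    have half2 : 2^-1 + 2^-1 = 1 :> R by field.
    by rewrite wE -scalerDl -rmorphD half2 scale1r.
  have -> : y + y - (h + y ** y) =
    (y - w) + (y - w) + (u n ** (u n - y) + (u n - y) ** y).
    by rewrite -sq (addrACA y) -opprD w2 !opprD -[RHS]addrA subrKA.
  apply: (le_trans (cnormD _ _)).
  apply: (le_trans (lerD (cnormD _ _) (cnormD _ _))).
  apply: (le_trans (lerD (lexx _) (lerD (cnormM _ _) (cnormM _ _)))).
  rewrite (cnorm_distC y w).
  have -> : (2 + a + cnorm y) * d = (d + d) + (a * d + d * cnorm y) by ring.
  by rewrite !lerD ?ler_pM ?cnorm_ge0.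
exists (e - y); split.
- by rewrite starB star_unit sy.
- have yyE : y ** y = y + y - h by rewrite ey addrC addKr.
  rewrite smulBl !smulBr smul1x smulx1 smul1x opprB yyE.
  by rewrite (addrAC (y + y)) addrK subrKA.
- by move=> z zh; rewrite smulBl smulBr smul1x smulx1 cy.
Qed.

Lemma sqrt_scal_sub h s : star h = h -> cnorm h < s ->
  exists k, [/\ star k = k, k ** k = scal s - h
    & forall z, z ** h = h ** z -> z ** k = k ** z].
Proof.
move=> sh hs; have s0 : 0 < s by exact: le_lt_trans (cnorm_ge0 h) hs.
have [||k [sk kk kc]] := @sqrt_one_sub ((s^-1)%:C *: h).
- by rewrite starZR sh.
- by rewrite cnormZR gtr0_norm ?invr_gt0// mulrC ltr_pdivrMr// mul1r.
exists ((Num.sqrt s)%:C *: k); split=> [||z zh].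
- by rewrite starZR sk.
- rewrite smulZl smulZr scalerA -rmorphM -expr2 sqr_sqrtr ?ltW// kk scalerBr.
  by rewrite scalerA -rmorphM divff ?gt_eqF// rmorph1 scale1r.
- by rewrite smulZl smulZr kc// smulZl smulZr zh.
Qed.

(* [g + i k] has norm [t], since its product with its adjoint is [t^2]. *)
Lemma circle_norm g k t : star g = g -> star k = k -> g ** k = k ** g ->
  g ** g + k ** k = scal (t ^+ 2) -> 0 <= t -> cnorm g <= t.
Proof.
move=> sg sk gk gkE t0; pose u := g + 'i *: k.
have su : star u = g - 'i *: k.
  rewrite /u starD sg starZ sk -scaleNr; congr (_ + _ *: _).
  by apply/eqP; rewrite eq_complex /= oppr0 !eqxx.
have uu : star u ** u = scal (t ^+ 2).
  rewrite su /u smulBl !smulDr !smulZl !smulZr gk scalerA addrKA.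
  by rewrite -expr2 sqr_i scaleN1r opprK.
have ut : cnorm u <= t.
  rewrite -ler_sqr ?nnegrE ?cnorm_ge0// -cnorm_star_mul uu.
  by rewrite (le_trans (cnorm_scal _))// ger0_norm// exprn_ge0.
rewrite -(@ler_pM2l _ 2)//; have -> : 2 * cnorm g = cnorm (u + star u).
  have -> : u + star u = (2 : R)%:C *: g.
    by rewrite su /u addrACA subrr addr0 rmorph_nat scaler_nat mulr2n.
  by rewrite cnormZR ger0_norm.
by rewrite (le_trans (cnormD _ _))// cnorm_star mulr2n mulrDl mul1r lerD.
Qed.

(** For self-adjoint [h] the norm condition says that the spectrum lies in [[0, 2t]]. In this form
    sums of positive elements are immediate, whereas the positivity of [star b ** b] is a theorem,
    [cpos_star_mul]. *)
Definition cpos h := star h = h /\ exists2 t, 0 <= t & cnorm (scal t - h) <= t.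

Lemma cpos_sa h : cpos h -> star h = h. Proof. by case. Qed.

Lemma cpos_scal_sub h s : star h = h -> cnorm h <= s -> cpos (scal s - h).
Proof.
move=> sh hs; split; first by rewrite starB star_scal sh.
exists s; first exact: le_trans (cnorm_ge0 _) hs.
by rewrite opprB addrC subrK.
Qed.

Lemma cpos_scal s : 0 <= s -> cpos (scal s).
Proof.
by move=> s0; rewrite -(subr0 (scal s)); apply: cpos_scal_sub; rewrite ?star0 ?cnorm0.
Qed.

Lemma cpos0 : cpos 0.
Proof. by split; [rewrite star0|exists 0; rewrite // subr0 /scal scale0r cnorm0]. Qed.

Lemma cposD h k : cpos h -> cpos k -> cpos (h + k).
Proof.
move=> [sh [s s0 hs]] [sk [t t0 kt]]; split; first by rewrite starD sh sk.
exists (s + t); first exact: addr_ge0.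
by rewrite scalD opprD addrACA (le_trans (cnormD _ _))// lerD.
Qed.

Lemma cposZ h s : 0 <= s -> cpos h -> cpos (s%:C *: h).
Proof.
move=> s0 [sh [t t0 ht]]; split; first by rewrite starZR sh.
exists (s * t); first exact: mulr_ge0.
rewrite /scal rmorphM -scalerA -scalerBr cnormZR ger0_norm//.
by rewrite ler_wpM2l.
Qed.

(** [h + d] is [(t + d) - (t - h)] with [|t - h| <= t < t + d]; the shift by [d] provides the strict
    inequality under which the iteration converges. *)
Lemma cpos_sqrt h d : cpos h -> 0 < d ->
  exists k, [/\ star k = k, k ** k = h + scal d
    & forall z, z ** h = h ** z -> z ** k = k ** z].
Proof.
move=> [sh [t t0 ht]] d0.
have [||k [sk kk kc]] := @sqrt_scal_sub (scal t - h) (t + d).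
- by rewrite starB star_scal sh.
- by rewrite (le_lt_trans ht)// ltrDl.
exists k; split=> // [|z zh].
  by rewrite kk scalD opprB addrC addrA subrK.
by apply: kc; rewrite smulBr smulBl smulx_scal smul_scal zh.
Qed.

(** If [l] is the root of [s - k^2], then [l^2 + k^2 = s], and [circle_norm] gives [|l|^2 <= s]. *)
Lemma cnorm_scal_sub_sqr k s : star k = k -> cnorm (k ** k) < s ->
  cnorm (scal s - k ** k) <= s.
Proof.
move=> sk ks; have s0 : 0 <= s by exact: le_trans (cnorm_ge0 _) (ltW ks).
have [|//|l [sl ll lc]] := @sqrt_scal_sub (k ** k) s; first by rewrite starM sk.
rewrite -ll cnorm_sqr// -(sqr_sqrtr s0) ler_sqr ?nnegrE ?cnorm_ge0 ?sqrtr_ge0//.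
apply: (@circle_norm l k) => //.
  by rewrite lc// smulA.
by rewrite ll subrK sqr_sqrtr.
Qed.

Lemma cpos_sqr k : star k = k -> cpos (k ** k).
Proof.
move=> sk; split; first by rewrite starM sk.
exists (cnorm (k ** k) + 1); first by rewrite addr_ge0 ?cnorm_ge0.
by apply: cnorm_scal_sub_sqr => //; rewrite ltrDl.
Qed.

(** The witness [t] of [cpos] can be any bound of [|h|]: up to small scalars [h] is a square, to
    which [cnorm_scal_sub_sqr] applies. *)
Lemma cpos_norm h s : cpos h -> cnorm h <= s -> cnorm (scal s - h) <= s.
Proof.
move=> ph hs; apply/ler_addgt0Pr => d d0.
have d4 : 0 < d / 4 by rewrite divr_gt0.
have [k [sk kk _]] := cpos_sqrt ph d4.
have kn : cnorm (k ** k) < s + d / 2.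
  rewrite kk (le_lt_trans (cnormD _ _))//.
  have := cnorm_scal (d / 4); rewrite gtr0_norm// => nd; lra.
have := cnorm_scal_sub_sqr sk kn; rewrite kk => H.
have -> : scal s - h = scal (s + d / 2) - (h + scal (d / 4)) - scal (d / 4).
  have -> : scal (s + d / 2) = scal s + scal (d / 4) + scal (d / 4).
    by rewrite -!scalD; congr scal; field.
  by rewrite opprD addrA addrAC addrK addrAC addrK.
rewrite (le_trans (cnormB _ _))//.
have := cnorm_scal (d / 4); rewrite gtr0_norm// => nd; lra.
Qed.

(** By [cpos_norm] the witness for [h + d] can be taken to be [|h| + d], which has a limit. So
    positivity may be proved up to small scalars, the form in which roots are available. *)
Lemma cpos_closed h : (forall d, 0 < d -> cpos (h + scal d)) -> cpos h.
Proof.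
move=> hd; split.
  have [+ _] := hd 1 ltr01; rewrite starD star_scal; exact: addIr.
exists (cnorm h); first exact: cnorm_ge0.
apply/ler_addgt0Pr => d d0.
have -> : scal (cnorm h) - h = scal (cnorm h + d) - (h + scal d).
  by rewrite scalD opprD addrACA subrr addr0.
apply: cpos_norm; first exact: hd.
rewrite (le_trans (cnormD _ _))// lerD2l (le_trans (cnorm_scal _))//.
by rewrite gtr0_norm.
Qed.

(** Commuting roots [l], [m] of [h + t] and [k + t] give [(l m)^2 = h k + t (h + k) + t^2]. The
    error is at most [t c <= d], as [t <= 1]. *)
Lemma cposM h k : cpos h -> cpos k -> h ** k = k ** h -> cpos (h ** k).
Proof.
move=> ph pk hk; apply: cpos_closed => d d0.
set c := cnorm h + cnorm k + 1.
have c0 : 0 < c by rewrite ltr_wpDl// addr_ge0 ?cnorm_ge0.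
pose t := Num.min 1 (d / c).
have t0 : 0 < t by rewrite lt_min ltr01 divr_gt0.
have t1 : t <= 1 by rewrite ge_min lexx.
have tc : t * c <= d by rewrite -ler_pdivlMr// ge_min lexx orbT.
have [l [sl ll lc]] := cpos_sqrt ph t0.
have [m [sm mm mc]] := cpos_sqrt pk t0.
have lm : l ** m = m ** l by rewrite mc// lc.
have -> : h ** k + scal d = (l ** m) ** (l ** m)
    + (scal d - (t%:C *: (h + k) + scal (t ^+ 2))).
  rewrite smulA -(smulA l m) -lm -!smulA mm !smulA ll.
  rewrite smulDl !smulDr smulx_scal smul_scal [scal t ** scal t]smul_scal.
  rewrite {4}/scal scalerA -rmorphM -expr2 -/(scal (t ^+ 2)) scalerDr.
  rewrite [_ + (_ - _)]addrCA [RHS]addrC; congr (_ + _).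
  have -> : h ** k + t%:C *: h + (t%:C *: k + scal (t ^+ 2)) =
     h ** k + (t%:C *: h + t%:C *: k + scal (t ^+ 2)) by rewrite !addrA.
  by rewrite addrK.
apply: cposD; first by apply: cpos_sqr; rewrite starM sl sm.
apply: cpos_scal_sub.
  by rewrite starD starZR starD star_scal (cpos_sa ph) (cpos_sa pk).
apply: le_trans tc; apply: (le_trans (cnormD _ _)).
rewrite cnormZR gtr0_norm// /c mulrDr mulr1 lerD//.
  by apply: ler_wpM2l; [exact: ltW|exact: cnormD].
rewrite (le_trans (cnorm_scal _))// gtr0_norm ?exprn_gt0//.
by rewrite expr2 ler_piMr// ltW.
Qed.

(** [t^2 - g^2 = (t + g) (t - g)] is a product of commuting positive elements; with a root [l] of
    it, up to [d], [circle_norm] applies to [g] and [l]. *)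
Lemma cpos_norm_le g t : star g = g -> 0 <= t ->
  cpos (scal t + g) -> cpos (scal t - g) -> cnorm g <= t.
Proof.
move=> sg t0 p1 p2.
have pE : (scal t + g) ** (scal t - g) = scal (t ^+ 2) - g ** g.
  rewrite smulDl !smulBr !smulx_scal smul_scal subrKA.
  by rewrite /scal scalerA -rmorphM -expr2.
have p3 : cpos (scal (t ^+ 2) - g ** g).
  rewrite -pE; apply: cposM => //; rewrite pE smulBl !smulDr !smulx_scal.
  by rewrite smul_scal addrKA /scal scalerA -rmorphM -expr2.
rewrite -ler_sqr ?nnegrE ?cnorm_ge0//; apply/ler_addgt0Pr => d d0.
have td : 0 <= t ^+ 2 + d by rewrite addr_ge0 ?exprn_ge0// ltW.
have [l [sl ll lc]] := cpos_sqrt p3 d0.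
rewrite -(sqr_sqrtr td) ler_sqr ?nnegrE ?cnorm_ge0 ?sqrtr_ge0//.
apply: (@circle_norm g l) => //.
  by rewrite lc// smulBr smulBl smulA smulx_scal smul_scal.
by rewrite ll sqr_sqrtr// scalD addrC addrAC subrK.
Qed.

Lemma cpos_le_norm h t : 0 <= t -> cpos h -> cpos (scal t - h) -> cnorm h <= t.
Proof.
move=> t0 ph pt; apply: cpos_norm_le => //; first exact: cpos_sa.
by apply: cposD => //; exact: cpos_scal.
Qed.

Lemma cpos_norm_mono h k : cpos h -> cpos (k - h) -> cnorm h <= cnorm k.
Proof.
move=> ph pkh; apply: cpos_le_norm => //; first exact: cnorm_ge0.
rewrite -(subrKA k); apply: cposD => //; apply: cpos_scal_sub => //.
by have := cposD ph pkh; rewrite addrC subrK => /cpos_sa.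
Qed.

(** An upper bound on [a = star c ** c] in the order bounds its norm, before [a] is known to be
    positive. The substitute for positivity is the comparison of [a] with [p = c ** star c], which
    has the same norm. *)
Lemma cnorm_star_mul_small c d : 0 <= d -> cpos (scal d - star c ** c) ->
  cnorm (star c ** c) <= 5 * d.
Proof.
move=> d0 pd; set a := star c ** c; set p := c ** star c; set T := cnorm a.
have sa : star a = a by rewrite starM starK.
have sp : star p = p by rewrite starM starK.
have T0 : 0 <= T by exact: cnorm_ge0.
have cT : cnorm c ^+ 2 = T by rewrite -cnorm_star_mul.
have pT : cnorm p = T by rewrite cnorm_mul_star.
(* [p + a] is half a sum of squares of self-adjoint elements, so [a <= d] forces [p >= -d]. *)
have pp : cpos (p + scal d).
  have -> : p + scal d = (p + a) + (scal d - a) by rewrite addrACA subrr addr0.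
  apply: cposD => //.
  pose x := c + star c; pose y := 'i *: (c - star c).
  have -> : p + a = (2^-1)%:C *: (x ** x + y ** y).
    have half2 : 2^-1 + 2^-1 = 1 :> R by field.
    have -> : x ** x + y ** y = (p + a) + (p + a).
      rewrite /x /y smulZl smulZr scalerA -expr2 sqr_i scaleN1r.
      rewrite smulBl smulDl !smulBr !smulDr -/a -/p !opprB.
      by rewrite [LHS](AC ((2*2)*(2*2)) (((2*3)*(7*5))*((1*8)*(4*6)))) /= !subrr !addr0.
    by rewrite scalerDr -scalerDl -rmorphD half2 scale1r.
  apply: cposZ; first by rewrite invr_ge0.
  apply: cposD; apply: cpos_sqr; first by rewrite /x starD starK addrC.
  rewrite /y starZ starB starK -[RHS]opprK -scalerN -scaleNr opprB; congr (_ *: _).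
  by apply/eqP; rewrite eq_complex /= oppr0 !eqxx.
have Tp : cnorm (scal T - p) <= T + d.
  have -> : scal T - p = scal (T + d) - (p + scal d).
    by rewrite scalD opprD addrACA subrr addr0.
  apply: cpos_norm => //; rewrite -pT (le_trans (cnormD _ _))// lerD2l.
  by rewrite (le_trans (cnorm_scal _))// ger0_norm.
pose w := c ** (scal T - a).
have wE : w = (scal T - p) ** c.
  by rewrite /w smulBr smulBl smulx_scal smul_scal /a /p smulA.
have wn : cnorm (star w ** w) <= (T + d) ^+ 2 * T.
  rewrite cnorm_star_mul -cT -exprMn ler_sqr ?nnegrE ?mulr_ge0 ?cnorm_ge0//.
    rewrite wE (le_trans (cnormM _ _))// cT ler_wpM2r ?cnorm_ge0//.
  by rewrite addr_ge0// exprn_ge0// cnorm_ge0.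
pose z := scal (T ^+ 2) + a ** a.
have pz : cpos z by apply: cposD; [apply: cpos_scal; exact: exprn_ge0|exact: cpos_sqr].
have az : a ** z = z ** a by rewrite /z smulDl smulDr smulx_scal smul_scal smulA.
have pdz : cpos ((scal d - a) ** z).
  by apply: cposM => //; rewrite smulBl smulBr smulx_scal smul_scal az.
(* [star w ** w] is [a (T - a)^2], so [a z] exceeds it by [2 T a^2]. Thus [2 T a^2] is dominated by
   [d z - star w ** w], whose norm is under control. *)
have E : (scal d - a) ** z = d%:C *: z - star w ** w - (2 * T)%:C *: (a ** a).
  have E1 : a ** z = star w ** w + (2 * T)%:C *: (a ** a).
    have -> : star w ** w = (T ^+ 2)%:C *: a - T%:C *: (a ** a)
        - (T%:C *: (a ** a) - a ** (a ** a)).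
      rewrite /w starM starB star_scal sa -smulA (smulA (star c)) -/a.
      rewrite smulBl smul_scal !smulBr !smulx_scal scalerBr smulZr scalerA.
      by rewrite -rmorphM -expr2.
    have -> : (2 * T)%:C *: (a ** a) = T%:C *: (a ** a) + T%:C *: (a ** a).
      by rewrite -scalerDl -rmorphD -mulr2n mulr_natl.
    rewrite opprB [RHS](AC ((2*2)*2) ((1*3)*((5*2)*(6*4)))) /= !subrr !addr0.
    by rewrite /z smulDr smulx_scal.
  by rewrite smulBl smul_scal E1 opprD addrA.
have paa : cpos ((2 * T)%:C *: (a ** a)).
  by apply: cposZ; [exact: mulr_ge0|exact: cpos_sqr].
have := @cpos_norm_mono ((2 * T)%:C *: (a ** a)) (d%:C *: z - star w ** w) paa.
rewrite -E => /(_ pdz); rewrite cnormZR cnorm_sqr// -/T.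
rewrite (@ger0_norm _ (2 * T)) ?mulr_ge0// => H1.
have H2 : cnorm (d%:C *: z - star w ** w) <= d * (2 * T ^+ 2) + (T + d) ^+ 2 * T.
  rewrite (le_trans (cnormB _ _))// lerD// cnormZR ger0_norm// ler_wpM2l//.
  rewrite mulr2n mulrDl mul1r (le_trans (cnormD _ _))// lerD//.
    by rewrite (le_trans (cnorm_scal _))// ger0_norm// exprn_ge0.
  by rewrite cnorm_sqr.
(* The estimate reads [2 T^3 <= 2 d T^2 + (T + d)^2 T], that is [T^2 <= 4 d T + d^2] for [T > 0].
   This fails if [T > 5 d], where also [d^2 <= d T]. *)
have {H1 H2} := le_trans H1 H2; rewrite leNgt => H; rewrite leNgt; apply/negP => Td.
apply/negP: H; rewrite negbK.
have Tp0 : 0 < T by apply: le_lt_trans Td; rewrite mulr_ge0.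
have -> : d * (2 * T ^+ 2) + (T + d) ^+ 2 * T = T * (T ^+ 2 + 4 * d * T + d ^+ 2).
  by ring.
have -> : 2 * T * T ^+ 2 = T * (2 * T ^+ 2) by ring.
rewrite ltr_pM2l//.
have dT : 0 <= d * T by rewrite mulr_ge0.
have : 5 * d * T < T * T by rewrite ltr_pM2r.
have : d * d <= d * T by rewrite ler_wpM2l//; lra.
rewrite !expr2; lra.
Qed.

Lemma iter_sqr_comm z k n : z ** k = k ** z ->
  z ** iter n (fun x => x ** x) k = iter n (fun x => x ** x) k ** z.
Proof. by move=> zk; elim: n => //= n IH; rewrite smulA IH -smulA IH smulA. Qed.

Lemma star_iter_sqr k n : star k = k ->
  star (iter n (fun x => x ** x) k) = iter n (fun x => x ** x) k.
Proof. by move=> sk; elim: n => //= n IH; rewrite starM IH. Qed.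

Lemma cnorm_iter_sqr k n : star k = k ->
  cnorm (iter n (fun x => x ** x) k) = cnorm k ^+ (2 ^ n).
Proof.
move=> sk; elim: n => [|n IH]; first by rewrite expr1.
by rewrite iterS cnorm_sqr ?star_iter_sqr// IH -exprM expnSr.
Qed.

(** The norm is multiplicative only on iterated squares. Here [l] is [k^(2^n - 1)], and
    [k^(2^(n+1))], of known norm, is the product of [k^(2^n + 1)] and [l]. *)
Lemma cnorm_iter_sqr_mul k n : star k = k -> 0 < cnorm k ->
  cnorm k ^+ (2 ^ n).+1 <= cnorm (iter n (fun x => x ** x) k ** k).
Proof.
move=> sk k0; set M := cnorm k; pose p j := iter j (fun x => x ** x) k.
have [l [pl ln]] : exists l, p n = k ** l /\ cnorm l * M <= M ^+ (2 ^ n).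
  elim: n => [|n [l [pl ln]]].
    by exists e; rewrite smulx1; split=> //; rewrite ler_piMl ?cnorm_unit// ltW.
  exists (l ** p n); split; first by rewrite smulA -pl.
  rewrite expnS mul2n -addnn exprD (@le_trans _ _ (cnorm l * M * M ^+ (2 ^ n)))//.
    rewrite -(cnorm_iter_sqr n sk) mulrAC ler_wpM2r ?cnorm_ge0//.
    exact: cnormM.
  by rewrite ler_wpM2r// exprn_ge0// ltW.
rewrite -(@ler_pM2r _ (M ^+ (2 ^ n))) ?exprn_gt0//.
rewrite exprS -mulrA -exprD addnn -mul2n -expnS -(cnorm_iter_sqr n.+1 sk).
rewrite iterS -/(p n) {2}pl mulrC smulA.
rewrite (@le_trans _ _ (cnorm (p n ** k) * (cnorm l * M)))//.
  by rewrite mulrA ler_wpM2r ?(ltW k0)// cnormM.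
by rewrite ler_wpM2l// cnorm_ge0.
Qed.

Lemma comm_addscal x z s : x ** z = z ** x -> x ** (z + scal s) = (z + scal s) ** x.
Proof. by move=> xz; rewrite smulDr smulDl xz smulx_scal smul_scal. Qed.

Lemma comm_subscal x z s : x ** z = z ** x -> x ** (z - scal s) = (z - scal s) ** x.
Proof. by move=> xz; rewrite smulBr smulBl xz smulx_scal smul_scal. Qed.

Lemma comm_mul x y z : x ** z = z ** x -> y ** z = z ** y ->
  (x ** y) ** z = z ** (x ** y).
Proof. by move=> xz yz; rewrite -smulA yz smulA xz smulA. Qed.

(** Induction from [(k - t)^2]: doubling the exponent multiplies by the positive factor
    [k^(2^n) + t^(2^n)], which commutes with the rest. *)
Lemma cpos_poly k t n : cpos k -> 0 <= t ->
  cpos ((k - scal t) ** (iter n (fun x => x ** x) k - scal (t ^+ (2 ^ n)))).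
Proof.
move=> pk t0; have sk := cpos_sa pk; set p := fun j => iter j (fun x => x ** x) k.
elim: n => [|n IH].
  by rewrite expr1; apply: cpos_sqr; rewrite starB star_scal sk.
have pp : cpos (p n) by case: n {IH} => // n; apply: cpos_sqr; exact: star_iter_sqr.
have kp : k ** p n = p n ** k by apply: iter_sqr_comm.
have -> : (k - scal t) ** (iter n.+1 (fun x => x ** x) k - scal (t ^+ (2 ^ n.+1))) =
  ((k - scal t) ** (p n - scal (t ^+ (2 ^ n)))) ** (p n + scal (t ^+ (2 ^ n))).
  rewrite -smulA; congr (_ ** _); rewrite smulBl !smulDr !smulx_scal smul_scal.
  by rewrite addrKA scalerA -rmorphM -exprD addnn -mul2n -expnS.
apply: cposM => //; first by apply: cposD => //; apply: cpos_scal; exact: exprn_ge0.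
by apply: comm_addscal; apply: comm_mul; apply/esym/comm_subscal.
Qed.

(* With [k := t - b^*b], the element [t^{n+1} - (b k^{n/2})^* (b k^{n/2})] is
   [(k - t) (k^n - t^n) + t^n k], hence positive, for [n] a power of 2. So
   [cnorm_star_mul_small] bounds [|k|^n (|k| - t)] by [5 t^{n+1}] for all such
   [n], which forces [|k| <= t]. *)
Lemma cpos_star_mul b : cpos (star b ** b).
Proof.
set h := star b ** b; have sh : star h = h by rewrite starM starK.
pose t := cnorm h + 1; have t0 : 0 < t by rewrite ltr_wpDl// cnorm_ge0.
have ht : cnorm h <= t by rewrite lerDl.
split=> //; exists t; first exact: ltW.
have [k kE] : exists k, k = scal t - h by exists (scal t - h).
have pk : cpos k by rewrite kE; exact: cpos_scal_sub.
have hE : h = scal t - k by rewrite kE opprB addrC subrK.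
rewrite -kE.
have sk := cpos_sa pk; rewrite leNgt; apply/negP => tM; set M := cnorm k in tM.
have M0 : 0 < M by exact: lt_trans tM.
have key n : M ^+ (2 ^ n.+1) * (M - t) <= 5 * t ^+ (2 ^ n.+1).+1.
  set p := fun j => iter j (fun x => x ** x) k; pose c := b ** p n.
  have hk : h ** k = k ** h.
    by rewrite kE smulBl smulBr smulx_scal smul_scal.
  have ccE : star c ** c = t%:C *: p n.+1 - p n.+1 ** k.
    rewrite /c starM star_iter_sqr// -smulA (smulA (star b)) -/h iter_sqr_comm//.
    rewrite smulA -[p n ** _]/(p n.+1).
    by rewrite hE smulBr smulx_scal.
  have pc : cpos (scal (t ^+ (2 ^ n.+1).+1) - star c ** c).
    have -> : scal (t ^+ (2 ^ n.+1).+1) - star c ** c =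
      (k - scal t) ** (p n.+1 - scal (t ^+ (2 ^ n.+1)))
      + (t ^+ (2 ^ n.+1))%:C *: k.
      rewrite ccE smulBl !smulBr !smulx_scal smul_scal iter_sqr_comm//.
      have -> : (t ^+ (2 ^ n.+1))%:C *: scal t = scal (t ^+ (2 ^ n.+1).+1).
        by rewrite /scal scalerA -rmorphM -exprSr.
      by rewrite !opprB [RHS](AC ((2*2)*1) ((2*5)*(3*(1*4)))) /= addNr add0r.
    apply: cposD; first by apply: cpos_poly => //; exact: ltW.
    by apply: cposZ => //; rewrite exprn_ge0// ltW.
  have := cnorm_star_mul_small _ pc; rewrite exprn_ge0 ?(ltW t0)// => /(_ isT).
  apply: le_trans; rewrite mulrBr lerBlDr -exprSr.
  apply: (le_trans (cnorm_iter_sqr_mul n.+1 sk M0)).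
  rewrite -/(p n.+1) (_ : p n.+1 ** k = t%:C *: p n.+1 - star c ** c); last first.
    by rewrite ccE opprB addrC subrK.
  rewrite [leRHS]addrC (le_trans (cnormB _ _))// lerD// cnormZR gtr0_norm//.
  by rewrite cnorm_iter_sqr// mulrC.
(* [key] says that [(M - t) / (5 t) <= (t / M)^(2^(n+1))] for all [n], and the right side tends to 0
   as [t < M]. *)
have q0 : 0 <= t / M by rewrite divr_ge0// ltW.
have q1 : t / M < 1 by rewrite ltr_pdivrMr// mul1r.
have [||N tN] := @expr_small R (t / M) ((M - t) / (5 * t)); first by rewrite q0.
  by rewrite divr_gt0 ?subr_gt0// mulr_gt0.
have Nn : (N <= 2 ^ N.+1)%N by rewrite (leq_trans (leqnSn N))// ltnW// ltn_expl.
have := key N; rewrite leNgt => /negP; apply.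
have : (t / M) ^+ (2 ^ N.+1) < (M - t) / (5 * t).
  apply: le_lt_trans tN; rewrite -(subnKC Nn) exprD ler_piMr ?exprn_ge0//.
  by rewrite exprn_ile1// ltW.
rewrite expr_div_n ltr_pdivrMr ?exprn_gt0// mulrAC ltr_pdivlMr ?mulr_gt0//.
by rewrite exprS [M ^+ _ * _]mulrC [t * _]mulrC mulrCA.
Qed.

End UnitalCstar.

Lemma dense_cnorm (R : realType) (A : Type) (B : cstarAlgType R) (i : A -> B) :
  dense (range i) -> forall b (d : R), 0 < d -> exists a, cnorm (i a - b) < d.
Proof.
move=> di b d d0; have d0' : 0 < d%:C :> R[i] by rewrite ltcR.
have : (interior (ball b d%:C) `&` range i) !=set0.
  by apply: di; [exists b; exact: nbhsx_ballx|exact: open_interior].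
case=> y [yb [a _ ay]]; move: yb; rewrite -ay => /interior_subset.
rewrite -ball_normE /= cnormE ltcR => ab.
by exists a; rewrite cnorm_distC.
Qed.

(** * Units of completions and positive maps on a dense subalgebra *)

Section CompletionUnit.
Context (R : realType) (A : starAlgType R) (one : A).
Hypotheses (one_l : forall a, one ** a = a) (one_r : forall a, a ** one = a).
Context (B : cstarAlgType R) (i : A -> B).
Hypotheses (ih : star_hom i) (di : dense (range i)).

Lemma star_homD a b : i (a + b) = i a + i b.
Proof. by have [il _ _] := ih; have := il 1 a b; rewrite !scale1r. Qed.

Lemma star_hom0 : i 0 = 0.
Proof. by apply: (addIr (i 0)); rewrite -star_homD !add0r. Qed.

Lemma star_homZ k a : i (k *: a) = k *: i a.
Proof. by have [il _ _] := ih; have := il k a 0; rewrite star_hom0 !addr0. Qed.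

Lemma star_homN a : i (- a) = - i a.
Proof. by rewrite -scaleN1r star_homZ scaleN1r. Qed.

Lemma star_homB a b : i (a - b) = i a - i b.
Proof. by rewrite star_homD star_homN. Qed.

Lemma star_homM a b : i (a ** b) = i a ** i b.
Proof. by have [_ iM _] := ih; exact: iM. Qed.

Lemma star_homS a : i (star a) = star (i a).
Proof. by have [_ _ iS] := ih; exact: iS. Qed.

Lemma star_hom_sum (I : Type) (s : seq I) (F : I -> A) :
  i (\sum_(k <- s) F k) = \sum_(k <- s) i (F k).
Proof. exact: (big_morph i star_homD star_hom0). Qed.

Lemma completion_one_l b : i one ** b = b.
Proof.
apply/eqP; rewrite -subr_eq0; apply/eqP.
apply: (@cnorm_eq0P _ _ _ (cnorm (i one) + 1)) => d d0.
have [a /ltW ab] := dense_cnorm di b d0.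
have -> : i one ** b - b = (i a - b) - i one ** (i a - b).
  by rewrite smulBr -star_homM one_l opprB [RHS](AC (2*2) ((1*4)*(3*2))) /= subrr add0r.
rewrite (le_trans (cnormB _ _))// mulrDl mul1r addrC lerD//.
by rewrite (le_trans (cnormM _ _))// ler_wpM2l// cnorm_ge0.
Qed.

Lemma completion_one_r b : b ** i one = b.
Proof.
have star_one : star one = one.
  by rewrite -[RHS]starK -[in RHS](one_r (star one)) starM starK one_r.
by rewrite -[LHS]starK starM -star_homS star_one completion_one_l starK.
Qed.

End CompletionUnit.

Section PositiveMap.
Context (R : realType) (A : starAlgType R) (one : A).
Hypotheses (one_l : forall a, one ** a = a) (one_r : forall a, a ** one = a).
Context (B C : cstarAlgType R) (i : A -> B) (j : A -> C).
Hypotheses (ih : star_hom i) (di : dense (range i)).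
Hypotheses (jh : star_hom j) (dj : dense (range j)).

(* A positive unital map is contractive on self-adjoint elements even when it is
   positive on the dense subalgebra only, provided that it is bounded: then
   [c - b] is almost of the form [a^* a] with [a] in the subalgebra. *)
Lemma positive_map_contractive (F : A -> A) (K : R) :
  linear F -> F one = one ->
  (forall a, exists s : seq A, F (star a ** a) = \sum_(z <- s) star z ** z) ->
  (forall a, cnorm (i (F a)) <= K * cnorm (j a)) ->
  forall b, star b = b -> cnorm (i (F b)) <= cnorm (j b).
Proof.
move=> Fl F1 Fpos FK.
have B1l := completion_one_l one_l ih di; have B1r := completion_one_r one_l one_r ih di.
have C1l := completion_one_l one_l jh dj; have C1r := completion_one_r one_l one_r jh dj.
have star_one : star one = one.
  by rewrite -[RHS]starK -[in RHS](one_r (star one)) starM starK one_r.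
have FD a b : F (a + b) = F a + F b by have := Fl 1 a b; rewrite !scale1r.
have F0 : F 0 = 0 by apply: (addIr (F 0)); rewrite -FD !add0r.
have FZ k a : F (k *: a) = k *: F a by have := Fl k a 0; rewrite F0 !addr0.
have FN a : F (- a) = - F a by rewrite -scaleN1r FZ scaleN1r.
have iFpos a : cpos (i one) (i (F (star a ** a))).
  have [s ->] := Fpos a; rewrite (star_hom_sum ih); elim/big_ind: _ => [|x y|z _].
  - exact: cpos0.
  - exact: cposD.
  - by rewrite (star_homM ih) (star_homS ih); exact: cpos_star_mul.
(* Polarization: with [x = b + one], [2 b] is a combination of three elements [star z ** z], whose
   images are positive, hence self-adjoint. *)
have iFsa b : star b = b -> star (i (F b)) = i (F b).
  move=> sb; pose x := b + one.
  have bE : b + b = star x ** x - star b ** b - star one ** one.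
    rewrite /x starD sb star_one smulDl !smulDr !one_l one_r.
    by rewrite [RHS](AC ((2*2)*1*1) ((2*3)*((1*5)*(4*6)))) /= !subrr !addr0.
  clearbody x; have : star (i (F (b + b))) = i (F (b + b)).
    rewrite bE !(FD, FN) !(star_homD ih, star_homN ih) !(starD, starN).
    by rewrite !(cpos_sa (iFpos _)).
  rewrite FD (star_homD ih) starD => E; have : (2 : R[i]) *: star (i (F b)) = (2 : R[i]) *: i (F b).
    by rewrite !scaler_nat !mulr2n.
  by move=> /(congr1 (fun y => 2^-1 *: y)); rewrite !scalerA mulVf ?scale1r// pnatr_eq0.
(* In [C], [c - j b] is a square [k^2], and [k] is replaced by some [j a] within [r]. The remainder
   [u = c - b - star a ** a] has [|j u| <= r (2 |k| + 1)], so [F (c - b)] is the positive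
   [F (star a ** a)] plus a term that [K] makes smaller than [d]. *)
have key b c : star b = b -> cnorm (j b) < c -> cpos (i one) (scal (i one) c - i (F b)).
  move=> sb bc; have sjb : star (j b) = j b by rewrite -(star_homS jh) sb.
  have [k [sk kk _]] := sqrt_scal_sub C1l C1r sjb bc.
  apply: (cpos_closed B1l B1r) => d d0.
  pose M := `|K| * (2 * cnorm k + 1) + 1.
  have M0 : 0 < M.
    by rewrite ltr_wpDl// mulr_ge0// addr_ge0// mulr_ge0// cnorm_ge0.
  pose r := Num.min 1 (d / M).
  have r0 : 0 < r by rewrite lt_min ltr01 divr_gt0.
  have r1 : r <= 1 by rewrite ge_min lexx.
  have rM : r * M <= d by rewrite -ler_pdivlMr// ge_min lexx orbT.
  have [a /ltW ak] := dense_cnorm dj k r0.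
  pose u := c%:C *: one - b - star a ** a.
  have su : star u = u by rewrite /u !starB starZR star_one sb starM starK.
  have ju : cnorm (j u) <= r * (2 * cnorm k + 1).
    have -> : j u = - ((star (j a) - k) ** j a + k ** (j a - k)).
      rewrite /u !(star_homB jh) (star_homZ jh) -/(scal (j one) c) -kk (star_homM jh) (star_homS jh).
      by rewrite smulBl smulBr subrKA opprB.
    rewrite cnormN (le_trans (cnormD _ _))//.
    apply: (le_trans (lerD (cnormM _ _) (cnormM _ _))).
    have ja : cnorm (j a) <= cnorm k + 1.
      rewrite -(subrK k (j a)) (le_trans (cnormD _ _))// addrC lerD//.
      exact: le_trans ak r1.
    have -> : r * (2 * cnorm k + 1) = r * (cnorm k + 1) + cnorm k * r by ring.
    rewrite lerD// ?ler_wpM2l ?cnorm_ge0// ler_pM ?cnorm_ge0//.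
    by rewrite -{1}sk -starB cnorm_star.
  have -> : scal (i one) c - i (F b) + scal (i one) d =
      i (F (star a ** a)) + (scal (i one) d - i (F (- u))).
    rewrite FN (star_homN ih) opprK /u !FD !FN FZ F1 !(star_homD ih) !(star_homN ih) (star_homZ ih).
    rewrite -/(scal (i one) c) [RHS](AC (1*(1*(2*1))) ((3*4)*2*(1*5))) /=.
    by rewrite subrr addr0.
  apply: cposD => //; apply: (cpos_scal_sub B1r).
    by apply: iFsa; rewrite starN su.
  rewrite (le_trans (FK _))// (star_homN jh) cnormN.
  apply: (@le_trans _ _ (`|K| * cnorm (j u))).
    by rewrite ler_wpM2r ?cnorm_ge0// ler_norm.
  apply: le_trans rM; apply: (@le_trans _ _ (`|K| * (r * (2 * cnorm k + 1)))).
    exact: ler_wpM2l.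
  by rewrite mulrCA ler_wpM2l ?(ltW r0)// /M lerDl.
move=> b sb; apply/ler_addgt0Pr => d d0.
have bd : cnorm (j b) < cnorm (j b) + d by rewrite ltrDl.
apply: (cpos_norm_le B1l B1r); first exact: iFsa.
- by rewrite addr_ge0 ?cnorm_ge0// ltW.
- have := key (- b) (cnorm (j b) + d); rewrite starN sb (star_homN jh) cnormN.
  by rewrite FN (star_homN ih) opprK; exact.
- exact: key.
Qed.

End PositiveMap.

(** * Reiter's condition *)

Section HahnBanach.
Context (R : realType) (V : lmodType R).
Implicit Types (p q : V -> R) (x y : V) (c t : R).

Definition sublinear p : Prop :=
  (forall x y, p (x + y) <= p x + p y) /\
  (forall c x, 0 <= c -> p (c *: x) <= c * p x).

Lemma sublinear0 p : sublinear p -> p 0 = 0.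
Proof.
move=> [pD pZ]; apply/eqP; rewrite eq_le; apply/andP; split.
  by have := pZ 0 0 (lexx _); rewrite scaler0 mul0r.
by have := pD 0 0; rewrite addr0 -lerBlDr subrr.
Qed.

Lemma sublinearZ p c x : sublinear p -> 0 <= c -> p (c *: x) = c * p x.
Proof.
move=> sp; rewrite le_eqVlt => /predU1P[<-|c0].
  by rewrite scale0r mul0r sublinear0.
apply/eqP; rewrite eq_le (sp.2 _ _ (ltW c0)) /=.
rewrite -(@ler_pM2l _ c^-1) ?invr_gt0// mulKf ?gt_eqF//.
have c'0 : 0 <= c^-1 by rewrite invr_ge0 ltW.
by have := sp.2 _ (c *: x) c'0; rewrite scalerA mulVf ?gt_eqF// scale1r.
Qed.

Lemma sublinear_geN p x : sublinear p -> - p (- x) <= p x.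
Proof.
by move=> sp; rewrite -subr_ge0 opprK -(sublinear0 sp) -(subrr x) sp.1.
Qed.

(* Lowering [p] along the ray of [y]: the reason why a minimal sublinear
   functional is additive. *)
Lemma sublinear_lower p y : sublinear p -> exists r,
  [/\ sublinear r, forall x, r x <= p x & forall x, r x <= p (x + y) - p y].
Proof.
move=> sp.
pose E x := [set p (x + t *: y) - t * p y | t in [set t | 0 <= t]].
have lbE x : lbound (E x) (- p (- x)).
  move=> _ [t /= t0 <-]; rewrite lerBrDr -(sublinearZ y sp t0) addrC.
  rewrite lerBlDr -[X in p X <= _](addrK x) (addrC (t *: y)); exact: sp.1.
have iE x : has_inf (E x).
  split; last by exists (- p (- x)); exact: lbE.
  by exists (p (x + 0 *: y) - 0 * p y); exists 0 => /=.
have rE x t : 0 <= t -> inf (E x) <= p (x + t *: y) - t * p y.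
  by move=> t0; apply: ge_inf; [exact: (iE x).2|exists t].
exists (fun x => inf (E x)); split.
- split=> [x x'|c x].
    apply/ler_addgt0Pr => d d0; have d2 : 0 < d / 2 by rewrite divr_gt0.
    have [_ [t /= t0 <-] tx] := inf_adherent d2 (iE x).
    have [_ [t' /= t'0 <-] tx'] := inf_adherent d2 (iE x').
    apply: le_trans (rE _ _ (addr_ge0 t0 t'0)) _; rewrite scalerDl addrACA.
    have := sp.1 (x + t *: y) (x' + t' *: y).
    by rewrite mulrDl; lra.
  rewrite le_eqVlt => /predU1P[<-|c0].
    rewrite scale0r mul0r -[leRHS](sublinear0 sp) (le_trans (rE _ 0 _))//.
    by rewrite scale0r addr0 mul0r subr0.
  rewrite mulrC -ler_pdivrMr//; apply: lb_le_inf; first exact: (iE x).1.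
  move=> _ [t /= t0 <-]; rewrite ler_pdivrMr//.
  apply: (le_trans (rE _ (c * t) _)); first by rewrite mulr_ge0// ltW.
  rewrite -scalerA -scalerDr (sublinearZ _ sp (ltW c0)).
  by rewrite -mulrA -mulrBr mulrC.
- by move=> x; apply: (le_trans (rE x 0 _)); rewrite // scale0r addr0 mul0r subr0.
- by move=> x; apply: (le_trans (rE x 1 _)); rewrite // scale1r mul1r.
Qed.

Lemma minimal_sublinear_linear p : sublinear p ->
  (forall r, sublinear r -> (forall x, r x <= p x) -> r = p) ->
  forall c x y, p (c *: x + y) = c * p x + p y.
Proof.
move=> sp pmin.
have pD x y : p (x + y) = p x + p y.
  apply/eqP; rewrite eq_le sp.1 /=.
  have [r [sr rp ry]] := sublinear_lower y sp.
  by have := ry x; rewrite (pmin _ sr rp) lerBrDr.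
have pN x : p (- x) = - p x.
  by apply/eqP; rewrite -addr_eq0 -pD addNr sublinear0.
move=> c x y; rewrite pD; congr (_ + _).
have [c0|/ltW c0] := leP 0 c; first exact: sublinearZ.
rewrite -[c]opprK scaleNr pN mulNr; congr (- _).
by apply: sublinearZ; rewrite // oppr_ge0.
Qed.

(** The pointwise infimum is finite, since [p x >= - p (- x) >= - q (- x)], and subadditive, since
    of two members of the chain the smaller one serves at both points. *)
Lemma sublinear_chain_inf q (A : set (V -> R)) : A !=set0 ->
  (forall p, A p -> sublinear p /\ forall x, p x <= q x) ->
  (forall p p', A p -> A p' -> (forall x, p x <= p' x) \/ (forall x, p' x <= p x)) ->
  exists r, [/\ sublinear r, forall x, r x <= q x & forall p, A p -> forall x, r x <= p x].
Proof.
move=> [p0 Ap0] Aq Atot; pose E x := [set p x | p in A].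
have iE x : has_inf (E x).
  split; first by exists (p0 x); exists p0.
  exists (- q (- x)) => _ [p Ap <-]; have [sp pq] := Aq _ Ap.
  by apply: le_trans (sublinear_geN x sp); rewrite lerN2.
have rE x p : A p -> inf (E x) <= p x.
  by move=> Ap; apply: ge_inf; [exact: (iE x).2|exists p].
exists (fun x => inf (E x)); split; first split.
- move=> x y; apply/ler_addgt0Pr => d d0; have d2 : 0 < d / 2 by rewrite divr_gt0.
  have [_ [p Ap <-] px] := inf_adherent d2 (iE x).
  have [_ [p' Ap' <-] p'y] := inf_adherent d2 (iE y).
  have [h|h] := Atot _ _ Ap Ap'.
    have := rE (x + y) p Ap; have := (Aq _ Ap).1.1 x y; have := h y; lra.
  have := rE (x + y) p' Ap'; have := (Aq _ Ap').1.1 x y; have := h x; lra.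
- move=> c x c0; move: (c0); rewrite le_eqVlt => /predU1P[<-|c'0].
    by have := rE (0 *: x) p0 Ap0; rewrite scale0r mul0r (sublinear0 (Aq _ Ap0).1).
  rewrite mulrC -ler_pdivrMr//; apply: lb_le_inf; first exact: (iE x).1.
  move=> _ [p Ap <-]; rewrite ler_pdivrMr// (le_trans (rE _ p Ap))//.
  by rewrite mulrC; exact: (Aq _ Ap).1.2.
- by move=> x; rewrite (le_trans (rE x p0 Ap0))//; exact: (Aq _ Ap0).2.
- by move=> p Ap x; exact: rE.
Qed.

(** No extension from subspaces: Zorn's lemma, for the reversed order [Rel], gives a minimal
    sublinear functional below [q], and such a functional is linear. *)
Lemma hahn_banach_sublinear q : sublinear q ->
  exists2 f : V -> R, forall c x y, f (c *: x + y) = c * f x + f y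
    & forall x, f x <= q x.
Proof.
move=> sq; pose T := {p : V -> R | sublinear p /\ forall x, p x <= q x}.
pose Rel (p r : T) : bool := `[< forall x, sval r x <= sval p x >].
have T_inj (p r : T) : sval p = sval r -> p = r.
  by case: p r => [p hp] [r hr] /= pr; subst r; congr exist; exact: Prop_irrelevance.
have [||||[p [sp pq]] pmin] := @Zorn T Rel.
- by move=> p; apply/asboolP.
- move=> p r s /asboolP pr /asboolP rs; apply/asboolP => x.
  exact: le_trans (rs x) (pr x).
- move=> p r /asboolP pr /asboolP rp; apply: T_inj; apply/funext => x.
  by apply/eqP; rewrite eq_le pr rp.
- move=> A Atot; have [[r0 Ar0]|A0] := pselect (exists r0 : T, A r0); last first.
    by exists (exist _ q (conj sq (fun x => lexx _))) => s As; case: A0; exists s.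
  have [|||r [sr rq rA]] :=
      @sublinear_chain_inf q [set sval r | r in A].
  + by exists (sval r0); exists r0.
  + by move=> _ [r Ar <-]; exact: svalP r.
  + move=> _ _ [r1 Ar1 <-] [r2 Ar2 <-].
    case: (Atot _ _ Ar1 Ar2) => /asboolP h; [right|left]; exact: h.
  + exists (exist _ r (conj sr rq)) => s As; apply/asboolP => x /=.
    by apply: rA; exists s.
- exists p => //; apply: minimal_sublinear_linear => // r sr rp.
  have rq x : r x <= q x by exact: le_trans (rp x) (pq x).
  have := pmin (exist _ r (conj sr rq)); rewrite /Rel => pmin'.
  by have [] : exist _ r (conj sr rq) = exist _ p (conj sp pq) :> T
    by apply: pmin'; exact/asboolP.
Qed.

End HahnBanach.

(** * Finitely supported functions with the [l^1] norm *)

Section FinitelySupported.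
Context (R : realType) (I : choiceType).

Definition finitely_supported : {pred (I -> R)} :=
  mem [set v : I -> R | finite_set [set i | v i <> 0]].

Lemma finitely_supported_submod : submod_closed finitely_supported.
Proof.
split=> [|c v w /set_mem vf /set_mem wf]; apply/mem_set.
  by apply: (@sub_finite_set _ _ set0) => // i; apply.
have : finite_set ([set i | v i <> 0] `|` [set i | w i <> 0]) by rewrite finite_setU.
apply: sub_finite_set => i /= vwi; apply: contrapT => /not_orP[/contrapT vi /contrapT wi].
by apply: vwi; rewrite -[LHS]/(c * v i + w i) vi wi mulr0 addr0.
Qed.

HB.instance Definition _ :=
  GRing.isSubmodClosed.Build R (I -> R) finitely_supported
    finitely_supported_submod.

Record fsfun1 := FSFun1 { fsval :> I -> R; _ : fsval \in finitely_supported }.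

HB.instance Definition _ := [isSub for fsval].
HB.instance Definition _ := [Choice of fsfun1 by <:].
HB.instance Definition _ := [SubChoice_isSubLmodule of fsfun1 by <:].

Implicit Types v w : fsfun1.

Definition fsupp v : {fset I} := fset_set [set i | v i <> 0].

Lemma notin_fsupp v i : i \notin fsupp v -> v i = 0.
Proof.
rewrite in_fset_set; last exact/set_mem/(valP v).
by move=> /negP h; apply: contrapT => ?; apply: h; exact/mem_set.
Qed.

Lemma fsval_in (f : I -> R) (S : {fset I}) : (forall i, i \notin S -> f i = 0) ->
  f \in finitely_supported.
Proof.
move=> fS; apply/mem_set; apply: (@sub_finite_set _ _ [set` S]); last exact: finite_fset.
by move=> i /= fi; apply: contrapT => /negP /fS.
Qed.

Lemma fsvalD v w i : (v + w) i = v i + w i. Proof. by []. Qed.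
Lemma fsvalZ c v i : (c *: v) i = c * v i. Proof. by []. Qed.

Definition l1norm v : R := \sum_(i \in [set: I]) `|v i|.

Definition fssum v : R := \sum_(i \in [set: I]) v i.

Lemma l1normE v (S : {fset I}) : (forall i, i \notin S -> v i = 0) ->
  l1norm v = \sum_(i <- S) `|v i|.
Proof. by move=> vS; rewrite /l1norm (fsbigTE S)// => i /vS ->; rewrite normr0. Qed.

Lemma fssumE v (S : {fset I}) : (forall i, i \notin S -> v i = 0) ->
  fssum v = \sum_(i <- S) v i.
Proof. by move=> vS; rewrite /fssum (fsbigTE S)// => i /vS ->. Qed.

Lemma l1norm0 : l1norm 0 = 0.
Proof. by rewrite (@l1normE _ fset0)// big_seq_fset0. Qed.

Lemma l1normD v w : l1norm (v + w) <= l1norm v + l1norm w.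
Proof.
pose S := (fsupp v `|` fsupp w)%fset.
have vS i : i \notin S -> v i = 0 by rewrite inE negb_or => /andP[/notin_fsupp].
have wS i : i \notin S -> w i = 0 by rewrite inE negb_or => /andP[_ /notin_fsupp].
rewrite (l1normE vS) (l1normE wS) (@l1normE _ S); last first.
  by move=> i iS; rewrite fsvalD vS// wS// addr0.
by rewrite -big_split ler_sum// => i _; exact: ler_normD.
Qed.

Lemma l1normZ c v : l1norm (c *: v) = `|c| * l1norm v.
Proof.
rewrite (l1normE (@notin_fsupp v)) (@l1normE _ (fsupp v)); last first.
  by move=> i /notin_fsupp vi; rewrite fsvalZ vi mulr0.
by rewrite mulr_sumr; apply: eq_bigr => i _; rewrite fsvalZ normrM.
Qed.

Lemma l1norm_ge0 v : 0 <= l1norm v.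
Proof. by rewrite (l1normE (@notin_fsupp v)) sumr_ge0. Qed.

Lemma l1norm_ge_sum v (s : seq I) : uniq s -> \sum_(i <- s) `|v i| <= l1norm v.
Proof.
move=> us; pose S := (fsupp v `|` [fset i in s])%fset.
rewrite (@l1normE _ S); last by move=> i; rewrite inE negb_or => /andP[/notin_fsupp].
have E : \sum_(i <- S | i \in s) `|v i| = \sum_(i <- s) `|v i|.
  rewrite -big_filter; apply: perm_big; apply: uniq_perm.
  - by rewrite filter_uniq ?fset_uniq.
  - exact: us.
  - by move=> i; rewrite mem_filter /S !inE; case: (i \in s); rewrite ?orbT.
rewrite [leRHS](bigID (fun i => i \in s)) /= E.
by rewrite lerDl sumr_ge0.
Qed.

Lemma fssumD v w : fssum (v + w) = fssum v + fssum w.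
Proof.
pose S := (fsupp v `|` fsupp w)%fset.
have vS i : i \notin S -> v i = 0 by rewrite inE negb_or => /andP[/notin_fsupp].
have wS i : i \notin S -> w i = 0 by rewrite inE negb_or => /andP[_ /notin_fsupp].
rewrite (fssumE vS) (fssumE wS) (@fssumE _ S) ?big_split//.
by move=> i iS; rewrite fsvalD vS// wS// addr0.
Qed.

Lemma fssumZ c v : fssum (c *: v) = c * fssum v.
Proof.
rewrite (fssumE (@notin_fsupp v)) (@fssumE _ (fsupp v)) ?mulr_sumr//.
by move=> i /notin_fsupp vi; rewrite fsvalZ vi mulr0.
Qed.

Lemma fsdelta_in (k : I) : (fun i => (i == k)%:R : R) \in finitely_supported.
Proof. by apply: (@fsval_in _ [fset k]%fset) => i; rewrite inE => /negPf ->. Qed.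

Definition fsdelta k := FSFun1 (fsdelta_in k).

Lemma fssum_delta k : fssum (fsdelta k) = 1.
Proof.
rewrite (@fssumE _ [fset k]%fset) ?big_seq_fset1 /= ?eqxx// => i.
by rewrite inE => /negPf ik; rewrite /= ik.
Qed.

Lemma l1norm_delta k : l1norm (fsdelta k) = 1.
Proof.
rewrite (@l1normE _ [fset k]%fset) ?big_seq_fset1 /= ?eqxx ?normr1// => i.
by rewrite inE => /negPf ik; rewrite /= ik.
Qed.

End FinitelySupported.

(** * From an invariant mean to almost invariant vectors *)

Section Reiter.
Context (R : realType) (H : groupType).
Implicit Types (t h g : H) (psi : fsfun1 R H).

Section Displacement.
Variable T : seq H.

Lemma displacement_in psi : (fun i : H * H =>
    if i.1 \in T then psi (i.1^-1 * i.2)%g - psi i.2 else 0 : R)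
  \in @finitely_supported R (H * H)%type.
Proof.
pose s1 := [seq (t, (t * h)%g) | t <- T, h <- fsupp psi].
pose s2 := [seq (t, h) | t <- T, h <- fsupp psi].
apply: (@fsval_in _ _ _ [fset i in s1 ++ s2]%fset) => -[t h] /=.
rewrite !inE negb_or => /andP[h1 h2].
case: ifP => // tT; rewrite !notin_fsupp ?subr0//.
  by apply: contra h2 => hp; apply/allpairsP; exists (t, h).
apply: contra h1 => hp; apply/allpairsP; exists (t, (t^-1 * h)%g); split=> //=.
by rewrite mulgA mulgV mul1g.
Qed.

(** The family of the [t psi - psi], [t] in [T], as one vector of [l^1(H * H)], so that a single
    functional sees all [t] at once. *)
Definition displacement psi := FSFun1 (displacement_in psi).

Lemma displacementE psi t h : displacement psi (t, h) =
  if t \in T then psi (t^-1 * h)%g - psi h else 0.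
Proof. by []. Qed.

Lemma displacementD psi psi' :
  displacement (psi + psi') = displacement psi + displacement psi'.
Proof.
apply/val_inj/funext => -[t h].
rewrite -[RHS]/(displacement psi (t, h) + displacement psi' (t, h)).
rewrite -[LHS]/(displacement (psi + psi') (t, h)) !displacementE.
by case: ifP => _; rewrite ?addr0// !fsvalD opprD addrACA.
Qed.

Lemma displacementZ c psi : displacement (c *: psi) = c *: displacement psi.
Proof.
apply/val_inj/funext => -[t h].
rewrite -[RHS]/(c * displacement psi (t, h)).
rewrite -[LHS]/(displacement (c *: psi) (t, h)) !displacementE.
by case: ifP => _; rewrite ?mulr0// !fsvalZ mulrBr.
Qed.

Lemma l1norm_displacement psi t (s : seq H) : t \in T -> uniq s ->
  \sum_(h <- s) `|psi (t^-1 * h)%g - psi h| <= l1norm (displacement psi).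
Proof.
move=> tT us; have us' : uniq [seq (t, h) | h <- s].
  by rewrite map_inj_uniq// => h g [].
apply: le_trans (l1norm_ge_sum (displacement psi) us').
by rewrite big_map /= tT.
Qed.

Lemma displacement_delta h : uniq T -> displacement (fsdelta R h) =
  \sum_(t <- T) (fsdelta R (t, (t * h)%g) - fsdelta R (t, h)).
Proof.
move=> uT; apply/val_inj/funext => -[t g].
rewrite -[LHS]/(displacement (fsdelta R h) (t, g)) displacementE.
have sumE (s : seq H) (F : H -> fsfun1 R (H * H)%type) i :
    (\sum_(t <- s) F t) i = \sum_(t <- s) F t i.
  by elim/big_rec2: _ => [//|r x y _ <-].
rewrite -[RHS]/((\sum_(t <- T) (fsdelta R (t, (t * h)%g) - fsdelta R (t, h))) (t, g)) sumE.
have E r : (fsdelta R (r, (r * h)%g) - fsdelta R (r, h)) (t, g) =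
    if t == r then (t^-1 * g == h)%g%:R - (g == h)%:R else 0 :> R.
  rewrite -[LHS]/(((t, g) == (r, (r * h)%g))%:R - ((t, g) == (r, h))%:R).
  rewrite !xpair_eqE; have [->|_] /= := eqVneq t r; last by rewrite subrr.
  by congr ((nat_of_bool _)%:R - _); apply/eqP/eqP => [->|<-]; rewrite mulgA ?mulVg ?mulgV mul1g.
under eq_bigr do rewrite E.
have [tT|tT] := boolP (t \in T).
  by rewrite (bigD1_seq t)//= eqxx big1 ?addr0// => r; rewrite eq_sym => /negPf ->.
rewrite big_seq big1// => r rT; case: eqP => // tr.
by rewrite tr rT in tT.
Qed.

End Displacement.
(** Write [D] for the displacement. If no [psi] exists, then [|D psi| >= eps * fssum psi] for
    [psi >= 0], so that [q], the infimum of [|v + D psi| - eps * fssum psi], is finite. A linear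
    [f <= q] is bounded by the [l^1] norm and has [f (D delta_h) >= eps], as [psi = delta_h] shows.
    The bounded functions [F t h = f (delta_(t,h))] then satisfy [sum_t (F t (t h) - F t h) >= eps]
    for all [h], while the mean of the left side is 0. *)
Lemma reiter (T : seq H) (eps : R) : amenable_group R H -> 0 < eps ->
  exists psi : fsfun1 R H, [/\ forall h, 0 <= psi h, fssum psi = 1
    & forall t (s : seq H), t \in T -> uniq s ->
      \sum_(h <- s) `|psi (t^-1 * h)%g - psi h| <= eps].
Proof.
move=> [m [mD m_ge0 m1 minv]] eps0; apply: contrapT => noPsi.
pose T' := undup T; have uT : uniq T' by exact: undup_uniq.
pose nonneg psi := forall h, 0 <= psi h.
(* A violation, divided by [fssum psi], would be one of the [psi] excluded by [noPsi]. *)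
have big psi : nonneg psi -> eps * fssum psi <= l1norm (displacement T' psi).
  move=> psi0; have s0 : 0 <= fssum psi.
    by rewrite (fssumE (@notin_fsupp _ _ psi)) sumr_ge0.
  move: s0; rewrite le_eqVlt => /predU1P[<-|s0]; first by rewrite mulr0 l1norm_ge0.
  rewrite leNgt; apply/negP => lt; apply: noPsi.
  exists ((fssum psi)^-1 *: psi); split=> [h||t s tT us].
  - by rewrite fsvalZ mulr_ge0// invr_ge0 ltW.
  - by rewrite fssumZ mulVf// gt_eqF.
  have tT' : t \in T' by rewrite mem_undup.
  apply: (le_trans (l1norm_displacement _ tT' us)).
  rewrite displacementZ l1normZ ger0_norm ?invr_ge0 ?(ltW s0)//.
  by rewrite mulrC ler_pdivrMr// ltW.
pose V := fsfun1 R (H * H)%type.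
pose E (v : V) := [set l1norm (v + displacement T' psi) - eps * fssum psi | psi in nonneg].
have lbE v : lbound (E v) (- l1norm v).
  move=> _ [psi psi0 <-].
  have := l1normD (v + displacement T' psi) ((-1) *: v).
  rewrite l1normZ normrN1 mul1r scaleN1r (addrC v) addrK addrC.
  have := big _ psi0; lra.
have nonneg0 : nonneg 0 by [].
have D0 : displacement T' 0 = 0.
  by rewrite -(scale0r (0 : fsfun1 R H)) displacementZ scale0r.
have s0 : fssum (0 : fsfun1 R H) = 0 by rewrite -(scale0r 0) fssumZ mul0r.
have iE v : has_inf (E v).
  split; last by exists (- l1norm v); exact: lbE.
  by exists (l1norm (v + displacement T' 0) - eps * fssum (0 : fsfun1 R H)); exists 0.
pose q v := inf (E v).
have qE v psi : nonneg psi -> q v <= l1norm (v + displacement T' psi) - eps * fssum psi.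
  by move=> psi0; apply: ge_inf; [exact: (iE v).2|exists psi].
have qN v : q v <= l1norm v.
  by rewrite (le_trans (qE v 0 nonneg0))// D0 s0 mulr0 subr0 addr0.
have sq : sublinear q.
  split=> [v w|c v].
    apply/ler_addgt0Pr => d d0; have d2 : 0 < d / 2 by rewrite divr_gt0.
    have [_ [psi psi0 <-] vd] := inf_adherent d2 (iE v).
    have [_ [psi' psi'0 <-] wd] := inf_adherent d2 (iE w).
    have psiD : nonneg (psi + psi') by move=> h; rewrite fsvalD addr_ge0.
    apply: (le_trans (qE _ _ psiD)); rewrite displacementD addrACA fssumD mulrDr.
    by have := l1normD (v + displacement T' psi) (w + displacement T' psi'); lra.
  rewrite le_eqVlt => /predU1P[<-|c0].
    by rewrite scale0r mul0r (le_trans (qN 0))// l1norm0.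
  rewrite mulrC -ler_pdivrMr//; apply: lb_le_inf; first exact: (iE v).1.
  move=> _ [psi psi0 <-]; rewrite ler_pdivrMr//.
  have cpsi : nonneg (c *: psi) by move=> h; rewrite fsvalZ mulr_ge0// ltW.
  apply: (le_trans (qE _ _ cpsi)).
  rewrite displacementZ -scalerDr l1normZ fssumZ gtr0_norm//.
  by rewrite mulrBl mulrC lerD2l lerN2 mulrCA mulrC.
have [f fL fq] := hahn_banach_sublinear sq.
have f0 : f 0 = 0 by have := fL (-1) 0 0; rewrite scaler0 addr0 mulN1r addNr.
have fD v w : f (v + w) = f v + f w by have := fL 1 v w; rewrite scale1r mul1r.
have fZ c v : f (c *: v) = c * f v by have := fL c v 0; rewrite !addr0 f0 addr0.
have fN v : f (- v) = - f v by rewrite -scaleN1r fZ mulN1r.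
have f1 v : `|f v| <= l1norm v.
  rewrite ler_norml (le_trans (fq v) (qN v)) andbT lerNl -fN.
  by rewrite (le_trans (fq _))// (le_trans (qN _))// -scaleN1r l1normZ normrN1 mul1r.
pose F t h := f (fsdelta R (t, h)).
have F1 t h : `|F t h| <= 1 by rewrite (le_trans (f1 _))// l1norm_delta.
have Fe h : eps <= \sum_(t <- T') (F t (t * h)%g - F t h).
  have -> : \sum_(t <- T') (F t (t * h)%g - F t h) = f (displacement T' (fsdelta R h)).
    rewrite displacement_delta// [RHS](big_morph f fD f0).
    by apply: eq_bigr => t _; rewrite fD fN.
  rewrite -[leRHS]opprK -fN lerNr (le_trans (fq _))//.
  have d0 : nonneg (fsdelta R h) by move=> g; exact: ler0n.
  by rewrite (le_trans (qE _ _ d0))// addNr l1norm0 fssum_delta mulr1 sub0r.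
pose bdd (g : H -> R) := exists M, forall h, `|g h| <= M.
have bF t : bdd (F t) by exists 1.
have bFt t : bdd (fun h => F t (t * h)%g) by exists 1.
have b1 : bdd (fun=> 1) by exists 1 => h; rewrite normr1.
have b0 : bdd (fun=> 0) by exists 0 => h; rewrite normr0.
have m0 : m (fun=> 0) = 0.
  have := mD (-1) _ _ b1 b1; rewrite m1 (_ : (fun=> _) = fun=> 0).
    by move=> ->; rewrite mulr1 addNr.
  by apply/funext => h; rewrite mulr1 addNr.
have bD (c : R) (g g' : H -> R) : bdd g -> bdd g' -> bdd (fun h => c * g h + g' h).
  move=> [M gM] [M' gM']; exists (`|c| * M + M') => h.
  by rewrite (le_trans (ler_normD _ _))// lerD// normrM ler_wpM2l.
have mdiff t : m (fun h => F t (t * h)%g - F t h) = 0.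
  have := mD (-1) _ _ (bF t) (bFt t).
  rewrite (_ : (fun=> _) = fun h => F t (t * h)%g - F t h); last first.
    by apply/funext => h; rewrite mulN1r addrC.
  move=> ->; have := minv _ t^-1%g (bF t); rewrite invgK => ->.
  by rewrite mulN1r addNr.
have bdiff t : bdd (fun h => F t (t * h)%g - F t h).
  exists 2 => h; rewrite (le_trans (ler_normB _ _))// (_ : 2 = 1 + 1)//.
  by rewrite lerD.
have bmS (s : seq H) : bdd (fun h => \sum_(t <- s) (F t (t * h)%g - F t h)) /\
    m (fun h => \sum_(t <- s) (F t (t * h)%g - F t h)) = 0.
  elim: s => [|t s [bs ms]].
    by rewrite (_ : (fun=> _) = fun=> 0)//; apply/funext => h; rewrite big_nil.
  rewrite (_ : (fun=> _) = fun h => 1 * (F t (t * h)%g - F t h) +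
    \sum_(t <- s) (F t (t * h)%g - F t h)); last first.
    by apply/funext => h; rewrite big_cons mul1r.
  split; first exact: bD.
  by rewrite (mD 1 _ _ (bdiff t) bs) ms addr0 mul1r; exact: mdiff.
have [bS mS] := bmS T'.
have := mD (- eps) _ _ b1 bS; rewrite m1 mS => me.
have : 0 <= m (fun h => - eps * 1 + \sum_(t <- T') (F t (t * h)%g - F t h)).
  by apply: m_ge0; [exact: bD|move=> h; rewrite mulr1 addrC subr_ge0].
by rewrite me addr0 mulr1 oppr_ge0 leNgt eps0.
Qed.

Lemma sqr_sqrtB (a b : R) : 0 <= a -> 0 <= b ->
  (Num.sqrt a - Num.sqrt b) ^+ 2 <= `|b - a|.
Proof.
wlog ab : a b / a <= b => [wl a0 b0|a0 b0].
  have [ab|/ltW ba] := leP a b; first exact: wl.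
  by rewrite -sqrrN opprB distrC wl.
rewrite ger0_norm ?subr_ge0// -{2}(sqr_sqrtr a0) -{2}(sqr_sqrtr b0).
have : Num.sqrt a <= Num.sqrt b by rewrite ler_wsqrtr.
have := sqrtr_ge0 a; move: (Num.sqrt a) (Num.sqrt b) => u v u0 uv.
by rewrite -subr_ge0 (_ : _ - _ = 2 * u * (v - u)); [rewrite !mulr_ge0 ?subr_ge0|ring].
Qed.

(** Square roots turn the [l^1] estimate into an [l^2] one: for unit vectors [1 - <xi, t xi>] is
    half of [|xi - t xi|^2], which [sqr_sqrtB] bounds by the [l^1] displacement of [psi = xi^2]. *)
Lemma reiter_sqrt (T : seq H) (eps : R) : amenable_group R H -> 0 < eps ->
  exists (xi : H -> R) (S : {fset H}), [/\ forall h, 0 <= xi h,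
    forall h, h \notin S -> xi h = 0, \sum_(h <- S) xi h * xi h = 1
    & forall t, t \in T -> `|\sum_(h <- S) xi h * xi (t^-1 * h)%g - 1| <= eps].
Proof.
move=> amH eps0; have [psi [psi0 psi1 psiT]] := reiter T amH eps0.
exists (fun h => Num.sqrt (psi h)), (fsupp psi); split.
- by move=> h; exact: sqrtr_ge0.
- by move=> h /notin_fsupp ->; rewrite sqrtr0.
- rewrite -psi1 (fssumE (@notin_fsupp _ _ psi)).
  by apply: eq_bigr => h _; rewrite -expr2 sqr_sqrtr.
move=> t tT; pose S := (fsupp psi `|` [fset (t * h)%g | h in fsupp psi])%fset.
have S1 h : h \notin S -> psi h = 0 by rewrite inE negb_or => /andP[/notin_fsupp].
have S2 h : h \notin S -> psi (t^-1 * h)%g = 0.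
  rewrite inE negb_or => /andP[_ hS]; apply: notin_fsupp; apply: contra hS => hS.
  by apply/imfsetP; exists (t^-1 * h)%g; rewrite //= mulgA mulgV mul1g.
have E : \sum_(h <- fsupp psi) Num.sqrt (psi h) * Num.sqrt (psi (t^-1 * h)%g) =
    \sum_(h <- S) Num.sqrt (psi h) * Num.sqrt (psi (t^-1 * h)%g).
  pose f h := Num.sqrt (psi h) * Num.sqrt (psi (t^-1 * h)%g).
  rewrite -[LHS](@fsbigTE _ _ _ _ _ f) -?[RHS](@fsbigTE _ _ _ _ _ f)// => h.
    by move=> /S1 hS; rewrite /f hS sqrtr0 mul0r.
  by move=> /notin_fsupp hS; rewrite /f hS sqrtr0 mul0r.
have s1 : \sum_(h <- S) psi h = 1 by rewrite -psi1 (fssumE S1).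
have s2 : \sum_(h <- S) psi (t^-1 * h)%g = 1.
  rewrite -psi1 /fssum (@reindex_fsbigT _ _ _ _ _ (fun h => t^-1 * h)%g); last first.
    by exists (fun h => t * h)%g => h; rewrite mulgA ?mulVg ?mulgV mul1g.
  by rewrite (fsbigTE S).
have E2 : 1 - \sum_(h <- S) Num.sqrt (psi h) * Num.sqrt (psi (t^-1 * h)%g) =
    (\sum_(h <- S) (Num.sqrt (psi h) - Num.sqrt (psi (t^-1 * h)%g)) ^+ 2) / 2.
  rewrite [in RHS](eq_bigr (fun h => psi h + psi (t^-1 * h)%g -
      2 * (Num.sqrt (psi h) * Num.sqrt (psi (t^-1 * h)%g)))); last first.
    by move=> h _; rewrite sqrrB !sqr_sqrtr//; ring.
  by rewrite big_split big_split /= s1 s2 sumrN -mulr_sumr; field.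
rewrite distrC E E2 ger0_norm ?divr_ge0// ?sumr_ge0// => [|h _]; last exact: sqr_ge0.
have : \sum_(h <- S) (Num.sqrt (psi h) - Num.sqrt (psi (t^-1 * h)%g)) ^+ 2 <= eps.
  apply: le_trans (psiT t S tT (fset_uniq _)); apply: ler_sum => h _.
  exact: sqr_sqrtB.
by move=> h; rewrite ler_pdivrMr// (le_trans h)// ler_peMr ?(ltW eps0)// ler1n.
Qed.

End Reiter.

(** * Norms and multipliers on the crossed product *)

Section ComplexModulus.
Context (R : realType).
Implicit Types z w : R[i].

Definition cmod z : R := complex.Re `|z|.

Lemma cmodE z : `|z| = (cmod z)%:C. Proof. exact: normcRe. Qed.

Lemma cmod_ge0 z : 0 <= cmod z.
Proof. by rewrite -lecR -cmodE normr_ge0. Qed.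

Lemma cmodD z w : cmod (z + w) <= cmod z + cmod w.
Proof. by rewrite -lecR rmorphD /= -!cmodE ler_normD. Qed.

Lemma cmodM z w : cmod (z * w) = cmod z * cmod w.
Proof. by apply/complexI; rewrite rmorphM /= -!cmodE normrM. Qed.

Lemma cmod0 : cmod 0 = 0. Proof. by rewrite /cmod normr0. Qed.

Lemma cmodR (s : R) : cmod s%:C = `|s|.
Proof. by rewrite /cmod normc_def /= expr0n addr0 sqrtr_sqr. Qed.

Lemma cmod_conj z : cmod z^*%C = cmod z. Proof. by rewrite /cmod normcJ. Qed.

Lemma conj_mul_cmod z : z^*%C * z = (cmod z ^+ 2)%:C.
Proof. by rewrite mulrC -sqr_normc cmodE rmorphXn. Qed.

Lemma cmod_sum (I : Type) (s : seq I) (F : I -> R[i]) :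
  cmod (\sum_(k <- s) F k) <= \sum_(k <- s) cmod (F k).
Proof.
elim/big_rec2: _ => [|k x y _ xy]; first by rewrite cmod0.
by rewrite (le_trans (cmodD _ _))// lerD2l.
Qed.

Lemma cmod_dist z w : `|cmod z - cmod w| <= cmod (z - w).
Proof.
have H u v : cmod u - cmod v <= cmod (u - v).
  by rewrite lerBlDr -{1}(subrK v u) cmodD.
by rewrite ler_norml H andbT lerNl opprB [cmod (z - w)]/cmod distrC H.
Qed.

Lemma cmod_continuous (T : topologicalType) (f : T -> R[i]) :
  continuous f -> continuous (cmod \o f).
Proof.
move=> cf x; apply/cvgrPdist_lt => e e0.
have e0' : 0 < e%:C :> R[i] by rewrite ltcR.
have /cvgrPdist_lt/(_ _ e0') := cf x.
apply: filterS => y; rewrite cmodE ltcR; apply: le_lt_trans; exact: cmod_dist.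
Qed.

Lemma complex_of_real_continuous (T : topologicalType) (f : T -> R) :
  continuous f -> continuous (fun x => (f x)%:C : R[i]).
Proof.
move=> cf x; apply/cvgrPdist_lt => e e0.
have /andP[/eqP ie re] : (complex.Im e == 0) && (0 < complex.Re e).
  by move: e0; rewrite ltcE.
have eE : e = (complex.Re e)%:C by case: (e) ie => ? ? /= ->.
have /cvgrPdist_lt/(_ _ re) := cf x.
by apply: filterS => y; rewrite -rmorphB cmodE cmodR eE ltcR.
Qed.

End ComplexModulus.

(** * The unit and the sizes of the coefficients *)

Section CrossedProductAlgebra.
Context (R : realType) (G : groupType) (P : set G) (X : invariant_space P).
Implicit Types (x y : X) (s t : G) (a b : cp_alg R X) (f : X -> R[i]) (c : R).

Lemma cp_coef_sum (I : Type) (r : seq I) (F : I -> cp_alg R X) t x :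
  (\sum_(k <- r) F k) t x = \sum_(k <- r) F k t x.
Proof. by elim/big_rec2: _ => [//|k u v _ <-]. Qed.

Lemma cp_coefN a t x : (- a) t x = - a t x. Proof. by []. Qed.

Lemma mono_in t f : C0U t f ->
  (fun s => if s == t then f else 0) \in finite_sums (R:=R) (X:=X).
Proof.
move=> tf; apply/mem_set; split=> [s|].
  by case: eqP => [->//|_]; exact: C0U0.
apply: (@sub_finite_set _ _ [set t]); last exact: finite_set1.
by move=> s /=; case: eqP.
Qed.

(** The monomial [f delta_t]. *)
Definition mono t f (tf : C0U t f) : cp_alg R X := CPAlg (mono_in tf).

Lemma monoE t f (tf : C0U t f) s x : mono tf s x = if s == t then f x else 0.
Proof. by rewrite /=; case: ifP. Qed.

Lemma C0U1 f : continuous f -> C0U 1%g f.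
Proof. by move=> cf; split=> // x; rewrite val_id. Qed.

Lemma mono_mulE t f (tf : C0U t f) b s x :
  (mono tf ** b) s x = f x * b (t^-1 * s)%g (theta t^-1%g x).
Proof.
rewrite -[LHS]/(cp_mul _ _ _ _) (@cp_mulE _ _ _ _ _ _ _ _ [fset t]%fset).
  by rewrite big_seq_fset1 monoE eqxx.
by move=> r; rewrite inE => /negPf rt; apply/funext => z; rewrite monoE rt.
Qed.

Lemma star_mono_notin t f (tf : C0U t f) s : s != t^-1%g -> star (mono tf) s = 0.
Proof.
move=> st; apply/funext => x; have [xs|xs] := boolP (val x s); last by rewrite coef_out.
rewrite -[LHS]/(cp_star _ _ _) cp_starE// monoE ifF ?conjc0//.
by apply/negP => /eqP E; move: st; rewrite -E invgK eqxx.
Qed.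

Definition cp_one : cp_alg R X := mono (C0U1 (@cst_continuous X R[i] 1)).

Lemma cp_one_l a : cp_one ** a = a.
Proof. by apply: coef_inj => t x; rewrite mono_mulE mul1r invg1 mul1g theta1. Qed.

Lemma cp_one_r a : a ** cp_one = a.
Proof.
have star_one : star cp_one = cp_one.
  apply: coef_inj => t x; have [xt|xt] := boolP (val x t); last by rewrite !coef_out.
  rewrite -[LHS]/(cp_star _ _ _) cp_starE// !monoE eq_sym -(inj_eq (@invg_inj G)).
  by rewrite invgK invg1 eq_sym; case: ifP; rewrite ?conjc0 ?rmorph1.
by rewrite -[LHS]starK starM star_one cp_one_l starK.
Qed.

Lemma star_mul_at1 a x (S : {fset G}) : (forall s, s \notin S -> star a s = 0) ->
  (star a ** a) 1%g x = (\sum_(s <- S) cmod (star a s x) ^+ 2)%:C.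
Proof.
move=> aS; rewrite -[LHS]/(cp_mul _ _ _ _) (cp_mulE _ _ _ aS) [RHS]rmorph_sum.
apply: eq_bigr => s _; rewrite mulg1 -[RHS]conj_mul_cmod.
have [xs|xs] := boolP (val x s); last by rewrite coef_out// conjc0 !mul0r.
by rewrite -[star a s x]/(cp_star a s x) cp_starE// conjcK mulrC.
Qed.

Lemma star_mul_at1_sum a x :
  (star a ** a) 1%g x = (\sum_(s \in [set: G]) cmod (star a s x) ^+ 2)%:C.
Proof.
rewrite (star_mul_at1 x (@notin_supp _ _ _ _ (star a))) (fsbigTE (supp (star a)))//.
by move=> s /notin_supp ->; rewrite cmod0 expr0n.
Qed.

Lemma cmod_star_coef_le a c s x : (forall y, cmod ((star a ** a) 1%g y) <= c) ->
  cmod (star a s x) ^+ 2 <= c.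
Proof.
move=> ac; apply: le_trans (ac x).
rewrite (star_mul_at1 x (@notin_supp _ _ _ _ (star a))) cmodR ger0_norm; last first.
  by rewrite sumr_ge0// => r _; exact: sqr_ge0.
have [sS|/notin_supp ->] := boolP (s \in supp (star a)); last first.
  by rewrite cmod0 expr0n sumr_ge0// => r _; exact: sqr_ge0.
rewrite (big_fsetD1 s)//= lerDl sumr_ge0// => r _; exact: sqr_ge0.
Qed.

Lemma cmod_coef_le a c t x : (forall y, cmod ((star a ** a) 1%g y) <= c) ->
  cmod (a t x) ^+ 2 <= c.
Proof.
move=> ac; have [xt|xt] := boolP (val x t); last first.
  rewrite coef_out// cmod0 expr0n; apply: le_trans (ac x); exact: cmod_ge0.
have := cmod_star_coef_le t^-1%g (theta t^-1%g x) ac.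
have xt' : val x (t^-1)^-1%g by rewrite invgK.
rewrite -[star a _ _]/(cp_star a _ _) cp_starE; last first.
  by rewrite val_theta// /translate invgK mulgV val_id.
by rewrite cmod_conj thetaK// invgK.
Qed.

(** As for a positive matrix, an off-diagonal entry is bounded by diagonal ones:
    [2 |u v| <= |u|^2 + |v|^2], term by term, bounds the coefficient at [t] in [x] by the mean of
    the coefficients at 1 in [x] and in [y = t^-1 x]. *)
Lemma cmod_star_mul_le a c t x : (forall y, cmod ((star a ** a) 1%g y) <= c) ->
  cmod ((star a ** a) t x) <= c.
Proof.
move=> ac; have [xt|xt] := boolP (val x t); last first.
  rewrite coef_out// cmod0; apply: le_trans (ac x); exact: cmod_ge0.
have xt' : val x (t^-1)^-1%g by rewrite invgK.
set y := theta t^-1%g x.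
pose S := (supp (star a) `|` [fset (t * s)%g | s in supp (star a)])%fset.
have S1 s : s \notin S -> star a s = 0.
  by rewrite inE negb_or => /andP[/notin_supp].
have S2 s : s \notin S -> star a (t^-1 * s)%g = 0.
  rewrite inE negb_or => /andP[_ hS]; apply: notin_supp; apply: contra hS => hS.
  by apply/imfsetP; exists (t^-1 * s)%g; rewrite //= mulgA mulgV mul1g.
pose F s := cmod (star a s x) ^+ 2; pose F' s := cmod (star a (t^-1 * s)%g y) ^+ 2.
pose F2 s := cmod (star a s x * a (s^-1 * t)%g (theta s^-1%g x)).
have Ex : cmod ((star a ** a) 1%g x) = \sum_(s <- S) F s.
  by rewrite (star_mul_at1 x S1) cmodR ger0_norm// sumr_ge0// => s _; exact: sqr_ge0.
have Ey : cmod ((star a ** a) 1%g y) = \sum_(s <- S) F' s.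
  rewrite star_mul_at1_sum (@reindex_fsbigT _ _ _ _ _ (fun s => t^-1 * s)%g); last first.
    by exists (fun s => t * s)%g => s; rewrite mulgA ?mulVg ?mulgV mul1g.
  rewrite (fsbigTE S) => [|s /S2 ->]; last by rewrite cmod0 expr0n.
  by rewrite cmodR ger0_norm// sumr_ge0// => s _; exact: sqr_ge0.
rewrite -[(star a ** a) t x]/(cp_mul (star a) a t x) (cp_mulE _ _ _ S1).
apply: (le_trans (cmod_sum _ _)); rewrite -[leLHS]/(\sum_(s <- S) F2 s).
apply: (@le_trans _ _ ((cmod ((star a ** a) 1%g x) + cmod ((star a ** a) 1%g y)) / 2)).
  rewrite Ex Ey -big_split /= mulr_suml; apply: ler_sum => s _.
  rewrite /F2 /F /F'.
  have [xs|xs] := boolP (val x s); last first.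
    by rewrite (coef_out (star a))// mul0r cmod0 divr_ge0// addr_ge0// sqr_ge0.
  have ys : val y (t^-1 * s)%g by rewrite val_theta// /translate invgK mulgA mulgV mul1g.
  rewrite -[star a (t^-1 * s)%g y]/(cp_star a _ _) cp_starE// cmod_conj.
  have -> : theta (t^-1 * s)^-1%g y = theta s^-1%g x.
    have e : ((t^-1 * s)^-1 * t^-1 = s^-1)%g by rewrite invgM invgK -mulgA mulgV mulg1.
    by rewrite /y thetaM ?e ?invgK.
  rewrite invgM invgK cmodM ler_pdivlMr//.
  have := sqr_ge0 (cmod (star a s x) - cmod (a (s^-1 * t)%g (theta s^-1%g x))).
  by rewrite !expr2; lra.
by have := ac x; have := ac y; lra.
Qed.

End CrossedProductAlgebra.

(** * Norm bounds valid in every C*-completion of the finite sums *)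

Section CrossedProductNorm.
Context (R : realType) (G : groupType) (P : set G) (X : invariant_space P).
Context (B : cstarAlgType R) (iota : cp_alg R X -> B).
Hypotheses (ih : star_hom iota) (di : dense (range iota)).
Implicit Types (x y : X) (s t : G) (a b : cp_alg R X) (f : X -> R[i]) (c : R).

Lemma star_mono1E f (cf : continuous f) t x :
  star (mono (C0U1 cf)) t x = if t == 1%g then (f x)^*%C else 0.
Proof.
have [->|t1] := eqVneq t 1%g; last by rewrite star_mono_notin// invg1.
rewrite -[LHS]/(cp_star _ _ _) cp_starE ?val_id// monoE invg1 eqxx.
by rewrite theta1.
Qed.

(** The function [g], the root of [c^2 - |f|^2], is continuous and real, so [c^2 - star f ** f] is
    the square of a self-adjoint element already among the finite sums. *)
Lemma cnorm_mono1_le f (cf : continuous f) c : 0 <= c ->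
  (forall x, cmod (f x) <= c) -> cnorm (iota (mono (C0U1 cf))) <= c.
Proof.
move=> c0 fc.
have B1l := completion_one_l (@cp_one_l R G P X) ih di.
have B1r := completion_one_r (@cp_one_l R G P X) (@cp_one_r R G P X) ih di.
pose g x : R[i] := (Num.sqrt (c ^+ 2 - cmod (f x) * cmod (f x)))%:C.
have cg : continuous g.
  apply: complex_of_real_continuous => x.
  apply: (@continuous_comp _ _ _ (fun x => c ^+ 2 - cmod (f x) * cmod (f x)) Num.sqrt).
    apply: (@continuousB _ _ _ (fun=> c ^+ 2) (fun x => cmod (f x) * cmod (f x))).
      exact: cst_continuous.
    have cm := cmod_continuous cf.
    exact: (@continuousM _ _ (fun y => cmod (f y)) (fun y => cmod (f y)) x (cm x) (cm x)).
  exact: sqrt_continuous.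
have sg : star (mono (C0U1 cg)) = mono (C0U1 cg).
  by apply: coef_inj => t x; rewrite star_mono1E monoE /g /= oppr0.
have E : star (mono (C0U1 cf)) ** mono (C0U1 cf) =
    (c ^+ 2)%:C *: cp_one R X - mono (C0U1 cg) ** mono (C0U1 cg).
  apply: coef_inj => t x; rewrite Defs.coefD cp_coefN Defs.coefZ mono_mulE !monoE invg1 mul1g theta1.
  rewrite -[LHS]/(cp_mul (star (mono (C0U1 cf))) _ _ _).
  rewrite (@cp_mulE _ _ _ _ _ _ _ _ [fset 1%g]%fset); last first.
    by move=> s; rewrite inE => s1; rewrite star_mono_notin// invg1.
  rewrite big_seq_fset1 star_mono1E eqxx monoE invg1 mul1g theta1.
  case: eqP => _; last by rewrite !mulr0 subrr.
  rewrite conj_mul_cmod /g mulr1 -rmorphM -rmorphB; congr (_%:C).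
  have h : 0 <= c ^+ 2 - cmod (f x) ^+ 2 by rewrite subr_ge0 ler_sqr ?nnegrE ?cmod_ge0.
  by rewrite -!expr2 sqr_sqrtr// opprB addrC subrK.
rewrite -ler_sqr ?nnegrE ?cnorm_ge0// -cnorm_star_mul.
apply: (cpos_le_norm B1l B1r); first exact: exprn_ge0.
  exact: cpos_star_mul.
rewrite -(star_homS ih) -(star_homM ih) E (star_homB ih) (star_homZ ih) /scal.
rewrite opprB addrC subrK (star_homM ih).
by apply: (cpos_sqr B1l B1r); rewrite -(star_homS ih) sg.
Qed.

(** In the order [b ** star b] the product is [|f|^2 delta_e], with no translate of [f], so the case
    [t = e] applies. *)
Lemma cnorm_mono_le t f (tf : C0U t f) c : 0 <= c ->
  (forall x, cmod (f x) <= c) -> cnorm (iota (mono tf)) <= c.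
Proof.
move=> c0 fc; rewrite -ler_sqr ?nnegrE ?cnorm_ge0// -cnorm_mul_star.
have cff : continuous (fun x => f x * (f x)^*%C).
  move=> x; apply: (@continuousM _ _ f (fun x => (f x)^*%C) x (tf.1 x)).
  exact: (cvg_comp _ _ (tf.1 x) (@conjc_continuous R _)).
rewrite -(star_homS ih) -(star_homM ih).
have -> : mono tf ** star (mono tf) = mono (C0U1 cff).
  apply: coef_inj => s x; rewrite mono_mulE monoE.
  have [->|s1] := eqVneq s 1%g; last first.
    rewrite (star_mono_notin tf) ?mulr0//.
    by rewrite -[X in _ != X]mulg1 (inj_eq (mulgI _)).
  rewrite mulg1; have [xt|xt] := boolP (val x t); last by rewrite tf.2// !mul0r.
  have xt' : val x (t^-1)^-1%g by rewrite invgK.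
  rewrite -[star (mono tf) _ _]/(cp_star (mono tf) _ _) cp_starE; last first.
    by rewrite val_theta// /translate invgK mulgV val_id.
  by rewrite thetaK// invgK monoE eqxx.
apply: cnorm_mono1_le => [|x]; first exact: exprn_ge0.
by rewrite cmodM cmod_conj -expr2 ler_sqr ?nnegrE ?cmod_ge0.
Qed.

Lemma cnorm_iota_le a (S : {fset G}) c : (forall t, t \notin S -> a t = 0) -> 0 <= c ->
  (forall t x, cmod (a t x) <= c) -> cnorm (iota a) <= c *+ #|` S|.
Proof.
move=> aS c0 ac; have -> : a = \sum_(t <- S) mono (coef_C0U a t).
  apply: coef_inj => t x; rewrite cp_coef_sum; have [tS|tS] := boolP (t \in S).
    rewrite (big_fsetD1 t)//= eqxx big_seq big1 ?addr0// => s.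
    by rewrite !inE eq_sym => /andP[/negPf ->].
  rewrite aS// big_seq big1// => s sS; rewrite monoE.
  by case: eqP => // ts; rewrite ts sS in tS.
rewrite (star_hom_sum ih) -sum1_size -[leRHS]mulr_natr natr_sum mulr_sumr mulr1.
elim/big_ind2 : _ => [|x1 x2 y1 y2 h1 h2|t _].
- by rewrite cnorm0.
- by rewrite (le_trans (cnormD _ _))// lerD.
- exact: cnorm_mono_le.
Qed.

End CrossedProductNorm.

(** * Multipliers of positive type *)

Section Multiplier.
Context (R : realType) (G : groupType) (P : set G) (X : invariant_space P).
Implicit Types (x y : X) (s t r : G) (a b : cp_alg R X).
Context (I : choiceType) (act : G -> I -> I).
Hypotheses (act1 : forall i, act 1%g i = i)
  (actM : forall s t i, act (s * t)%g i = act s (act t i)).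
Context (eta : I -> X -> R[i]) (S : {fset I}).
Hypotheses (eta_cont : forall i, continuous (eta i))
  (eta_real : forall i x, (eta i x)^*%C = eta i x)
  (eta_out : forall i, i \notin S -> eta i = 0).

Definition mult_coef t x : R[i] :=
  \sum_(i <- S) eta i x * eta (act t^-1%g i) (theta t^-1%g x).

Lemma C0UM t (f g : X -> R[i]) : continuous f -> C0U t g -> C0U t (f \* g).
Proof.
move=> cf [cg g0]; split=> [x|x xt]; last by rewrite /= g0// mulr0.
exact: (@continuousM _ _ f g x (cf x) (cg x)).
Qed.

Lemma multiplier_in a :
  (fun t x => mult_coef t x * a t x) \in finite_sums (R:=R) (X:=X).
Proof.
apply/mem_set; split=> [t|]; last first.
  apply: sub_finite_set (coefP a).2 => t /= mt at0; apply: mt.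
  by apply/funext => x; rewrite at0 mulr0.
pose F := \sum_(i <- S) (eta i \* alpha t (eta (act t^-1%g i))).
have cF : continuous F.
  apply: (@C0U_sum R G P X 1%g _ _ _ _).1 => i; apply: C0UM => //.
  apply: C0U1; exact: alpha_continuous.
have := C0UM cF (coef_C0U a t); congr (C0U _ _); apply/funext => x /=.
have [xt|xt] := boolP (val x t); last by rewrite coef_out// !mulr0.
congr (_ * _); rewrite /F fct_sumE; apply: eq_bigr => i _.
by rewrite /= alpha_in.
Qed.

Definition multiplier a : cp_alg R X := CPAlg (multiplier_in a).

Lemma multiplierE a t x : multiplier a t x = mult_coef t x * a t x.
Proof. by []. Qed.

Lemma multiplier_linear : linear multiplier.
Proof.
move=> k a b; apply: coef_inj => t x.
rewrite multiplierE !Defs.coefD !Defs.coefZ !multiplierE mulrDr.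
by rewrite mulrCA.
Qed.

Lemma multiplier_one : (forall x, mult_coef 1%g x = 1) ->
  multiplier (cp_one R X) = cp_one R X.
Proof.
move=> m1; apply: coef_inj => t x; rewrite multiplierE monoE.
by case: eqP => [->|_]; rewrite ?m1 ?mulr1 ?mulr0.
Qed.

Lemma translated_in a (j : I) :
  (fun r x => a r x * eta (act r^-1%g j) (theta r^-1%g x)) \in finite_sums (R:=R) (X:=X).
Proof.
apply/mem_set; split=> [t|]; last first.
  apply: sub_finite_set (coefP a).2 => t /= mt at0; apply: mt.
  by apply/funext => x; rewrite at0 mul0r.
have := C0UM (@alpha_continuous _ _ _ _ t _ (@eta_cont (act t^-1%g j))) (coef_C0U a t).
congr (C0U _ _); apply/funext => x /=; rewrite mulrC.
have [xt|xt] := boolP (val x t); last by rewrite coef_out// !mul0r.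
by rewrite /= alpha_in.
Qed.

Definition translated a j : cp_alg R X := CPAlg (translated_in a j).

Lemma translatedE a j r x :
  translated a j r x = a r x * eta (act r^-1%g j) (theta r^-1%g x).
Proof. by []. Qed.

Lemma star_translatedE a j s x : star (translated a j) s x = star a s x * eta (act s j) x.
Proof.
have [xs|xs] := boolP (val x s); last by rewrite !coef_out// mul0r.
rewrite -[LHS]/(cp_star (translated a j) s x) -[star a s x]/(cp_star a s x) !cp_starE//.
have xs' : val x (s^-1)^-1%g by rewrite invgK.
have ts : theta s (theta s^-1%g x) = x by have := thetaK xs'; rewrite invgK.
by rewrite translatedE rmorphM /= invgK ts eta_real.
Qed.

Lemma bij_act s : bijective (act s).
Proof. by exists (act s^-1%g) => i; rewrite -actM ?mulVg ?mulgV act1. Qed.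

(* [mult_coef] is a coefficient of the G-set [I], hence of positive type: the
   [z] are the functions [r -> a_r eta_{r^-1 j}(r^-1 x)], for [j] in [I]. *)
Lemma multiplier_star_mul a :
  exists s : seq (cp_alg R X), multiplier (star a ** a) = \sum_(z <- s) star z ** z.
Proof.
(* [J] contains every [j] with [s j] in [S] for some [s] in the support of [star a], so for each
   such [s] the substitution [i = s j] turns the sum over [J] into the one that defines
   [mult_coef]. *)
pose J := [fset act s^-1%g i | s in supp (star a), i in S]%fset.
exists [seq translated a j | j <- J]; rewrite big_map.
apply: coef_inj => t x; rewrite cp_coef_sum multiplierE.
have [xt|xt] := boolP (val x t); last first.
  by rewrite coef_out// mulr0 big1// => j _; rewrite coef_out.
have xt' : val x (t^-1)^-1%g by rewrite invgK.
rewrite -[(star a ** a) t x]/(cp_mul (star a) a t x).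
rewrite (cp_mulE _ _ _ (@notin_supp _ _ _ _ (star a))) mulr_sumr.
pose F s j := star a s x * a (s^-1 * t)%g (theta s^-1%g x) *
  (eta (act s j) x * eta (act (t^-1 * s)%g j) (theta t^-1%g x)).
have E j : (star (translated a j) ** translated a j) t x = \sum_(s <- supp (star a)) F s j.
  rewrite -[LHS]/(cp_mul (star (translated a j)) (translated a j) t x).
  rewrite (@cp_mulE _ _ _ _ _ _ _ _ (supp (star a))); last first.
    move=> s /notin_supp as0; apply/funext => y.
    by rewrite star_translatedE as0 mul0r.
  apply: eq_bigr => s _; rewrite star_translatedE translatedE /F.
  have [xs|xs] := boolP (val x s); last by rewrite coef_out// !mul0r.
  have xs' : val x (s^-1)^-1%g by rewrite invgK.
  have e : ((s^-1 * t)^-1 * s^-1 = t^-1)%g by rewrite invgM invgK -mulgA mulgV mulg1.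
  rewrite thetaM ?e// invgM invgK.
  by ring.
rewrite [RHS](eq_bigr _ (fun j _ => E j)).
rewrite exchange_big /= big_seq [RHS]big_seq; apply: eq_bigr => s sS.
rewrite -mulr_sumr mulrC; congr (_ * _).
pose g i := eta i x * eta (act t^-1%g i) (theta t^-1%g x).
rewrite /mult_coef -[LHS](@fsbigTE _ _ _ _ S g); last first.
  by move=> i iS; rewrite /g eta_out// mul0r.
rewrite (@reindex_fsbigT _ _ _ _ _ (act s) g (bij_act s)) (fsbigTE J).
  by apply: eq_bigr => j _; rewrite /g -actM.
move=> j jJ; rewrite /g eta_out ?mul0r//; apply: contra jJ => sj.
apply/imfset2P; exists s => //; exists (act s j) => //.
by rewrite -actM mulVg act1.
Qed.

End Multiplier.

(** * The multipliers of a controlled map *)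

Section QuasiLatticeOrder.
Context (G : groupType) (P : set G).
Hypothesis qloP : quasi_lattice_ordered P.
Implicit Types x y z w g : G.

Lemma ql_le_refl x : ql_le P x x.
Proof. by rewrite /ql_le mulVg; case: qloP. Qed.

Lemma ql_le_trans y x z : ql_le P x y -> ql_le P y z -> ql_le P x z.
Proof.
rewrite /ql_le => xy yz; have [_ PM _ _] := qloP.
by have := PM _ _ xy yz; rewrite -mulgA (mulgA y) mulgV mul1g.
Qed.

Lemma ql_le_anti x y : ql_le P x y -> ql_le P y x -> x = y.
Proof.
rewrite /ql_le => xy yx; have [_ _ Panti _] := qloP.
by apply/(mulgI x^-1%g); rewrite mulVg; apply/esym/Panti => //; rewrite invgM invgK.
Qed.

Lemma ql_le_mul2l g x y : ql_le P (g * x)%g (g * y)%g = ql_le P x y.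
Proof. by rewrite /ql_le invgM -mulgA (mulgA g^-1%g) mulVg mul1g. Qed.

Lemma ql_le1 x : ql_le P 1%g x = P x.
Proof. by rewrite /ql_le invg1 mul1g. Qed.

Lemma ql_join_mul2l g x y z : ql_join P x y z -> ql_join P (g * x)%g (g * y)%g (g * z)%g.
Proof.
move=> [[xz yz] zlub]; split; first by split; rewrite ql_le_mul2l.
move=> w [xw yw]; rewrite -[w](mulKg g^-1%g) invgK ql_le_mul2l; apply: zlub.
by split; rewrite -(ql_le_mul2l g) mulgA mulgV mul1g.
Qed.

(** [F] consists of the least upper bounds of sets of positions in [L]: finitely many sets, with at
    most one bound each, and the join of the bounds of [p] and [q] is the bound of their union. *)
Lemma finite_join_closure (L : seq G) : exists F : set G,
  [/\ finite_set F, forall x, x \in L -> F x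
    & forall x y z, F x -> F y -> ql_join P x y z -> F z].
Proof.
pose lub (p : {set 'I_(size L)}) z :=
  forall w, ql_le P z w <-> (forall i, i \in p -> ql_le P (nth 1%g L i) w).
exists [set z | exists p, lub p z]; split.
- apply: (@sub_finite_set _ _ [set xget 1%g [set z | lub p z] | p in [set: {set 'I_(size L)}]]).
    move=> z [p pz]; exists p => //; case: xgetP => [z' _ pz'|/(_ z)//].
    by apply: ql_le_anti; [apply/pz' => i ip|apply/pz => i ip];
      [apply: (pz z).1|apply: (pz' z').1]; rewrite ?ip//; exact: ql_le_refl.
  exact/finite_image/finite_finset.
- move=> x xL; have ix : (index x L < size L)%N by rewrite index_mem.
  exists [set Ordinal ix]%SET => w; split=> [xw i|]; last first.
    by move=> /(_ (Ordinal ix)); rewrite inE eqxx /= nth_index//; apply.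
  by rewrite inE => /eqP -> /=; rewrite nth_index.
- move=> x y z [p px] [q qy] [[xz yz] zlub]; exists (p :|: q)%SET => w; split.
    move=> zw i; rewrite inE => /orP[ip|iq].
      by apply: (px w).1 => //; exact: ql_le_trans zw.
    by apply: (qy w).1 => //; exact: ql_le_trans zw.
  move=> wub; apply: zlub; split; [apply/px => i ip|apply/qy => i iq];
    by apply: wub; rewrite inE ?ip ?iq ?orbT.
Qed.

End QuasiLatticeOrder.

(** * The largest candidate at each level *)

Section ControlledMultiplier.
Context (G H : groupType) (P : set G) (Q : set H) (phi : G -> H).
Context (X : invariant_space P).
Hypothesis (qloP : quasi_lattice_ordered P).
Hypothesis (ctrl : controlled_map P Q phi).
Implicit Types (x y : X) (s t p g : G) (h k : H).

Lemma controlled_morphM : {morph phi : s t / (s * t)%g}. Proof. by case: ctrl. Qed.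

Lemma controlled_morph1 : phi 1%g = 1%g.
Proof. by apply: (mulgI (phi 1%g)); rewrite -controlled_morphM !mulg1. Qed.

Lemma controlled_morphV t : phi t^-1%g = (phi t)^-1%g.
Proof. by apply: (mulgI (phi t)); rewrite -controlled_morphM !mulgV controlled_morph1. Qed.

Lemma val_theta_inv t x g : val x t -> val (theta t^-1%g x) g = val x (t * g)%g.
Proof. by move=> xt; rewrite val_theta ?invgK// /translate invgK. Qed.

Lemma val_directed x s t : val x s -> val x t -> exists2 z, ql_join P s t z & val x z.
Proof. by have [_ _] := inv_set_sub (set_mem (valP x)); exact. Qed.

Lemma ql_le_P p s : P p -> ql_le P p s -> P s.
Proof. by rewrite -!(ql_le1 P); exact: ql_le_trans. Qed.

Context (F : set H).
Hypotheses (finF : finite_set F)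
  (joinF : forall a b c, F a -> F b -> ql_join Q a b c -> F c).

Definition candidate h p : Prop := P p /\ F (h^-1 * phi p)%g.

Lemma finite_candidate h : finite_set (candidate h).
Proof.
have [_ phi_le ctrl1 _] := ctrl.
have -> : candidate h = \bigcup_(f in F) [set p | P p /\ phi p = (h * f)%g].
  apply/seteqP; split=> [p [Pp Fp]|p [f Ff [Pp pE]]].
    by exists (h^-1 * phi p)%g => //; split=> //; rewrite mulgA mulgV mul1g.
  by split=> //; rewrite pE mulgA mulVg mul1g.
apply: bigcup_finite => // f Ff.
(* (C1) concerns fibres over [Q]; over other points there is nothing of [P], as [phi] preserves the
   order. *)
have [Qf|Qf] := pselect (Q (h * f)%g); first exact: ctrl1.
apply: (@sub_finite_set _ _ set0) => // p [Pp pE]; apply: Qf.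
by rewrite -pE -ql_le1 -controlled_morph1; apply: phi_le; rewrite ql_le1.
Qed.

Lemma candidate_join h s t z : candidate h s -> candidate h t -> ql_join P s t z ->
  candidate h z.
Proof.
have [_ _ _ ctrl2] := ctrl.
move=> [Ps Fs] [Pt Ft] zj; split; first by apply: ql_le_P zj.1.1.
by apply: joinF Fs Ft _; apply: ql_join_mul2l; exact: ctrl2.
Qed.

Definition top_candidate h s x : Prop := [/\ candidate h s, val x s
  & forall p, candidate h p -> val x p -> ql_le P p s].

Lemma top_candidate_unique h s t x :
  top_candidate h s x -> top_candidate h t x -> s = t.
Proof.
by move=> [hs xs smax] [ht xt tmax]; apply: (ql_le_anti qloP); [exact: tmax|exact: smax].
Qed.

(** [F h^-1] makes 1 a candidate to start from. Candidates in [x] have a join, again a candidate in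
    [x], because [x] is directed; there are finitely many. *)
Lemma top_candidate_exists h x : F h^-1%g -> exists s, top_candidate h s x.
Proof.
move=> Fh; have h1 : candidate h 1%g.
  by split; [case: qloP|rewrite controlled_morph1 mulg1].
have /finite_seqP[l lE] := finite_candidate h.
suff [s [hs xs smax]] : exists s, [/\ candidate h s, val x s
    & forall p, p \in l -> candidate h p -> val x p -> ql_le P p s].
  by exists s; split=> // p hp xp; apply: smax => //; move: hp; rewrite lE.
elim: l {lE} => [|p l [s [hs xs smax]]]; first by exists 1%g; split=> //; exact: val_id.
have [[hp xp]|np] := pselect (candidate h p /\ val x p); last first.
  exists s; split=> // q; rewrite inE => /predU1P[-> hp xp|]; last exact: smax.
  by case: np.
have [z zj xz] := val_directed xs xp.
exists z; split=> //; first exact: candidate_join zj.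
move=> q; rewrite inE => /predU1P[->|ql] hq xq; first exact: zj.1.2.
by apply: (ql_le_trans qloP) zj.1.1; exact: smax.
Qed.

Lemma candidate_translate t z h s : ql_join P 1%g t z -> ql_le P z s ->
  candidate h s -> candidate ((phi t)^-1 * h)%g (t^-1 * s)%g.
Proof.
move=> [[_ tz] _] zs [_ Fs]; split.
  exact: ql_le_trans tz zs.
by rewrite controlled_morphM controlled_morphV invgM invgK -mulgA (mulgA (phi t)) mulgV mul1g.
Qed.

(* The point of the construction: passing from [x] to [t^-1 x] moves the largest
   candidate at level [h] to the largest candidate at level [phi(t)^-1 h]. *)
Lemma top_candidate_translate t z h s x : val x t -> ql_join P 1%g t z ->
  F (h^-1 * phi z)%g -> top_candidate h s x ->
  top_candidate ((phi t)^-1 * h)%g (t^-1 * s)%g (theta t^-1%g x).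
Proof.
move=> xt zj Fz [hs xs smax].
have Pz : P z by rewrite -ql_le1; exact: zj.1.1.
have xz : val x z.
  have [z' z'j xz'] := val_directed (val_id x) xt.
  by rewrite (ql_join_unique qloP zj z'j).
have hz : candidate h z by [].
(* The join [z] of 1 and [t] is a candidate in [x], so [s >= z >= t] and [t^-1 s] lies in [P]. *)
have zs : ql_le P z s by exact: smax.
split; first exact: candidate_translate zj zs hs.
  by rewrite val_theta_inv// mulgA mulgV mul1g.
(* For a competitor [p], [t p] may lie outside [P]. The join [w] of [p] and [t^-1 z] has [t w >= z],
   so [t w] is a candidate at level [h], and [t p <= t w <= s]. *)
move=> p kp yp; set y := theta _ _ in yp.
have kz : candidate ((phi t)^-1 * h)%g (t^-1 * z)%g.
  by apply: candidate_translate zj _ hz; exact: ql_le_refl.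
have yz : val y (t^-1 * z)%g by rewrite val_theta_inv// mulgA mulgV mul1g.
have [w wj yw] := val_directed yp yz.
have kw := candidate_join kp kz wj.
have zw : ql_le P z (t * w)%g.
  by rewrite -(ql_le_mul2l P t^-1%g) (mulgA t^-1%g) mulVg mul1g; exact: wj.1.2.
have hw : candidate h (t * w)%g.
  split; first exact: ql_le_P Pz zw.
  have := kw.2; rewrite invgM invgK controlled_morphM -mulgA; congr (F (_ * (_ * _))%g).
have ws : ql_le P (t * w)%g s by apply: smax => //; rewrite -val_theta_inv.
apply: (ql_le_trans qloP wj.1.1).
by rewrite -(ql_le_mul2l P t) (mulgA t t^-1%g) mulgV mul1g.
Qed.

End ControlledMultiplier.

Section ApproximateMultiplier.
Context (R : realType) (G H : groupType) (P : set G) (Q : set H) (phi : G -> H).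
Context (X : invariant_space P).
Hypotheses (qloP : quasi_lattice_ordered P) (qloQ : quasi_lattice_ordered Q).
Hypothesis (ctrl : controlled_map P Q phi).
Implicit Types (x y : X) (s t p g : G) (h k : H).

Definition pair_act t (i : H * G) : H * G := ((phi t * i.1)%g, (t * i.2)%g).

Lemma pair_act1 i : pair_act 1%g i = i.
Proof. by case: i => h s; rewrite /pair_act (controlled_morph1 ctrl) !mul1g. Qed.

Lemma pair_actM s t i : pair_act (s * t)%g i = pair_act s (pair_act t i).
Proof. by rewrite /pair_act (controlled_morphM ctrl) !mulgA. Qed.

(** If [i] and [t^-1 i] both lie in [S], then [t] is the quotient of their second coordinates. *)
Lemma mult_coef_finite (eta : H * G -> X -> R[i]) (S : {fset (H * G)%type}) :
  (forall i, i \notin S -> eta i = 0) ->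
  exists T : {fset G}, forall t x, t \notin T -> mult_coef pair_act eta S t x = 0.
Proof.
move=> eta0; exists [fset g in [seq (i.2 * j.2^-1)%g | i <- S, j <- S]]%fset.
move=> t x tT; rewrite /mult_coef big_seq big1// => i iS.
rewrite (eta0 (pair_act t^-1%g i)) ?mulr0//; apply: contra tT => jS.
rewrite inE; apply/allpairsP; exists (i, pair_act t^-1%g i); split=> //=.
by rewrite invgM invgK mulgA mulgV mul1g.
Qed.

Lemma val_near_seq x (l : seq G) : \forall y \near x, {in l, val y =1 val x}.
Proof.
elim: l => [|g l IH]; first by near=> y.
have gx := val_near x g; near=> y => p; rewrite inE => /predU1P[->|pl].
  by near: y; exact: gx.
by move: p pl; near: y.
Unshelve. all: by end_near. Qed.

(** Being the largest candidate depends only on which of the finitely many candidates lie in [x],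
    hence is locally constant; this makes [eta] continuous. *)
Lemma near_top_candidate (F : set H) h s x : finite_set F ->
  \forall y \near x, `[< top_candidate phi F h s y >] = `[< top_candidate phi F h s x >].
Proof.
move=> finF; have /finite_seqP[l lE] := finite_candidate ctrl finF h.
have := val_near_seq x l; apply: filterS => y yx.
have lP p : candidate P phi F h p -> p \in l by rewrite lE.
have E p : candidate P phi F h p -> val y p = val x p by move=> /lP /yx.
apply/asboolP/asboolP => -[hs vs smax]; split=> //.
- by rewrite -E.
- by move=> p hp xp; apply: smax; rewrite // E.
- by rewrite E.
- by move=> p hp xp; apply: smax; rewrite // -E.
Qed.

Lemma approximate_multiplier (T : seq G) (eps : R) : amenable_group R H -> 0 < eps ->
  exists (eta : H * G -> X -> R[i]) (S : {fset (H * G)%type}),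
  [/\ forall i, continuous (eta i),
      forall i x, (eta i x)^*%C = eta i x,
      forall i, i \notin S -> eta i = 0,
      forall x, mult_coef pair_act eta S 1%g x = 1
    & forall t, t \in T -> exists2 c : R[i], cmod (c - 1) <= eps
        & forall x, val x t -> mult_coef pair_act eta S t x = c].
Proof.
move=> amH eps0.
have [xi [SH [xi0 xiS xi1 xiT]]] := reiter_sqrt [seq phi t | t <- T] amH eps0.
(* The default 1 occurs only if 1 and [t] have no join, and then no [x] contains [t]. *)
pose join1 t := xget 1%g [set z | ql_join P 1%g t z].
have join1E t z : ql_join P 1%g t z -> join1 t = z.
  move=> zj; rewrite /join1; case: xgetP => [z' _ zj'|/(_ z)//].
  exact: ql_join_unique qloP zj' zj.
(* The [h^-1] make the largest candidate exist at each level in the support of [xi]; the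
   [h^-1 phi(1 \/ t)] are what [top_candidate_translate] requires. *)
pose L := [seq h^-1%g | h <- SH] ++
  [seq (h^-1 * phi (join1 t))%g | h <- SH, t <- 1%g :: T].
have [F [finF LF joinF]] := finite_join_closure qloQ L.
have F1 h : h \in SH -> F h^-1%g.
  by move=> hS; apply: LF; rewrite mem_cat map_f.
have FT h t : h \in SH -> t \in 1%g :: T -> F (h^-1 * phi (join1 t))%g.
  move=> hS tT; apply: LF; rewrite mem_cat; apply/orP; right.
  by apply/allpairsP; exists (h, t).
have finD : finite_set (\bigcup_(h in [set` SH]) candidate P phi F h).
  apply: bigcup_finite => [|h _]; first exact: finite_fset.
  exact: (finite_candidate ctrl finF h).
pose D := fset_set (\bigcup_(h in [set` SH]) candidate P phi F h).
have DP h s x : h \in SH -> top_candidate phi F h s x -> s \in D.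
  by move=> hS [hs _ _]; rewrite in_fset_set//; apply/mem_set; exists h.
pose eta (i : H * G) x : R[i] :=
  if `[< top_candidate phi F i.1 i.2 x >] then (xi i.1)%:C else 0.
pose l := [seq (h, s) | h <- SH, s <- D].
have ul : uniq l by apply: allpairs_uniq; rewrite ?fset_uniq// => -[? ?] [? ?].
pose S := [fset i in l]%fset.
have etaS i : i \notin S -> eta i = 0.
  case: i => h s; rewrite inE => iS; apply/funext => x; rewrite /eta /=.
  case: asboolP => // hs; have [hS|hS] := boolP (h \in SH); last by rewrite xiS.
  case/negP: iS; apply/allpairsP; exists (h, s); split=> //.
  exact: DP hs.
(* For each [h] only [s = s_h(x)] contributes, and [t^-1 s] is then the largest candidate at level
   [phi(t)^-1 h]. So the double sum collapses to the inner product of [xi] with its translate by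
   [phi(t)], whatever [x] in [U_t]. *)
have multE t x : t \in 1%g :: T -> val x t ->
    mult_coef pair_act eta S t x = (\sum_(h <- SH) xi h * xi ((phi t)^-1 * h)%g)%:C.
  move=> tT xt; rewrite /mult_coef.
  rewrite (perm_big l) /=; last first.
    by apply: uniq_perm; rewrite ?fset_uniq// => i; rewrite inE.
  rewrite big_allpairs /= [RHS]rmorph_sum [RHS]big_seq big_seq; apply: eq_bigr => h hS.
  set k := ((phi t)^-1 * h)%g.
  have etaE s : eta (pair_act t^-1%g (h, s)) (theta t^-1%g x) =
      if `[< top_candidate phi F k (t^-1 * s)%g (theta t^-1%g x) >] then (xi k)%:C else 0.
    by rewrite /eta /pair_act /= (controlled_morphV ctrl).
  have [kS|kS] := boolP (k \in SH); last first.
    rewrite (xiS k kS) mulr0 big1// => s _; rewrite etaE (xiS k kS).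
    by case: ifP; rewrite mulr0.
  have [z zj xz] := val_directed (val_id x) xt.
  have Fz : F (h^-1 * phi z)%g by rewrite -(join1E _ _ zj); exact: FT.
  have [s0 hs0] := top_candidate_exists qloP ctrl finF joinF x (F1 _ hS).
  have ks0 := top_candidate_translate qloP ctrl joinF xt zj Fz hs0.
  rewrite (big_fsetD1 s0) ?(DP _ _ _ hS hs0)//= big_seq big1 ?addr0.
    rewrite etaE /eta /= asboolT// asboolT// rmorphM//.
  move=> s; rewrite !inE => /andP[ss0 _]; rewrite /eta /=.
  case: asboolP => [hs|_]; last by rewrite mul0r.
  by rewrite (top_candidate_unique qloP hs hs0) eqxx in ss0.
exists eta, S; split=> //.
- move=> i x; apply: (@near_eq_cvg_to _ _ _ (fun=> eta i x)); last exact: cst_continuous.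
  have := near_top_candidate i.1 i.2 x finF.
  by apply: filterS => y yx; rewrite /eta yx.
- by move=> i x; rewrite /eta; case: ifP => _ /=; rewrite oppr0.
- move=> x; rewrite multE ?inE ?eqxx ?val_id// (controlled_morph1 ctrl) invg1.
  by under eq_bigr do rewrite mul1g; rewrite xi1.
- move=> t tT; exists (\sum_(h <- SH) xi h * xi ((phi t)^-1 * h)%g)%:C.
    by rewrite -rmorphB cmodR xiT// map_f.
  by move=> x xt; apply: multE; rewrite // inE tT orbT.
Qed.

End ApproximateMultiplier.

(** * Multipliers tending to the identity *)

Section Approximation.
Context (R : realType) (G H : groupType) (P : set G) (Q : set H) (phi : G -> H).
Context (X : invariant_space P).
Hypotheses (qloP : quasi_lattice_ordered P) (qloQ : quasi_lattice_ordered Q).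
Hypothesis (ctrl : controlled_map P Q phi) (amH : amenable_group R H).
Context (B C : cstarAlgType R) (iota : cp_alg R X -> B) (j : cp_alg R X -> C).
Hypotheses (ih : star_hom iota) (di : dense (range iota)).
Hypotheses (jh : star_hom j) (dj : dense (range j)).
Implicit Types (x y : X) (s t : G) (a b : cp_alg R X).

(** [F] keeps the coefficients in [T'] only and multiplies each by at most [#S], so sup bounds on
    the coefficients of [a] bound [iota (F a)]. Such bounds come from [jK] applied to [star a ** a];
    this is the crude constant that [positive_map_contractive] requires. The same count gives the
    last clause. *)
Lemma approximate_identity (T : seq G) (K eps : R) : 0 <= K -> 0 < eps ->
  (forall a x, cmod (a 1%g x) <= K * cnorm (j a)) ->
  exists F : cp_alg R X -> cp_alg R X,
  [/\ linear F,
      forall b, star b = b -> cnorm (iota (F b)) <= cnorm (j b),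
      forall a t x, t \in T -> cmod ((F a - a) t x) <= eps * cmod (a t x),
      forall a t, a t = 0 -> (F a - a) t = 0
    & exists2 K' : R, 0 <= K' & forall a c, 0 <= c ->
        (forall x, cmod ((star a ** a) 1%g x) <= c) ->
        cnorm (iota (F (star a ** a))) <= K' * c].
Proof.
move=> K0 eps0 jK.
have [eta [S [eta_cont eta_real eta0 eta1 etaT]]] :=
  approximate_multiplier X qloP qloQ ctrl T amH eps0.
have [T' T'0] := mult_coef_finite phi eta0.
(* As [eta] is real, [m_1 = 1] says that the squares of the [|eta_i(x)|] add up to 1. *)
have eta_le1 i x : cmod (eta i x) <= 1.
  have [iS|/eta0 ->] := boolP (i \in S); last by rewrite cmod0.
  rewrite -(@expr_le1 _ 2) ?cmod_ge0//.
  have := eta1 x; rewrite /mult_coef.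
  under eq_bigr => k _ do
    rewrite invg1 theta1 (pair_act1 ctrl) -{1}eta_real conj_mul_cmod.
  rewrite -rmorph_sum -[1](rmorph1 (real_complex R)) => /complexI <-.
  by rewrite (big_fsetD1 i)//= lerDl sumr_ge0// => k _; exact: sqr_ge0.
have mult_le t x : cmod (mult_coef (pair_act phi) eta S t x) <= #|` S|%:R.
  rewrite /mult_coef (le_trans (cmod_sum _ _))// -sum1_size natr_sum.
  by apply: ler_sum => i _; rewrite cmodM mulr_ile1 ?cmod_ge0.
have act1 := pair_act1 ctrl; have actM := pair_actM ctrl.
pose F := multiplier (pair_act phi) S eta_cont.
have FE a t x : F a t x = mult_coef (pair_act phi) eta S t x * a t x by [].
have F_bound a (c : R) : 0 <= c -> (forall t x, cmod (a t x) <= c) ->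
    cnorm (iota (F a)) <= (#|` S|%:R * #|` T'|%:R) * c.
  move=> c0 ac.
  have := @cnorm_iota_le R G P X B iota ih di (F a) T' (#|` S|%:R * c).
  rewrite mulrAC mulr_natr; apply.
  - by move=> t tT; apply/funext => x; rewrite FE T'0// mul0r.
  - by rewrite mulr_ge0.
  - by move=> t x; rewrite FE cmodM ler_pM ?cmod_ge0.
exists F; split.
- exact: multiplier_linear.
- apply: (positive_map_contractive (@cp_one_l R G P X) (@cp_one_r R G P X) ih di jh dj
    (K := #|` S|%:R * #|` T'|%:R * Num.sqrt K)).
  + exact: multiplier_linear.
  + exact: multiplier_one.
  + exact: multiplier_star_mul.
  + move=> a; rewrite -[leRHS]mulrA; apply: F_bound.
      by rewrite mulr_ge0 ?sqrtr_ge0 ?cnorm_ge0.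
    move=> t x; rewrite -ler_sqr ?nnegrE ?cmod_ge0 ?mulr_ge0 ?sqrtr_ge0 ?cnorm_ge0//.
    rewrite exprMn sqr_sqrtr// -cnorm_star_mul -(star_homS jh) -(star_homM jh).
    exact: cmod_coef_le.
- move=> a t x /etaT[c ceps cE].
  rewrite Defs.coefD cp_coefN FE.
  have [xt|xt] := boolP (val x t); last by rewrite coef_out// mulr0 subr0 cmod0 mulr0.
  by rewrite cE// -[X in _ - X]mul1r -mulrBl cmodM ler_wpM2r ?cmod_ge0.
- move=> a t at0; apply/funext => x; rewrite Defs.coefD cp_coefN FE at0.
  by rewrite mulr0 subr0.
- exists (#|` S|%:R * #|` T'|%:R); first by rewrite mulr_ge0.
  move=> a c c0 ac; apply: F_bound => // t x.
  exact: cmod_star_mul_le.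
Qed.

Lemma approximate_identity_norm a (K d : R) : 0 <= K -> 0 < d ->
  (forall b x, cmod (b 1%g x) <= K * cnorm (j b)) ->
  exists F : cp_alg R X -> cp_alg R X,
  [/\ linear F,
      forall b, star b = b -> cnorm (iota (F b)) <= cnorm (j b),
      cnorm (iota a) <= cnorm (iota (F a)) + d
    & exists2 K' : R, 0 <= K' & forall b c, 0 <= c ->
        (forall x, cmod ((star b ** b) 1%g x) <= c) ->
        cnorm (iota (F (star b ** b))) <= K' * c].
Proof.
move=> K0 d0 jK.
pose c := Num.sqrt (K * cnorm (j a) ^+ 2).
have c0 : 0 <= c by exact: sqrtr_ge0.
have ac t x : cmod (a t x) <= c.
  rewrite -ler_sqr ?nnegrE ?cmod_ge0// sqr_sqrtr ?mulr_ge0 ?sqr_ge0 ?cnorm_ge0//.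
  rewrite -cnorm_star_mul -(star_homS jh) -(star_homM jh); exact: cmod_coef_le.
(* [a] has [#|supp a|] coefficients, of modulus at most [c]; a relative error of [d / M] in each
   costs at most [d]. *)
pose M := c * #|` supp a|%:R + 1.
have M0 : 0 < M by rewrite ltr_wpDl// mulr_ge0.
have dM : 0 < d / M by rewrite divr_gt0.
have [F [Fl Fsa FT Fout FK]] := approximate_identity (supp a) K0 dM jK.
exists F; split=> //.
have aE : a = F a - (F a - a) by rewrite opprB addrC subrK.
have Fa : cnorm (iota (F a - a)) <= d.
  have : cnorm (iota (F a - a)) <= (d / M * c) *+ #|` supp a|.
    apply: (cnorm_iota_le ih di) => [t|| t x].
    - by move=> /notin_supp; exact: Fout.
    - by rewrite mulr_ge0// ltW.
    - have [ta|ta] := boolP (t \in supp a).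
        by rewrite (le_trans (FT _ _ _ ta))// ler_wpM2l// ltW.
      by rewrite Fout ?notin_supp// cmod0 mulr_ge0// ltW.
  move=> /le_trans; apply.
  rewrite -mulr_natr -mulrA mulrAC ler_pdivrMr// ler_wpM2l ?(ltW d0)//.
  by rewrite /M lerDl.
by rewrite {1}aE (star_homB ih) (le_trans (cnormB _ _))// lerD2l.
Qed.

End Approximation.

(** * The full and the reduced crossed product *)

Section IsometricExtension.
Context (R : realType) (A : starAlgType R).
Implicit Types (d : R).

(** The closure of the set of pairs [(i a, j a)], which is the graph of the extension. It is
    symmetric in [i] and [j], so the inverse comes from the same construction. *)
Definition limit_pair (B C : cstarAlgType R) (i : A -> B) (j : A -> C) (b : B) (y : C) :=
  forall d, 0 < d -> exists a, cnorm (i a - b) < d /\ cnorm (j a - y) < d.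

Lemma limit_pair_sym (B C : cstarAlgType R) (i : A -> B) (j : A -> C) b y :
  limit_pair i j b y -> limit_pair j i y b.
Proof. by move=> ij d /ij[a [h1 h2]]; exists a. Qed.

Section Pair.
Context (B C : cstarAlgType R) (i : A -> B) (j : A -> C).
Hypotheses (ih : star_hom i) (di : dense (range i)) (jh : star_hom j).
Hypothesis ij : forall a, cnorm (j a) = cnorm (i a).

Lemma limit_pair_exists b : exists y, limit_pair i j b y.
Proof.
have half : 0 <= (2^-1 : R) < 1 by rewrite invr_ge0 ler0n invf_lt1// ltr1n.
have [u uE] : exists u : nat -> A, forall n, cnorm (i (u n) - b) < 2^-1 ^+ n.
  have H n : exists a, cnorm (i a - b) < 2^-1 ^+ n.
    by apply: dense_cnorm => //; rewrite exprn_gt0 ?invr_gt0.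
  by have [u uE] := choice H; exists u.
have uN d : 0 < d -> exists N, forall n, (N <= n)%N -> cnorm (i (u n) - b) < d.
  move=> d0; have [N Nd] := @expr_small R 2^-1 d half d0; exists N => n Nn.
  apply: lt_trans (uE n) _; apply: le_lt_trans Nd.
  by apply: ler_wiXn2l => //; case/andP: half => // _ /ltW.
have [|y yE] := @cauchy_cnorm R C (j \o u).
  move=> d d0; have d2 : 0 < d / 2 by rewrite divr_gt0.
  have [N hN] := uN _ d2; exists N => m n Nm Nn /=.
  rewrite -(star_homB jh) ij (star_homB ih) -(subrKA b) [ltRHS]splitr.
  by rewrite (le_lt_trans (cnormD _ _))// ltrD ?hN// cnorm_distC hN.
exists y => d d0; have [N hN] := uN _ d0; have [M hM] := yE _ d0.
by exists (u (maxn N M)); rewrite hN ?leq_maxl// hM ?leq_maxr.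
Qed.

Lemma limit_pair_unique b y y' : limit_pair i j b y -> limit_pair i j b y' -> y = y'.
Proof.
move=> h h'; apply/eqP; rewrite -subr_eq0; apply/eqP.
apply: (@cnorm_eq0P _ _ _ 4) => d d0.
have [a [/ltW ab /ltW ay]] := h d d0; have [a' [/ltW ab' /ltW ay']] := h' d d0.
rewrite -(subrKA (j a)) (le_trans (cnormD _ _))// -(subrKA (j a') (j a)).
have -> : 4 * d = d + ((d + d) + d) by ring.
apply: lerD; first by rewrite cnorm_distC.
apply: (le_trans (cnormD _ _)); apply: lerD => //.
rewrite -(star_homB jh) ij (star_homB ih) -(subrKA b).
by rewrite (le_trans (cnormD _ _))// lerD// cnorm_distC.
Qed.

End Pair.

Section Operations.
Context (B C : cstarAlgType R) (i : A -> B) (j : A -> C).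
Hypotheses (ih : star_hom i) (jh : star_hom j).

Lemma limit_pair_image a : limit_pair i j (i a) (j a).
Proof. by move=> d d0; exists a; rewrite !subrr !cnorm0. Qed.

Lemma limit_pairD b y b' y' : limit_pair i j b y -> limit_pair i j b' y' ->
  limit_pair i j (b + b') (y + y').
Proof.
move=> h h' d d0; have d2 : 0 < d / 2 by rewrite divr_gt0.
have [a [ab ay]] := h _ d2; have [a' [ab' ay']] := h' _ d2; exists (a + a').
have H (D : cstarAlgType R) (u v w z : D) : cnorm (u - w) < d / 2 ->
    cnorm (v - z) < d / 2 -> cnorm (u + v - (w + z)) < d.
  by move=> uw vz; rewrite opprD addrACA [ltRHS]splitr (le_lt_trans (cnormD _ _))// ltrD.
by rewrite (star_homD ih) (star_homD jh); split; exact: H.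
Qed.

Lemma limit_pairZ k b y : limit_pair i j b y -> limit_pair i j (k *: b) (k *: y).
Proof.
move=> h d d0; have k0 : 0 < cmod k + 1 by rewrite ltr_wpDl// cmod_ge0.
have dk : 0 < d / (cmod k + 1) by rewrite divr_gt0.
have [a [ab ay]] := h _ dk; exists (k *: a).
rewrite (star_homZ ih) (star_homZ jh) -!scalerBr !cnormZ -/(cmod k).
have H (z : R) : 0 <= z -> z < d / (cmod k + 1) -> cmod k * z < d.
  move=> z0; rewrite ltr_pdivlMr// => zd; apply: le_lt_trans zd.
  by rewrite mulrC ler_wpM2l// lerDl.
by split; apply: H; rewrite ?cnorm_ge0.
Qed.

Lemma limit_pairS b y : limit_pair i j b y -> limit_pair i j (star b) (star y).
Proof.
move=> h d /h[a [ab ay]]; exists (star a).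
by rewrite (star_homS ih) (star_homS jh) -!starB !cnorm_star.
Qed.

Lemma cnorm_mul_near (D : cstarAlgType R) (u v b b' : D) (r M : R) : r <= 1 ->
  cnorm b + cnorm b' + 1 <= M -> 0 < r ->
  cnorm (u - b) < r -> cnorm (v - b') < r -> cnorm (u ** v - b ** b') < M * r.
Proof.
move=> r1 bM r0 ub vb'.
have -> : u ** v - b ** b' = u ** (v - b') + (u - b) ** b'.
  by rewrite smulBr smulBl subrKA.
have un : cnorm u < cnorm b + 1.
  rewrite -(subrK b u) (le_lt_trans (cnormD _ _))// addrC ltrD2l.
  exact: lt_le_trans ub r1.
have b0 := cnorm_ge0 b; have b'0 := cnorm_ge0 b'.
apply: (@lt_le_trans _ _ ((cnorm b + cnorm b' + 1) * r)); last first.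
  by rewrite ler_wpM2r// ltW.
have -> : (cnorm b + cnorm b' + 1) * r = (cnorm b + 1) * r + r * cnorm b' by ring.
apply: (le_lt_trans (cnormD _ _)); apply: ltr_leD.
  by apply: (le_lt_trans (cnormM _ _)); rewrite ltr_pM ?cnorm_ge0.
by rewrite (le_trans (cnormM _ _))// ler_wpM2r// ltW.
Qed.

Lemma limit_pairM b y b' y' : limit_pair i j b y -> limit_pair i j b' y' ->
  limit_pair i j (b ** b') (y ** y').
Proof.
move=> h h' d d0.
pose M := (cnorm b + cnorm b' + 1) + (cnorm y + cnorm y' + 1).
have M0 : 0 < M by rewrite addr_gt0// ltr_wpDl// addr_ge0 ?cnorm_ge0.
pose r := Num.min 1 (d / M).
have r0 : 0 < r by rewrite lt_min ltr01 divr_gt0.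
have r1 : r <= 1 by rewrite ge_min lexx.
have rM : M * r <= d by rewrite mulrC -ler_pdivlMr// ge_min lexx orbT.
have [a [ab ay]] := h _ r0; have [a' [ab' ay']] := h' _ r0; exists (a ** a').
rewrite (star_homM ih) (star_homM jh).
by split; apply: lt_le_trans rM; apply: cnorm_mul_near => //;
  rewrite /M ?lerDl ?lerDr addr_ge0// addr_ge0 ?cnorm_ge0.
Qed.

End Operations.

Lemma isometric_extension (B C : cstarAlgType R) (i : A -> B) (j : A -> C) :
  star_hom i -> dense (range i) -> star_hom j -> dense (range j) ->
  (forall a, cnorm (j a) = cnorm (i a)) ->
  exists L : B -> C, [/\ star_hom L, forall a, L (i a) = j a & bijective L].
Proof.
move=> ih di jh dj ij; have ji a : cnorm (i a) = cnorm (j a) by rewrite ij.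
have [L LE] := choice (limit_pair_exists ih di jh ij).
have [L' L'E] := choice (limit_pair_exists jh dj ih ji).
have uniq_r b y y' := @limit_pair_unique B C i j ih jh ij b y y'.
have uniq_l b y y' := @limit_pair_unique C B j i jh ih ji b y y'.
exists L; split; first split.
- move=> k b b'; apply: (uniq_r _ _ _ (LE _)).
  by apply: limit_pairD => //; exact: limit_pairZ.
- by move=> b b'; apply: (uniq_r _ _ _ (LE _)); exact: limit_pairM.
- by move=> b; apply: (uniq_r _ _ _ (LE _)); exact: limit_pairS.
- by move=> a; apply: (uniq_r _ _ _ (LE _)); exact: limit_pair_image.
- exists L' => [b|y].
    exact: uniq_l (L'E (L b)) (limit_pair_sym (LE b)).
  exact: uniq_r (LE (L' y)) (limit_pair_sym (L'E y)).
Qed.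

End IsometricExtension.

(** * Compactness of [X] and a lower bound for the reduced norm *)

Section Compactness.
Context (R : realType) (G : groupType) (P : set G) (X : invariant_space P).

Lemma compact_invariant_space : compact [set: X].
Proof.
have cX : compact (inv_set X).
  apply: (@subclosed_compact _ _ setT); [exact: inv_set_closed| |by []].
  have -> : [set: {ptws G -> bool}] = [set f | forall g : G, [set: bool] (f g)].
    by apply/seteqP; split.
  exact: (@tychonoff G (fun=> bool) (fun=> setT) (fun=> bool_compact)).
move=> F FF _.
have FX : F [set x : X | inv_set X (val x)].
  apply: (filterS _ (filterT (F := F))) => x _; exact: (set_mem (valP x)).
have [w [Xw clw]] := cX _ (fmap_proper_filter _ FF) FX.
exists (exist _ w (mem_set Xw)); split=> // U V FU [V' [[W oW WV] V'x V'V]].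
have FU' : F [set y : X | [set val x | x in U] (val y)].
  by apply: filterS FU => x Ux; exists x.
have Ww : nbhs w W.
  by apply: open_nbhs_nbhs; split=> //; move: V'x; rewrite -WV.
have [_ [[x Ux <-] Wx]] := clw _ _ FU' Ww.
by exists x; split=> //; apply: V'V; rewrite -WV.
Qed.

Lemma cmod_le_sup_norm (f : X -> R[i]) x : continuous f -> cmod (f x) <= sup_norm f.
Proof.
move=> cf; apply: ub_le_sup; last by exists x.
have X0 : [set: X] !=set0 by exists x.
have cu : {within [set: X], continuous (fun y => cmod (f y))}.
  by apply: continuous_subspaceT; exact: cmod_continuous.
have [c _ cmax] := compact_EVT_max X0 compact_invariant_space cu.
by exists (cmod (f c)) => _ [y _ <-]; apply: cmax; rewrite inE.
Qed.

(** Test vector [delta_e], of norm at most 1: the square of the norm of [a delta_e] is the sup norm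
    of the coefficient of [star a ** a] at 1. *)
Lemma reduced_norm_ge (a : cp_alg R X) x : ((cmod (a 1%g x))%:E <= reduced_norm a)%E.
Proof.
have ca : continuous ((star a ** a) 1%g) by have [] := coef_C0U (star a ** a) 1%g.
have one1 : sup_norm (cp_inner (cp_one R X) (cp_one R X)) <= 1.
  apply: ge_sup; first by exists (cmod (cp_inner (cp_one R X) (cp_one R X) x)); exists x.
  move=> _ [y _ <-]; rewrite -/(cmod _) /cp_inner cp_one_r.
  rewrite star_mono1E eqxx conjc1.
  by rewrite /cmod normr1.
apply: (@le_trans _ _ (Num.sqrt (sup_norm (cp_inner (a ** cp_one R X) (a ** cp_one R X))))%:E).
  rewrite cp_one_r /cp_inner lee_fin.
  have s0 : 0 <= sup_norm ((star a ** a) 1%g).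
    by apply: le_trans (cmod_le_sup_norm x ca); exact: cmod_ge0.
  rewrite -ler_sqr ?nnegrE ?cmod_ge0 ?sqrtr_ge0// sqr_sqrtr//.
  by apply: cmod_coef_le => y; exact: cmod_le_sup_norm.
by apply: ereal_sup_ubound; exists (cp_one R X).
Qed.

End Compactness.

Lemma cstar_seminorm_cnorm (R : realType) (A : starAlgType R) (B : cstarAlgType R)
  (i : A -> B) : star_hom i -> cstar_seminorm (fun a => cnorm (i a)).
Proof.
move=> ih; split=> [x y|k x|x y|x] /=.
- by rewrite (star_homD ih) cnormD.
- by rewrite (star_homZ ih) cnormZ rmorphM /= -normcRe.
- by rewrite (star_homM ih) cnormM.
- by rewrite (star_homM ih) (star_homS ih) cnorm_star_mul.
Qed.

(** Some ball of radius [d] around 0 goes into functions of modulus below 1; rescaling [b] to norm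
    [d / 2] gives the constant [2 / d]. *)
Lemma uniform_continuous_bounded (R : realType) (T : choiceType) (B : cstarAlgType R)
  (Phi : B -> T -> R[i]) : linear Phi -> continuous (Phi : B -> {uniform T -> R[i]}) ->
  exists2 K : R, 0 <= K & forall b x, cmod (Phi b x) <= K * cnorm b.
Proof.
move=> Phil Phic.
have Phi0 : Phi 0 = 0.
  by have := Phil (-1) 0 0; rewrite scaler0 addr0 scaleN1r addNr.
have PhiZ k b : Phi (k *: b) = k *: Phi b.
  by have := Phil k b 0; rewrite addr0 Phi0 addr0.
pose E := [set zw : R[i] * R[i] | ball zw.1 (1 : R[i]) zw.2].
have entE : entourage E by rewrite -entourage_ballE; exists (1 : R[i]) => //=.
have : nbhs (0 : B) (Phi @^-1` [set h : {uniform T -> R[i]} | forall y, E (Phi 0 y, h y)]).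
  by apply: Phic; apply/uniform_nbhs; exists E; split=> // h hE y; exact: hE.
move=> /nbhs_ballP[d /= d0 dE].
have dR : d = (complex.Re d)%:C.
  by rewrite -(gtr0_norm d0) -normcRe.
have rd0 : 0 < complex.Re d by rewrite -ltcR -dR.
exists (2 / complex.Re d) => [|b x]; first by rewrite divr_ge0// ltW.
have [->|b0] := eqVneq b 0; first by rewrite Phi0 cmod0 cnorm0 mulr0.
have nb : 0 < cnorm b.
  rewrite lt_def cnorm_ge0 andbT; apply: contra b0 => /eqP nb0.
  by rewrite (cnorm0_eq0 nb0).
pose s := complex.Re d / 2 / cnorm b.
have s0 : 0 < s by rewrite !divr_gt0.
have : E (Phi 0 x, Phi (s%:C *: b) x).
  apply: dE; rewrite -ball_normE /= sub0r normrN cnormE cnormZR dR ltcR gtr0_norm//.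
  by rewrite divfK ?gt_eqF// ltr_pdivrMr// ltr_pMr// ltr1n.
rewrite /E /= -ball_normE /= Phi0 sub0r normrN PhiZ cmodE -[1](rmorph1 (real_complex R)) ltcR.
rewrite -[X in cmod X]/(s%:C * Phi b x) cmodM cmodR gtr0_norm// => /ltW h.
rewrite -(ler_pM2l s0) (le_trans h)// /s.
rewrite le_eqVlt; apply/orP; left; apply/eqP.
by field; rewrite !gt_eqF.
Qed.

(** * Faithfulness and amenability *)

Section Main.
Context (R : realType) (G H : groupType) (P : set G) (Q : set H) (phi : G -> H).
Context (X : invariant_space P).
Hypotheses (qloP : quasi_lattice_ordered P) (qloQ : quasi_lattice_ordered Q).
Hypothesis (ctrl : controlled_map P Q phi) (amH : amenable_group R H).

(** [F] is chosen for [p0], whose norm it almost does not decrease, and comes with an uncontrolled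
    constant [K']. Only then is [a1] taken so close to [c] that [K'] times the coefficient of [p1]
    at 1, small because [Phi b = 0], is at most [d]. Contractivity of [F] on the self-adjoint
    [p0 - p1] carries this over to [p0]. *)
Lemma conditional_expectation_faithful (B : cstarAlgType R) (iota : cp_alg R X -> B)
    (Phi : B -> X -> R[i]) :
  star_hom iota -> dense (range iota) -> conditional_expectation iota Phi ->
  faithful_on_positive Phi.
Proof.
move=> ih di [Phil Phic _ PhiE] b [c bE] Phib.
have [K K0 PhiK] := uniform_continuous_bounded Phil Phic.
have aK (a : cp_alg R X) (x : X) : cmod (a 1%g x) <= K * cnorm (iota a) by rewrite -PhiE.
have PhiB u v (x : X) : Phi (u - v) x = Phi u x - Phi v x.
  rewrite (addrC u) -scaleN1r Phil.
  by rewrite -[LHS]/(-1 * Phi v x + Phi u x) mulN1r addrC.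
pose M := 2 * cnorm c + 1.
have M0 : 0 < M by rewrite ltr_wpDl// mulr_ge0// cnorm_ge0.
have near_b (a : cp_alg R X) (r : R) : r <= 1 -> 0 < r -> cnorm (iota a - c) < r ->
    cnorm (iota (star a ** a) - b) < M * r.
  move=> r1 r0 ar; rewrite bE (star_homM ih) (star_homS ih).
  apply: cnorm_mul_near => //; first by rewrite cnorm_star /M mulr2n mulrDl mul1r.
  by rewrite -starB cnorm_star.
(* The constant adds up [|F (p0 - p1)| <= 2 M d], [|F p1| <= d], the loss [d] of [F] at [p0], and
   [|p0 - b| <= M d]. The cap of [d] at 1 serves [near_b]. *)
apply: (@cnorm_eq0P _ _ _ (3 * M + 2)) => d' d'0.
pose d := Num.min 1 d'.
have d0 : 0 < d by rewrite lt_min ltr01.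
have d1 : d <= 1 by rewrite ge_min lexx.
suff : cnorm b <= (3 * M + 2) * d.
  move=> /le_trans; apply; rewrite ler_wpM2l//.
    by rewrite addr_ge0// mulr_ge0// ltW.
  by rewrite ge_min lexx orbT.
have [a0 a0c] := dense_cnorm di c d0.
pose p0 := star a0 ** a0.
have [F [Fl Fsa Fp0 [K' K'0 FK]]] :=
  approximate_identity_norm qloP qloQ ctrl amH ih di ih di p0 K0 d0 aK.
pose N := K' * (K * M) + 1.
have N0 : 0 < N by rewrite ltr_wpDl// mulr_ge0// mulr_ge0// ltW.
pose r := Num.min d (d / N).
have r0 : 0 < r by rewrite lt_min d0 divr_gt0.
have rd : r <= d by rewrite ge_min lexx.
have rN : N * r <= d by rewrite mulrC -ler_pdivlMr// ge_min lexx orbT.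
have [a1 a1c] := dense_cnorm di c r0.
pose p1 := star a1 ** a1.
have p0b := ltW (near_b _ _ d1 d0 a0c).
have p1b := ltW (near_b _ _ (le_trans rd d1) r0 a1c).
have FD u v : F (u + v) = F u + F v by have := Fl 1 u v; rewrite !scale1r.
have Fp1 : cnorm (iota (F p1)) <= d.
  apply: le_trans rN; apply: (le_trans (FK a1 (K * M * r) _ _)).
  - by rewrite !mulr_ge0// ltW.
  - move=> x; rewrite -PhiE -[X in cmod X]subr0.
    have -> : 0 = Phi b x by rewrite Phib.
    rewrite -PhiB (le_trans (PhiK _ _))// -mulrA ler_wpM2l//.
  - by rewrite mulrA ler_wpM2r ?(ltW r0)// /N lerDl.
have Fdiff : cnorm (iota (F (p0 - p1))) <= 2 * M * d.
  apply: (le_trans (Fsa _ _)).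
    by rewrite starB /p0 /p1 !starM !starK.
  rewrite (star_homB ih) -(subrKA b) (le_trans (cnormD _ _))//.
  rewrite -mulrA mulr2n mulrDl mul1r lerD//.
  by rewrite cnorm_distC (le_trans p1b)// ler_wpM2l// ltW.
have -> : b = iota p0 - (iota p0 - b) by rewrite opprB addrC subrK.
rewrite (le_trans (cnormB _ _))//.
have : cnorm (iota (F p0)) <= 2 * M * d + d.
  rewrite -(subrK p1 p0) FD (star_homD ih) (le_trans (cnormD _ _))// lerD//.
have -> : (3 * M + 2) * d = ((2 * M * d + d) + d) + M * d by ring.
by move=> h; rewrite lerD// (le_trans Fp0)// lerD2r.
Qed.

Lemma full_norm_le_reduced (B C : cstarAlgType R) (iota : cp_alg R X -> B)
    (lambda : cp_alg R X -> C) :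
  star_hom iota -> dense (range iota) -> reduced_crossed_product lambda ->
  forall a, cnorm (iota a) <= cnorm (lambda a).
Proof.
move=> ih di [jh dj jE] a.
have aK (b : cp_alg R X) (x : X) : cmod (b 1%g x) <= 1 * cnorm (lambda b).
  by rewrite mul1r -lee_fin jE; exact: reduced_norm_ge.
have sa (b : cp_alg R X) : star b = b -> cnorm (iota b) <= cnorm (lambda b).
  move=> sb; apply/ler_addgt0Pr => d d0.
  have [F [_ Fsa Fb _]] :=
    approximate_identity_norm qloP qloQ ctrl amH ih di jh dj b ler01 d0 aK.
  by rewrite (le_trans Fb)// lerD2r Fsa.
rewrite -ler_sqr ?nnegrE ?cnorm_ge0// -!cnorm_star_mul.
rewrite -(star_homS ih) -(star_homM ih) -(star_homS jh) -(star_homM jh).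
by apply: sa; rewrite starM starK.
Qed.

(** The norm of [lambda] is one of the C*-seminorms whose supremum is the full norm; with
    [full_norm_le_reduced] the two norms agree on the finite sums, and the identity extends to the
    completions. *)
Lemma amenable_of_controlled_map : amenable_partial_action R X.
Proof.
move=> B C iota lambda [ih di iE] red; have [jh dj jE] := red.
apply: isometric_extension => // a; apply/eqP; rewrite eq_le.
rewrite (full_norm_le_reduced ih di red) andbT -lee_fin -/(complex.Re _) iE.
apply: ereal_sup_ubound; exists (fun b => cnorm (lambda b)) => //.
exact: cstar_seminorm_cnorm.
Qed.

End Main.

Theorem theorem4p7 (R : realType) (G H : groupType) (P : set G) (Q : set H)
    (phi : G -> H) (X : invariant_space P) :
  countable [set: G]%classic -> countable [set: H]%classic ->
  quasi_lattice_ordered P -> quasi_lattice_ordered Q ->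
  controlled_map P Q phi ->
  amenable_group R H ->
  (forall (B : cstarAlgType R) (iota : cp_alg R X -> B)
      (Phi : B -> X -> complex R),
    full_crossed_product iota -> conditional_expectation iota Phi ->
    faithful_on_positive Phi)
  /\ amenable_partial_action R X.
Proof.
move=> _ _ qloP qloQ ctrl amH; split=> [B iota Phi [ih di _] ce|].
  exact: (conditional_expectation_faithful qloP qloQ ctrl amH ih di ce).
exact: (amenable_of_controlled_map qloP qloQ ctrl amH).
Qed.
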